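(* Let $\kappa\in(0,1)$, $\delta>0$, $\lambda>0$, let $q^*\ge2$ be a fixed integer, and let $\gamma\ge\max\{(2q^* )^\kappa,4^\kappa\}$. Let $X(t)$ be a stationary Ornstein-Uhlenbeck (OU) type process with parameter $\lambda$ and tempered stable $TS(\kappa,\delta,\gamma)$ marginal distributions (see context), let $$\Lambda(t)=\exp\{X(t)-c_X\},\qquad c_X=\delta\gamma-\delta\bigl(\gamma^{1/\kappa}-2\bigr)^\kappa,$$ and let $\Lambda^{(j)}$, $j=0,1,2,\dots$, be independent copies of $\Lambda$. Put $$Q=\Bigl\{q:0<q<\frac{\gamma^{1/\kappa}}2\Bigr\}\cap[0,q^*].$$ Then, for any $$b>\exp\left\{-\gamma\delta+\frac{\delta}{1-q^*}\bigl(\gamma^{1/\kappa}-2q^*\bigr)^\kappa-\frac{q^*}{1-q^*}\,\delta\bigl(\gamma^{1/\kappa}-2\bigr)^\kappa\right\},$$ the stochastic processes $$A_n(t)=\int_0^t\prod_{j=0}^n\Lambda^{(j)}(sb^j)\,ds,\qquad t\in[0,1],$$ converge in $\mathcal{L}_q$ to a stochastic process $A(t)$ for each fixed $t\in[0,1]$ as $n\to\infty$, such that $A(1)\in\mathcal{L}_q$ for $q\in Q$, and $$\mathrm{E}A^q(t)\sim t^{\varsigma(q)},$$ where the scaling function $\varsigma(q)$ is given by $$\varsigma(q)=q\left(1+\frac{\delta\gamma}{\log b}-\frac{\delta}{\log b}\bigl(\gamma^{1/\kappa}-2\bigr)^\kappa\right)+\frac{\delta}{\log b}\bigl(\gamma^{1/\kappa}-2q\bigr)^\kappa-\frac{\delta\gamma}{\log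 b},\qquad q\in Q.$$ Moreover, $$\mathrm{Var}\,A(t)\ge\int_0^t\!\!\int_0^t\bigl[M(1,1;u-w)-1\bigr]\,du\,dw,$$ where $M(1,1;t_1-t_2)=e^{-2c_X}\,\mathrm{E}\exp\{X(t_1)+X(t_2)\}$.
   Context: Tempered stable law $TS(\kappa,\delta,\gamma)$, $\kappa\in(0,1)$, $\delta>0$, $\gamma>0$: the distribution on $(0,\infty)$ with density $e^{\delta\gamma}s_{\kappa,\delta}(x)e^{-\frac x2\gamma^{1/\kappa}}$, where $s_{\kappa,\delta}$ is the density of the positive $\kappa$-stable law with $\log\int_0^\infty e^{-\zeta x}s_{\kappa,\delta}(x)dx=-\delta(2\zeta)^\kappa$, $\zeta>0$. Its cumulant transform is $\log\mathrm{E}e^{\zeta X}=\delta\gamma-\delta(\gamma^{1/\kappa}-2\zeta)^\kappa$ for $0<\zeta<\gamma^{1/\kappa}/2$. It is self-decomposable. Stationary OU type process with a given self-decomposable marginal law $D$ and parameter $\lambda>0$: a strictly stationary process with $X(0)\sim D$ and $X(t)=e^{-\lambda t}X(0)+\int_{(0,t]}e^{-\lambda(t-s)}\,dZ(\lambda s)$, $t\ge0$, where $Z$ is a L\'evy process independent of $X(0)$ (the background driving L\'evy process, determined by $D$). The mother process $\Lambda$ is measurable and separable. Convergence in $\mathcal{L}_q$ (for $q\in Q$) means $\mathrm{E}|A_n(t)-A(t)|^q\to0$. Notation: $\mathrm{E}A^q(t)\sim t^{p}$ means that there are constants $0<\underline{C}\le\overline{C}<\infty$ (possibly depending on $q$ but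 not on $t$) with $\underline{C}\,t^{p}\le\mathrm{E}A^q(t)\le\overline{C}\,t^{p}$ for all $t\in[0,1]$. *)

(* Defs.v *)
(* Time is [0, +oo[: a process is a function R -> T -> R of which only the values
   at nonnegative times are ever used. *)
From HB Require Import structures.
From mathcomp Require Import all_boot all_order all_algebra.
From mathcomp Require Import all_classical all_reals all_analysis.

Set Implicit Arguments.
Unset Strict Implicit.
Unset Printing Implicit Defensive.

Import Order.TTheory GRing.Theory Num.Theory.
Import numFieldNormedType.Exports.

Local Open Scope classical_set_scope.
Local Open Scope ring_scope.

Section processes.
Context d (T : measurableType d) (R : realType) (P : probability T R).

Definition process (X : R -> T -> R) : Prop :=
  forall t : R, 0 <= t -> measurable_fun setT (X t).

Definition sigma_rv (f : T -> R) : set (set T) :=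
  preimage_set_system setT f measurable.

Definition sigma_process (X : R -> T -> R) : set (set T) :=
  <<s \bigcup_(t in `[0, +oo[) sigma_rv (X t) >>.

Definition indep2 (F G : set (set T)) : Prop :=
  forall A B, F A -> G B -> P (A `&` B) = (P A * P B)%E.

Definition mutually_indep (I : eqType) (F : I -> set (set T)) : Prop :=
  forall (s : seq I) (E : I -> set T), uniq s ->
    (forall i, i \in s -> F i (E i)) ->
    P (\bigcap_(i in [set` s]) E i) = (\prod_(i <- s) P (E i))%E.

Definition at_times n (t : n.-tuple R) (X : R -> T -> R) (w : T) :
    n.-tuple (measurableTypeR R) :=
  [tuple X (tnth t i) w | i < n].

Definition same_fdd (X Y : R -> T -> R) : Prop :=
  forall n (t : n.-tuple R) (B : set (n.-tuple (measurableTypeR R))),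
    (forall i, 0 <= tnth t i) -> measurable B ->
    P (at_times t X @^-1` B) = P (at_times t Y @^-1` B).

Definition strictly_stationary (X : R -> T -> R) : Prop :=
  forall h : R, 0 <= h -> same_fdd (fun t => X (t + h)) X.

Definition measurable_process (X : R -> T -> R) : Prop :=
  measurable_fun ([set t : measurableTypeR R | 0 <= t] `*` setT)
    (fun p : measurableTypeR R * T => X p.1 p.2).

(* Doob separability, with respect to closed sets.  Taking F = set0 shows that
   the separant S is dense in [0, +oo[. *)
Definition separable_process (X : R -> T -> R) : Prop :=
  exists S : set R, [/\ countable S, S `<=` `[0, +oo[ &
    {ae P, forall w, forall I F : set R, open I -> closed F ->
      (forall s, S s -> I s -> F (X s w)) ->
      forall t : R, 0 <= t -> I t -> F (X t w)}].

Definition continuous_in_probability (X : R -> T -> R) : Prop :=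
  forall t eps : R, 0 <= t -> 0 < eps ->
    P [set w | eps <= `|X s w - X t w|]
      @[s --> within [set s | 0 <= s] (nbhs t)] --> 0%E.

Definition cadlag (f : R -> R) : Prop :=
  (forall t : R, 0 <= t -> f s @[s --> t^'+] --> f t) /\
  (forall t : R, 0 < t -> cvg (f s @[s --> t^'-])).

Definition independent_increments (Z : R -> T -> R) : Prop :=
  forall n (u : nat -> R), 0 <= u 0%N -> (forall k, (k < n)%N -> u k <= u k.+1) ->
    mutually_indep
      (fun k : 'I_n => sigma_rv (fun w => Z (u k.+1) w - Z (u k) w)).

Definition stationary_increments (Z : R -> T -> R) : Prop :=
  forall (s h : R) (B : set (measurableTypeR R)), 0 <= s -> 0 <= h -> measurable B ->
    P [set w | B (Z (s + h) w - Z s w)] = P [set w | B (Z h w - Z 0 w)].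

Definition Levy_process (Z : R -> T -> R) : Prop :=
  [/\ process Z,
      {ae P, forall w, Z 0 w = 0} &
      [/\ independent_increments Z,
          stationary_increments Z,
          continuous_in_probability Z &
          {ae P, forall w, cadlag (Z ^~ w)}]].

Definition tagged_partition (a b eta : R) n (u xi : nat -> R) : Prop :=
  [/\ u 0%N = a, u n = b &
      forall k, (k < n)%N ->
        [/\ u k <= xi k, xi k <= u k.+1 & u k.+1 - u k < eta]].

(* J is the stochastic integral of the deterministic function f against L over
   ]a, b]: the limit in probability of the tagged Riemann sums as the mesh tends
   to 0.  (The increment of L over the k-th cell ]u_k, u_{k+1}] does not see a
   jump of L at a.) *)
Definition stochastic_integral (f : R -> R) (L : R -> T -> R) (a b : R)
    (J : T -> R) : Prop :=
  measurable_fun setT J /\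
  forall eps : R, 0 < eps -> exists2 eta : R, 0 < eta &
    forall n (u xi : nat -> R), tagged_partition a b eta n u xi ->
      (P [set w | (eps <= `|\sum_(k < n) f (xi k) *
                     (L (u k.+1) w - L (u k) w) - J w|)%R] <= eps%:E)%E.

Definition OU_driven (lam : R) (X Z : R -> T -> R) : Prop :=
  [/\ Levy_process Z,
      indep2 (sigma_rv (X 0)) (sigma_process Z) &
      forall t : R, 0 <= t -> exists2 J : T -> R,
        stochastic_integral (fun s => expR (- lam * (t - s)))
          (fun s => Z (lam * s)) 0 t J &
        {ae P, forall w, X t w = expR (- lam * t) * X 0 w + J w}].

Definition stationary_OU (lam : R) (D : (set (measurableTypeR R) -> \bar R) -> Prop)
    (X : R -> T -> R) : Prop :=
  [/\ process X, strictly_stationary X, D (pushforward P (X 0)) &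
      exists Z : R -> T -> R, OU_driven lam X Z].

End processes.

Section tempered_stable.
Context (R : realType).
Local Notation mu := (@lebesgue_measure R).

Definition stable_density (kappa delta : R) (s : R -> R) : Prop :=
  [/\ measurable_fun setT s,
      forall x : R, 0 <= s x,
      (\int[mu]_(x in `]0%R, +oo[) (s x)%:E = 1)%E &
      forall zeta : R, 0 < zeta ->
        (\int[mu]_(x in `]0%R, +oo[) (expR (- zeta * x) * s x)%:E
          = (expR (- delta * (2 * zeta) `^ kappa))%:E)%E].

(* The stable density is unique up to a Lebesgue-null set, so that this
   determines D on the Borel sets. *)
Definition tempered_stable (kappa delta gamma : R)
    (D : set (measurableTypeR R) -> \bar R) : Prop :=
  exists2 s, stable_density kappa delta s &
    forall B : set (measurableTypeR R), measurable B ->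
      (D B = \int[mu]_(x in B `&` `]0%R, +oo[)
        (expR (delta * gamma) * s x *
           expR (- (x / 2) * gamma `^ kappa^-1))%:E)%E.

Definition c_X (kappa delta gamma : R) : R :=
  delta * gamma - delta * (gamma `^ kappa^-1 - 2) `^ kappa.

Definition Q_range (kappa gamma : R) (qs : nat) : set R :=
  [set q | 0 < q < gamma `^ kappa^-1 / 2 /\ q <= qs%:R].

Definition b_bound (kappa delta gamma : R) (qs : nat) : R :=
  expR (- (gamma * delta)
        + delta / (1 - qs%:R) * (gamma `^ kappa^-1 - 2 * qs%:R) `^ kappa
        - qs%:R / (1 - qs%:R) * (delta * (gamma `^ kappa^-1 - 2) `^ kappa)).

Definition varsigma (kappa delta gamma b q : R) : R :=
  q * (1 + delta * gamma / ln b
         - delta / ln b * (gamma `^ kappa^-1 - 2) `^ kappa)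
  + delta / ln b * (gamma `^ kappa^-1 - 2 * q) `^ kappa
  - delta * gamma / ln b.

End tempered_stable.

Section multifractal_products.
Context d (T : measurableType d) (R : realType) (P : probability T R).

Definition geometric_process (c : R) (X : R -> T -> R) : R -> T -> R :=
  fun t w => expR (X t w - c).

(* Copies have the finite-dimensional distributions of L; being measurable and
   separable is a path property that these do not determine, so it is required
   of each copy. *)
Definition independent_copies (L : R -> T -> R) (Lj : nat -> R -> T -> R) :
    Prop :=
  [/\ forall j, process (Lj j) /\ same_fdd P (Lj j) L,
      forall j, measurable_process (Lj j) /\ separable_process P (Lj j) &
      mutually_indep P (fun j => sigma_process (Lj j))].

Definition A_proc (Lj : nat -> R -> T -> R) (b : R) (n : nat) :
    R -> T -> R :=
  fun t w => \int[lebesgue_measure]_(s in `[0, t])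
    \prod_(j < n.+1) Lj j (s * b ^+ j) w.

End multifractal_products.

(* Main.v *)
(** By the OU recursion, a joint moment E prod_i Lambda(s_i) at sorted times is the
    exponential of a sum of increments of the cumulant function at exponentially
    discounted lags.  Writing m(q) = log E Lambda(0)^q, convexity of the cumulant bounds
    this sum by m(p)/(p-1) * sum_i exp(-lambda (s_(i+1) - s_i)).  Summed over the scales
    b^j, inserting one more time point into a joint moment of the cascade thus costs the
    exponential of a potential which is integrable uniformly in n as soon as
    log b > m(p)/(p-1), which is the hypothesis on b for p = q*.  Hence the martingale
    A_n(t) is bounded in L_p and converges there.

    For t of order b^-n the cumulant is Hoelder continuous, so that the first n factors may
    be frozen at time 0.  With s = t * prod_(j<n) Lambda^(j)(0), comparing A^q pointwise
    with s^q, s^(q-1) A and s^(q-p) A^p reduces E A^q to t^q e^(n m(q)), which is of order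
    t^(q - m(q)/log b).

    The variance bound is E A_n(t)^2 >= E A_0(t)^2. *)

Require Import Defs.
From HB Require Import structures.
From mathcomp Require Import all_boot all_order all_algebra.
From mathcomp Require Import all_classical all_reals all_analysis.
From mathcomp Require Import measurable_realfun ring lra zify.

Set Implicit Arguments.
Unset Strict Implicit.
Unset Printing Implicit Defensive.

Import Order.TTheory GRing.Theory Num.Theory.
Import numFieldNormedType.Exports.

Local Open Scope classical_set_scope.
Local Open Scope ring_scope.

(** Two obstacles shape the proof. First, q need not be an integer, whereas only expectations of
    exponentials of linear combinations of the logarithms of the factors can be computed. So E A^q
    is never expanded: only weighted integer moments E(s^a A^k), with k = 1 or k = p, are, and
    pointwise inequalities turn them into bounds for E A^q. The exponents a = q - 1 and a = q - p
    may be negative, which is harmless because the cumulant is finite at every negative argument.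
    Second, a joint moment depends on the order of its times. The times are therefore kept sorted,
    and a new one is charged for splitting a gap: the price is a constant times a sum, over the
    times already present, of exponentials of a potential, each of which can be integrated
    separately. The quantity m(p)/(p-1) is the slope of the chord of m from 1, where m vanishes, to
    p. The extremal configurations are clusters of coinciding times infinitely far apart, and a
    cluster of k+1 times contributes m(k+1) <= k m(p)/(p-1). *)

(** * Real powers: subadditivity, concavity and convexity of a difference *)

Section powR_extra.
Context {R : realType}.
Implicit Types (k u v h t x y : R).

(** The power of the sum splits in proportion to the summands, and each share is at most the power
    of its summand because y <= y^k for y in ]0, 1]. *)
Lemma powR_subadd k u h : 0 < k <= 1 -> 0 <= u -> 0 <= h ->
  (u + h) `^ k <= u `^ k + h `^ k.
Proof.
move=> /andP[k0 k1] u0 h0; have [s0|s0] := eqVneq (u + h) 0.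
  by rewrite s0 powR0 ?gt_eqF// addr_ge0// powR_ge0.
have sp : 0 < u + h by rewrite lt_neqAle eq_sym s0 addr_ge0.
have key x : 0 <= x -> x <= u + h -> (u + h) `^ k * (x / (u + h)) <= x `^ k.
  rewrite le_eqVlt => /predU1P[<- _|x0 xs].
    by rewrite mul0r mulr0 powR_ge0.
  have -> : x `^ k = (u + h) `^ k * (x / (u + h)) `^ k.
    by rewrite -powRM ?(ltW sp) ?divr_ge0 ?(ltW sp) ?(ltW x0)// mulrC divfK.
  rewrite ler_wpM2l ?powR_ge0// ger1_powR// divr_gt0//= ler_pdivrMr// mul1r//.
have := lerD (key u u0 _) (key h h0 _).
by rewrite -mulrDr -mulrDl divff// mulr1; apply; rewrite ?lerDl ?lerDr.
Qed.

Lemma powR_holder k u v : 0 < k <= 1 -> 0 <= u -> u <= v ->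
  v `^ k - u `^ k <= (v - u) `^ k.
Proof.
move=> k01 u0 uv; rewrite lerBlDl -[X in X `^ _ <= _](subrKC u) addrC.
by rewrite addrC powR_subadd// subr_ge0.
Qed.

(** Convexity of the inverse power 1/k at the points u^k and v^k, read through the monotone power
    k. *)
Lemma powR_concave k t u v : 0 < k <= 1 -> 0 <= t <= 1 -> 0 <= u -> 0 <= v ->
  t * u `^ k + (1 - t) * v `^ k <= (t * u + (1 - t) * v) `^ k.
Proof.
move=> /andP[k0 k1] t01 u0 v0.
have /andP[t0 t1] := t01.
have kV1 : 1 <= k^-1 by rewrite invf_ge1.
have := @convex_powR R _ kV1 (Itv01 t0 t1) (u `^ k) (v `^ k).
rewrite !inE/= !in_itv/= !powR_ge0/= => /(_ isT isT).
rewrite !convRE/= -!powRrM divff ?gt_eqF// !powRr1// => H.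
have s0 : 0 <= t * u `^ k + (1 - t) * v `^ k.
  by rewrite addr_ge0// mulr_ge0 ?powR_ge0 ?subr_ge0.
rewrite -[leLHS](@powRr1 _)// -[X in _ `^ X <= _](mulVf (lt0r_neq0 k0)) powRrM.
by rewrite ge0_ler_powR ?nnegrE ?powR_ge0 ?(ltW k0) ?(le_trans (powR_ge0 _ _) H).
Qed.

Lemma continuous_powR_gt0 k x : 0 < x -> {for x, continuous (@powR R ^~ k)}.
Proof.
move=> x0; apply: differentiable_continuous; apply/derivable1_diffP.
by apply: derivable_powR; rewrite in_itv/= x0.
Qed.

Lemma powR_cvg_right k x : 0 < k -> 0 <= x ->
  u `^ k @[u --> x^'+] --> x `^ k.
Proof.
move=> k0; rewrite le_eqVlt => /predU1P[<-|x0].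
  by rewrite powR0 ?gt_eqF//; exact: powR_cvg0.
by apply: cvg_at_right_filter; exact: continuous_powR_gt0.
Qed.

(** The second derivative is k (k-1) (x^(k-2) - (x-2)^(k-2)), where the last two factors are
    nonpositive. The shift 2 is the change of [g - 2 * x] when x grows by 1, so that increments of
    the cumulant become convex. *)
Lemma powRB2_convex k t a b : 0 < k < 1 -> 0 <= t <= 1 -> 2 <= a -> 2 <= b ->
  (t * a + (1 - t) * b) `^ k - (t * a + (1 - t) * b - 2) `^ k <=
  t * (a `^ k - (a - 2) `^ k) + (1 - t) * (b `^ k - (b - 2) `^ k).
Proof.
move=> /andP[k0 k1].
wlog ab : t a b / a < b.
  move=> wl t01 a2 b2; have [ab|ba|->] := ltgtP a b; first exact: wl.
    have := wl (1 - t) b a ba; rewrite subKr => H.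
    rewrite (addrC (t * a)) (addrC (t * (_ - _))); apply: H => //.
    by move: t01 => /andP[? ?]; lra.
  have e u : t * u + (1 - t) * u = u by ring.
  by rewrite !e.
move=> /andP[t0 t1] a2 b2.
pose f : R -> R^o := fun u => u `^ k - (u - 2) `^ k.
have dsub u : is_derive u 1 (fun u => u - 2 : R) 1.
  by apply: is_derive_eq; rewrite subr0.
have dpow r u : 2 < u ->
    is_derive u 1 (fun u => (u - 2) `^ r) (r * (u - 2) `^ (r - 1)).
  move=> u2; rewrite -[X in is_derive _ _ _ X]mulr1.
  have d1 : is_derive (u - 2) 1 (@powR R ^~ r) (r * (u - 2) `^ (r - 1)).
    by apply: is_derive1_powR; rewrite subr_gt0.
  exact: (@is_derive1_comp _ _ (fun u => u - 2) u _ _ d1 (dsub u)).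
have df r u : 2 < u -> is_derive u 1 (fun u => u `^ r - (u - 2) `^ r)
    (r * (u `^ (r - 1) - (u - 2) `^ (r - 1))).
  move=> u2; rewrite mulrBr; apply: is_deriveB; last exact: dpow.
  by apply: is_derive1_powR; rewrite (lt_trans _ u2).
have near2 x : 2 < x -> {near x, 'D_1 f =1
    (fun u => k * (u `^ (k - 1) - (u - 2) `^ (k - 1)))}.
  move=> x2; near=> u; have u2 : 2 < u by near: u; exact: lt_nbhsr.
  by have [_] := df k u u2.
have d2 x : 2 < x -> is_derive x 1
    (fun u => k * (u `^ (k - 1) - (u - 2) `^ (k - 1)))
    (k * ((k - 1) * (x `^ (k - 1 - 1) - (x - 2) `^ (k - 1 - 1)))).
  by move=> x2; have := df (k - 1) x x2; exact: is_deriveZ.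
(* At the left end a = 2 there is no derivative, so that only continuity from the right is
   available. *)
have cf x : 2 <= x -> f u @[u --> x^'+] --> f x.
  move=> x2; apply: cvgB; first by apply: powR_cvg_right; lra.
  apply: (@cvg_comp _ _ _ (fun u => u - 2) (@powR R ^~ k) _ ((x - 2)^'+)).
    move=> A [e e0 Ae]; exists e => //= y xye xy; apply: Ae => /=.
      by rewrite opprB addrA subrK.
    by rewrite ltrD2r.
  by apply: powR_cvg_right; lra.
have := @second_derivative_convex R f a b _ _ (cf a a2) _ _ (Itv01 t0 t1) (ltW ab).
rewrite !convRE/=; apply.
- move=> x /andP[ax xb]; have x2 := le_lt_trans a2 ax.
  rewrite (near_eq_derive _ (near2 _ x2))//; have [_ ->] := d2 x x2.
  rewrite mulr_ge0 ?(ltW k0)// mulr_le0// ?subr_le0 ?(ltW k1)//.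
  have xm : 0 < x - 2 by rewrite subr_gt0.
  have -> : k - 1 - 1 = - (2 - k) by lra.
  rewrite !powRN lef_pV2 ?posrE ?powR_gt0//; last by lra.
  by rewrite ge0_ler_powR ?nnegrE//; lra.
- apply/cvg_at_left_filter/differentiable_continuous/derivable1_diffP.
  by have [] := df k b (le_lt_trans a2 ab).
- by move=> x; rewrite in_itv/= => /andP[ax xb]; have [] := df k x (le_lt_trans a2 ax).
- move=> x; rewrite in_itv/= => /andP[ax xb]; have x2 := le_lt_trans a2 ax.
  apply: (@near_eq_derivable _ _ _ (fun u => k * (u `^ (k - 1) - (u - 2) `^ (k - 1)))).
    by near=> u; apply/esym; near: u; exact: near2.
  by have [] := d2 x x2.
Unshelve. all: by end_near.
Qed.

End powR_extra.

(** * Sums of a convex function along a discounted accumulation *)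

Section convex_accumulation.
Context {R : realType}.
Variables (D : R -> R) (M : nat) (om : R).

(** Horner form of a discounted count: for x0 = 0 and y_i the discount over the i-th gap, it is the
    sum of the products y_1 ... y_i. The value x0 stands for what has accumulated further on. *)
Definition accum (x0 : R) (ys : seq R) : R := foldr (fun y x => y * (1 + x)) x0 ys.

Fixpoint accum_sum (x0 : R) (ys : seq R) : R :=
  if ys is _ :: ys' then D (accum x0 ys) + accum_sum x0 ys' else 0.

Hypothesis D0 : D 0 = 0.
Hypothesis D_convex : forall t a b : R, 0 <= t <= 1 ->
  0 <= a <= M%:R -> 0 <= b <= M%:R -> D (t * a + (1 - t) * b) <= t * D a + (1 - t) * D b.
Hypothesis om_ge : forall m, (m <= M)%N -> \sum_(i < m) D i.+1%:R <= om * m%:R.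

Lemma accum_affine y z ys : accum (y * z) ys = y * accum z ys + (1 - y) * accum 0 ys.
Proof. by elim: ys => [|a ys IH] /=; rewrite ?IH; ring. Qed.

Lemma accum_itv z ys : 0 <= z -> {in ys, forall y : R, 0 <= y <= 1} ->
  0 <= accum z ys <= z + (size ys)%:R.
Proof.
move=> z0; elim: ys => [|y ys IH] /= h; first by rewrite addr0 z0 lexx.
have /andP[y0 y1] := h y (mem_head _ _).
have /andP[h0 h1] : 0 <= accum z ys <= z + (size ys)%:R.
  by apply: IH => x xys; apply: h; rewrite inE xys orbT.
rewrite mulr_ge0 ?addr_ge0//= -natr1.
by have := ler_piMl (addr_ge0 ler01 h0) y1; lra.
Qed.

(** Every accumulated value is affine in the starting value and is then fed to the convex D. The
    bound on the size keeps the arguments in [0, M], where D is assumed convex. *)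
Lemma accum_sum_convex y z ys : 0 <= y <= 1 -> 0 <= z -> z + (size ys)%:R <= M%:R ->
  {in ys, forall y : R, 0 <= y <= 1} ->
  accum_sum (y * z) ys <= y * accum_sum z ys + (1 - y) * accum_sum 0 ys.
Proof.
move=> y01 z0; elim: ys => [|a ys IH] /= szM h; first by rewrite !mulr0 addr0.
have szM' : z + (size ys)%:R <= M%:R by rewrite (le_trans _ szM)// lerD2l ler_nat.
have hys : {in ys, forall y : R, 0 <= y <= 1} by move=> x xs; apply: h; rewrite inE xs orbT.
have {}IH := IH szM' hys.
have e : a * (1 + accum (y * z) ys) =
  y * accum z (a :: ys) + (1 - y) * accum 0 (a :: ys).
  by rewrite /= accum_affine; ring.
have h1 x : 0 <= x <= z -> 0 <= accum x (a :: ys) <= M%:R.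
  move=> /andP[x0 xz]; have /andP[-> H] := accum_itv x0 h.
  by apply: le_trans H _ => /=; apply: le_trans szM; rewrite lerD2r.
have := D_convex y01 (h1 z _) (h1 0 _); rewrite -e /= !lexx z0 => /(_ isT isT); lra.
Qed.

Lemma accum_sum_rcons x0 ys y : accum_sum x0 (rcons ys y) =
  accum_sum (y * (1 + x0)) ys + D (y * (1 + x0)).
Proof.
elim: ys => [|a ys IH] /=; first by rewrite addr0 add0r.
by rewrite IH addrA /accum foldr_rcons.
Qed.

(* The sum is convex in each [y] separately, so that it is enough to compare the two
   sides when every [y] is 0 or 1. *)
Lemma accum_sum_le m (ys : seq R) : (m + size ys <= M)%N -> {in ys, forall y : R, 0 <= y <= 1} ->
  accum_sum m%:R ys <=
  om * (\sum_(y <- ys) y) + om * m%:R - \sum_(i < m) D i.+1%:R.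
Proof.
(* The starting value m records m entries already pushed to 1, which explains the corrective sum.
   The last y is interpolated between 0, which resets the accumulation, and 1, which raises m to m +
   1. *)
elim/last_ind: ys m => [|ys y IH] m szM h.
  rewrite big_nil mulr0 add0r /= subr_ge0 om_ge//.
  by move: szM; rewrite addn0.
move: szM; rewrite size_rcons addnS => szM.
have hys : {in ys, forall y : R, 0 <= y <= 1}.
  by move=> x xs; apply: h; rewrite mem_rcons inE xs orbT.
have y01 : 0 <= y <= 1 by apply: h; rewrite mem_rcons inE eqxx.
have mM : (m < M)%N by rewrite (leq_trans _ szM)// ltnS leq_addr.
have szM' : 1 + m%:R + (size ys)%:R <= M%:R :> R.
  by rewrite nat1r -natrD ler_nat addSn.
have m0 : 0 <= 1 + m%:R :> R by rewrite addr_ge0.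
have H1 := accum_sum_convex y01 m0 szM' hys.
have H2 : D (y * (1 + m%:R)) <= y * D (1 + m%:R).
  have := D_convex y01 (a := 1 + m%:R) (b := 0); rewrite mulr0 addr0 D0 mulr0 addr0.
  by apply; rewrite ?lexx ?ler0n// m0 nat1r ler_nat.
have IH1 := IH m.+1 _ hys; rewrite addSn in IH1; have {}IH1 := IH1 szM.
have IH0 := IH 0 _ hys; rewrite add0n in IH0.
have {}IH0 := IH0 (leq_trans (leq_addl m _) (ltnW szM)); rewrite -[0%:R]/(0 : R) in IH0.
have omm := om_ge (ltnW mM).
rewrite accum_sum_rcons -cats1 big_cat big_seq1/=.
rewrite big_ord0 mulr0 addr0 subr0 in IH0.
rewrite big_ord_recr /= -natr1 (addrC m%:R) in IH1.
have /andP[y0 y1] := y01.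
have K1 := ler_wpM2l y0 IH1.
have y1' : 0 <= 1 - y by rewrite subr_ge0.
have K0 := ler_wpM2l y1' IH0.
have K2 := ler_wpM2l y1' omm.
set S := \sum_(j <- ys) j in K1 K0 *; set SD := \sum_(i < m) _ in K1 K2 *.
set V1 := accum_sum (1 + _) _ in H1 K1; set V0 := accum_sum 0 _ in H1 K0.
set V := accum_sum _ _ in H1 *.
set d := D (1 + m%:R) in H2 K1; set dd := D _ in H2 *.
have H : V + dd <= y * V1 + (1 - y) * V0 + y * d.
  exact: lerD.
apply: le_trans H _.
rewrite mulrDl mul1r in K2.
set mm := m%:R in K1 K2 *.
nra.
Qed.

End convex_accumulation.

(** * Sums over gaps of sorted times, and the insertion of a time *)

Section gap_sum.
Context {R : realType}.
Implicit Types (f psi : R -> R) (s u : R) (us : seq R).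

Definition gap_sum f us : R :=
  if us is s :: us' then \sum_(x <- pairmap (fun s u => f (u - s)) s us') x else 0.

Arguments gap_sum : simpl never.

Lemma gap_sum_cons2 f s u us : gap_sum f [:: s, u & us] = f (u - s) + gap_sum f (u :: us).
Proof. by rewrite /gap_sum /= big_cons. Qed.

Fixpoint insert s us : seq R :=
  if us is u :: us' then if s <= u then s :: us else u :: insert s us' else [:: s].

(** Sorting by insertion makes the sorted form of [s :: us] one [insert] by computation, so that
    [gap_sum_insert] prices the addition of a time. *)
Definition insertion_sort us := foldr insert [::] us.

Lemma perm_insert s us : perm_eq (insert s us) (s :: us).
Proof.
elim: us => //= u us IH; case: ifPn => // _.
rewrite -(perm_cons u) in IH; apply: perm_trans IH _.
exact/permPl/(perm_catCA [:: u] [:: s] us).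
Qed.

Lemma perm_insertion_sort us : perm_eq (insertion_sort us) us.
Proof.
elim: us => //= u us IH; apply: perm_trans (perm_insert _ _) _.
by rewrite perm_cons.
Qed.

Lemma sorted_insert s us : sorted <=%R us -> sorted <=%R (insert s us).
Proof.
case: us => //= u us; elim: us u => [|v us IH] u /=.
  by move=> _; case: ifPn => /= [->//|]; rewrite -ltNge andbT => /ltW.
move=> /andP[uv H]; case: ifPn => [su|]; first by rewrite /= su uv.
rewrite -ltNge => us'; case: ifPn => sv /=.
  by rewrite (ltW us') sv.
by have := IH v H; rewrite (negbTE sv) /= uv.
Qed.

Lemma sorted_insertion_sort us : sorted <=%R (insertion_sort us).
Proof. by elim: us => //= u us IH; exact: sorted_insert. Qed.

Lemma insert_scale a s us : 0 < a ->
  insert (a * s) [seq a * u | u <- us] = [seq a * u | u <- insert s us].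
Proof.
by move=> a0; elim: us => //= u us ->; rewrite ler_pM2l//; case: ifPn.
Qed.

Lemma insertion_sort_scale a us : 0 < a ->
  insertion_sort [seq a * u | u <- us] = [seq a * u | u <- insertion_sort us].
Proof. by move=> a0; elim: us => //= u us ->; exact: insert_scale. Qed.

Lemma gap_sum_scale f a us : gap_sum f [seq a * u | u <- us] = gap_sum (fun h => f (a * h)) us.
Proof.
case: us => // s us; elim: us s => [|u us IH] s; first by rewrite /gap_sum /= !big_nil.
by rewrite map_cons [map _ _]/= !gap_sum_cons2 -IH mulrBr.
Qed.

Lemma gap_sum_sum (I : Type) (r : seq I) (P : pred I) (F : I -> R -> R) us :
  gap_sum (fun h => \sum_(i <- r | P i) F i h) us = \sum_(i <- r | P i) gap_sum (F i) us.
Proof.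
case: us => [|s us]; first by rewrite /gap_sum big1.
elim: us s => [|u us IH] s; first by rewrite /gap_sum /= big_nil big1// => *; rewrite big_nil.
by rewrite gap_sum_cons2 IH -big_split; apply: eq_bigr => i _; rewrite gap_sum_cons2.
Qed.

Lemma gap_sumZ (c : R) f us : gap_sum (fun h => c * f h) us = c * gap_sum f us.
Proof.
case: us => [|s us]; first by rewrite /gap_sum mulr0.
elim: us s => [|u us IH] s; first by rewrite /gap_sum /= !big_nil mulr0.
by rewrite !gap_sum_cons2 IH mulrDr.
Qed.

(* The larger of the two gaps created by the insertion of [s] is at least half of the
   gap that it splits. *)
Lemma gap_sum_insert psi (c : R) s us : 0 <= c ->
  (forall h h', 0 <= h -> h <= h' -> psi h' <= psi h) ->
  (forall h, 0 <= h -> psi (h / 2) <= c + psi h) ->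
  us != [::] -> sorted <=%R us ->
  expR (gap_sum psi (insert s us)) <=
  expR c * expR (gap_sum psi us) * \sum_(u <- us) expR (psi `|s - u|).
Proof.
move=> c0 psi_dec psi_half.
have sum0 vs : 0 <= \sum_(u <- vs) expR (psi `|s - u|).
  by apply: sumr_ge0 => *; exact: expR_ge0.
have c1 : 1 <= expR c by rewrite -[1]expR0 ler_expR.
case: us => // u us _; elim: us u => [|v us IH] u /=.
  move=> _; case: ifPn => su; rewrite /gap_sum /= !big_seq1 big_nil expR0 mulr1.
    by rewrite distrC ger0_norm ?subr_ge0// ler_peMl ?expR_ge0.
  by rewrite ger0_norm ?ler_peMl ?expR_ge0// subr_ge0 ltW// ltNge.
move=> /andP[uv H]; rewrite big_cons; case: ifPn => [su|].
  rewrite !gap_sum_cons2 expRD distrC (ger0_norm (_ : 0 <= u - s)) ?subr_ge0//.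
  set a := expR (psi (u - s)); rewrite mulrDr -[leLHS]addr0 lerD//; last first.
    by rewrite !mulr_ge0 ?expR_ge0.
  by rewrite mulrC ler_wpM2r ?expR_ge0// ler_peMl ?expR_ge0.
rewrite -ltNge => us'; case: ifPn => sv.
  rewrite !gap_sum_cons2 !expRD big_cons.
  rewrite (ger0_norm (_ : 0 <= s - u)) ?subr_ge0 ?(ltW us')//.
  rewrite distrC (ger0_norm (_ : 0 <= v - s)) ?subr_ge0//.
  set a := expR (psi (s - u)); set b := expR (psi (v - s)).
  set G := expR (gap_sum _ _).
  have ab : a * b <= expR c * expR (psi (v - u)) * (a + b).
    have h0 : 0 <= v - u by rewrite subr_ge0.
    have := psi_half _ h0; rewrite -ler_expR expRD => hc.
    have E0 : 0 <= expR c * expR (psi (v - u)) by rewrite mulr_ge0 ?expR_ge0.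
    have [le1|le2] := leP ((v - u) / 2) (s - u).
      have : a <= expR (psi ((v - u) / 2)).
        by rewrite ler_expR psi_dec// divr_ge0.
      move=> /le_trans/(_ hc) ha.
      rewrite mulrDr -[leLHS]add0r lerD ?mulr_ge0 ?expR_ge0//.
      by rewrite ler_wpM2r ?expR_ge0.
    have : b <= expR (psi ((v - u) / 2)).
      by rewrite ler_expR psi_dec ?divr_ge0//; lra.
    move=> /le_trans/(_ hc) hb.
    rewrite mulrDr -[leLHS]addr0 lerD ?mulr_ge0 ?expR_ge0//.
    by rewrite mulrC ler_wpM2r ?expR_ge0.
  have G0 : 0 <= G by exact: expR_ge0.
  rewrite mulrA; apply: le_trans (ler_wpM2r G0 ab) _.
  have -> : expR c * expR (psi (v - u)) * (a + b) * G =
    expR c * (expR (psi (v - u)) * G) * (a + b) by ring.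
  by rewrite ler_wpM2l ?mulr_ge0 ?expR_ge0// addrA lerDl.
have := IH v H; rewrite /= (negbTE sv) => {}IH.
rewrite !gap_sum_cons2 !expRD.
have E0 : 0 <= expR (psi (v - u)) by exact: expR_ge0.
apply: (le_trans (ler_wpM2l E0 IH)).
rewrite mulrDr -[leLHS]add0r lerD ?mulr_ge0 ?expR_ge0//.
by rewrite le_eqVlt; apply/orP; left; apply/eqP; ring.
Qed.

End gap_sum.

(** * The tempered stable cumulant and the bound for joint moments *)

Section cumulant.
Context {R : realType}.
Variables (kappa delta gamma : R).
Hypothesis kappa01 : 0 < kappa < 1.
Hypothesis delta_gt0 : 0 < delta.
Hypothesis gamma_ge0 : 0 <= gamma.

Definition cumulant (theta : R) : R :=
  delta * gamma - delta * (gamma `^ kappa^-1 - 2 * theta) `^ kappa.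

Local Notation g := (gamma `^ kappa^-1).

Let kappa01' : 0 < kappa <= 1.
Proof. by have /andP[-> /ltW ->] := kappa01. Qed.

Let kappa_neq0 : kappa != 0.
Proof. by rewrite gt_eqF//; case/andP: kappa01. Qed.

Lemma cumulant0 : cumulant 0 = 0.
Proof. by rewrite /cumulant mulr0 subr0 -powRrM mulVf// powRr1// subrr. Qed.

Lemma cumulant_nondecreasing th th' : th <= th' -> 2 * th' <= g ->
  cumulant th <= cumulant th'.
Proof.
move=> h h'; rewrite lerD2l lerN2 ler_pM2l// ge0_ler_powR ?nnegrE; try lra.
by case/andP: kappa01 => /ltW.
Qed.

(** The exponent kappa holds up to the end point 2 th' = g, where the derivative of the cumulant is
    infinite; hence a Hoelder bound and not a Lipschitz one. *)
Lemma cumulant_holder th th' : th <= th' -> 2 * th' <= g ->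
  cumulant th' - cumulant th <= delta * (2 * (th' - th)) `^ kappa.
Proof.
move=> h h'; rewrite /cumulant.
have -> : 2 * (th' - th) = (g - 2 * th) - (g - 2 * th') by ring.
have h0 : 0 <= g - 2 * th' by lra.
have hh : g - 2 * th' <= g - 2 * th by lra.
by have := powR_holder kappa01' h0 hh; rewrite -(ler_pM2l delta_gt0); lra.
Qed.

Lemma cumulant_convex t a b : 0 <= t <= 1 -> 2 * a <= g -> 2 * b <= g ->
  cumulant (t * a + (1 - t) * b) <= t * cumulant a + (1 - t) * cumulant b.
Proof.
move=> t01 ag bg; rewrite /cumulant.
have a0 : 0 <= g - 2 * a by lra.
have b0 : 0 <= g - 2 * b by lra.
have := powR_concave kappa01' t01 a0 b0.
have -> : t * (g - 2 * a) + (1 - t) * (g - 2 * b) = g - 2 * (t * a + (1 - t) * b) by ring.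
by rewrite -(ler_pM2l delta_gt0); lra.
Qed.

Definition log_moment (theta : R) : R := cumulant theta - theta * cumulant 1.

Lemma log_moment0 : log_moment 0 = 0.
Proof. by rewrite /log_moment cumulant0 mul0r subrr. Qed.

Lemma log_moment1 : log_moment 1 = 0.
Proof. by rewrite /log_moment mul1r subrr. Qed.

Lemma log_moment_convex t a b : 0 <= t <= 1 -> 2 * a <= g -> 2 * b <= g ->
  log_moment (t * a + (1 - t) * b) <= t * log_moment a + (1 - t) * log_moment b.
Proof. by move=> t01 ag bg; have := cumulant_convex t01 ag bg; rewrite /log_moment; lra. Qed.

(** Logarithmic cost of a further factor exp(X - c_X) at a time that already carries the weight x
    discounted from later times. *)
Definition increment (x : R) : R := cumulant (x + 1) - cumulant x - cumulant 1.

Lemma increment0 : increment 0 = 0.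
Proof. by rewrite /increment cumulant0 add0r subr0 subrr. Qed.

(** The increments telescope: they are the successive costs of m + 1 coinciding times. *)
Lemma sum_increment m : \sum_(i < m) increment i.+1%:R = log_moment m.+1%:R.
Proof.
elim: m => [|m IH]; first by rewrite big_ord0 log_moment1.
by rewrite big_ord_recr /= IH /log_moment /increment -!natr1; ring.
Qed.

Lemma increment_convex t a b : 0 <= t <= 1 -> 2 * (a + 1) <= g -> 2 * (b + 1) <= g ->
  increment (t * a + (1 - t) * b) <= t * increment a + (1 - t) * increment b.
Proof.
move=> t01 ag bg; rewrite /increment /cumulant.
have a2 : 2 <= g - 2 * a by lra.
have b2 : 2 <= g - 2 * b by lra.
have := powRB2_convex kappa01 t01 a2 b2.
have -> : t * (g - 2 * a) + (1 - t) * (g - 2 * b) = g - 2 * (t * a + (1 - t) * b) by ring.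
have e x : g - 2 * x - 2 = g - 2 * (x + 1) by ring.
by rewrite !e -(ler_pM2l delta_gt0); lra.
Qed.

Variable lam : R.
Hypothesis lam_gt0 : 0 < lam.

Definition lag s (us : seq R) : R := \sum_(u <- us) expR (- lam * (u - s)).

(* For sorted times, this is the logarithm of [E prod_s exp (X s - c_X)]. *)
Fixpoint log_joint (us : seq R) : R :=
  if us is s :: us' then increment (lag s us') + log_joint us' else 0.

Let decays s us := pairmap (fun s u => expR (- lam * (u - s))) s us.

Let lag_accum s us : lag s us = accum 0 (decays s us).
Proof.
elim: us s => [|u us IH] s; first by rewrite /lag big_nil.
rewrite /= -IH /lag big_cons [RHS]mulrDr mulr1; congr (_ + _).
rewrite big_distrr; apply: eq_bigr => v _ /=; rewrite -expRD; congr expR; ring.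
Qed.

Let log_joint_accum s us : log_joint (s :: us) = accum_sum increment 0 (decays s us).
Proof.
elim: us s => [|u us IH] s; first by rewrite /= /lag big_nil increment0 addr0.
by rewrite -[log_joint _]/(increment (lag s (u :: us)) + log_joint (u :: us)) IH lag_accum.
Qed.

Variable p : nat.
Hypothesis p_ge2 : (2 <= p)%N.
Hypothesis p_le : 2 * p%:R <= g.

Definition decay_rate : R := log_moment p%:R / p.-1%:R.

Let p1_gt0 : 0 < p.-1%:R :> R.
Proof. by rewrite ltr0n; case: p p_ge2 => [|[]]. Qed.

Let pE : p%:R = p.-1%:R + 1 :> R.
Proof. by rewrite natr1 prednK// (leq_trans _ p_ge2). Qed.

Lemma log_moment_p : log_moment p%:R = decay_rate * p.-1%:R.
Proof. by rewrite divfK// gt_eqF. Qed.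

(** The convex [log_moment] vanishes at 0 and at 1, hence is nonnegative at p. *)
Lemma decay_rate_ge0 : 0 <= decay_rate.
Proof.
have p0 : 0 < p%:R :> R by rewrite ltr0n (leq_trans _ p_ge2).
rewrite divr_ge0// ?ler0n//.
have t01 : 0 <= (p%:R^-1 : R) <= 1.
  by rewrite invr_ge0 ler0n/= invf_le1// ler1n (leq_trans _ p_ge2).
have := @log_moment_convex p%:R^-1 p%:R 0 t01 p_le.
rewrite mulVf ?gt_eqF// !mulr0 addr0 log_moment0 log_moment1 mulr0 addr0.
by rewrite pmulr_rge0 ?invr_gt0//; apply; rewrite powR_ge0.
Qed.

Lemma log_moment_natS m : (m <= p.-1)%N -> log_moment m.+1%:R <= decay_rate * m%:R.
Proof.
move=> mp; pose t : R := m%:R / p.-1%:R.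
have t01 : 0 <= t <= 1.
  by rewrite divr_ge0 ?ler0n//= ler_pdivrMr// mul1r ler_nat.
have g2 : 2 * 1 <= g by apply: le_trans p_le; rewrite ler_pM2l// ler1n (leq_trans _ p_ge2).
have := log_moment_convex t01 p_le g2.
rewrite log_moment1 mulr0 addr0.
have -> : t * p%:R + (1 - t) * 1 = m.+1%:R.
  rewrite pE -natr1 /t mulrDr divfK ?gt_eqF//; ring.
by rewrite log_moment_p /t mulrC -mulrA (mulrC p.-1%:R) divfK ?gt_eqF.
Qed.

(** An instance of the accumulation bound, with D the [increment] and y the discounts over the gaps.
    Here M = p - 1, since a time has at most p - 1 successors. *)
Lemma log_joint_le us : sorted <=%R us -> (size us <= p)%N ->
  log_joint us <= decay_rate * gap_sum (fun h => expR (- lam * h)) us.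
Proof.
case: us => [|s us] sus szus; first by rewrite /gap_sum mulr0.
rewrite log_joint_accum -[0 in leLHS]/(0%:R).
have := @accum_sum_le _ increment p.-1 decay_rate increment0 _ _ 0%N (decays s us).
rewrite mulr0 big_ord0 addr0 subr0; apply.
- move=> t a b t01 /andP[_ a1] /andP[_ b1]; apply: increment_convex => //.
    by apply: le_trans p_le; rewrite ler_pM2l// pE lerD2r.
  by apply: le_trans p_le; rewrite ler_pM2l// pE lerD2r.
- by move=> m mp; rewrite sum_increment log_moment_natS.
- by rewrite add0n size_pairmap -ltnS prednK// (leq_trans _ p_ge2).
- move=> {szus}; rewrite /decays; elim: us s sus => //= u us IH s /andP[su H] y.
  rewrite inE => /orP[/eqP ->|]; last by apply: IH.
  by rewrite expR_ge0 -[leRHS]expR0 ler_expR mulNr oppr_le0 mulr_ge0 ?(ltW lam_gt0) ?subr_ge0.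
Qed.

End cumulant.

(** * The potential of a gap over geometric scales and its integral *)

Section geometric_scales.
Context {R : realType}.

Lemma geometric_sum_le (r : R) m : 0 <= r < 1 -> \sum_(i < m) r ^+ i <= (1 - r)^-1.
Proof.
move=> /andP[r0 r1]; have r1' : 0 < 1 - r by rewrite subr_gt0.
rewrite -[leRHS]mul1r ler_pdivlMr// mulrC -opprB mulNr -subrX1 opprB.
by rewrite lerBlDr lerDl exprn_ge0.
Qed.

Variables (lam b om : R).
Hypothesis lam_gt0 : 0 < lam.
Hypothesis b_gt1 : 1 < b.
Hypothesis om_ge0 : 0 <= om.

Let b_gt0 : 0 < b. Proof. exact: lt_trans b_gt1. Qed.
Let bn_gt0 n : 0 < b ^+ n. Proof. exact: exprn_gt0. Qed.

(** From exp x >= 1 + x >= x each term is at most [1 / (lam * b ^ i)], and these form a geometric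
    series. *)
Lemma sum_expR_scales_le m :
  \sum_(i < m) expR (- lam * b ^+ i) <= lam^-1 * (1 - b^-1)^-1.
Proof.
have b1 : 0 <= b^-1 < 1 by rewrite invr_ge0 (ltW b_gt0) invf_lt1.
apply: le_trans (ler_wpM2l (ltW (_ : 0 < lam^-1)) (geometric_sum_le m b1)); last first.
  by rewrite invr_gt0.
rewrite big_distrr /=; apply: ler_sum => i _.
have l0 : 0 < lam * b ^+ i by rewrite mulr_gt0.
rewrite mulNr expRN exprVn -invfM lef_pV2 ?posrE ?expR_gt0//.
by rewrite (le_trans _ (expR_ge1Dx _))// lerDr.
Qed.

Definition scale_potential n N (h : R) : R :=
  om * \sum_(n <= j < N) expR (- lam * b ^+ j * h).

Lemma scale_potential_nonincreasing n N h h' : h <= h' ->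
  scale_potential n N h' <= scale_potential n N h.
Proof.
move=> hh; rewrite ler_wpM2l// ler_sum// => j _.
by rewrite ler_expR !mulNr lerN2 ler_pM2l// mulr_gt0.
Qed.

(** As b^k >= 2, halving h is no worse than a shift by k scales; the k scales left unmatched cost at
    most [om] each. *)
Lemma scale_potential_half k n N h : 2 <= b ^+ k -> 0 <= h ->
  scale_potential n N (h / 2) <= om * k%:R + scale_potential n N h.
Proof.
move=> bk h0; rewrite /scale_potential -mulrDr ler_wpM2l//.
have le1 j x : 0 <= x -> expR (- lam * b ^+ j * x) <= 1.
  by move=> x0; rewrite -[leRHS]expR0 ler_expR !mulNr oppr_le0 !mulr_ge0 ?(ltW lam_gt0) ?(ltW (bn_gt0 _)).
have sum1 m n' x : 0 <= x ->
    \sum_(m <= j < n') expR (- lam * b ^+ j * x) <= (n' - m)%:R.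
  move=> x0; apply: (@le_trans _ _ (\sum_(m <= j < n') 1)).
    by apply: ler_sum => j _; exact: le1.
  by rewrite sumr_const_nat.
have [Nn|nN] := leqP N (n + k).
  rewrite -[leLHS]addr0 lerD//; last by rewrite sumr_ge0// => *; exact: expR_ge0.
  by rewrite (le_trans (sum1 _ _ _ _)) ?divr_ge0// ler_nat leq_subLR.
rewrite (big_cat_nat (n := n + k))//= ?leq_addr ?(ltnW nN)//.
apply: lerD; first by rewrite (le_trans (sum1 _ _ _ _)) ?divr_ge0// addKn.
have [m [nm ->]] : exists m, (n <= m)%N /\ N = (m + k)%N by exists (N - k)%N; lia.
rewrite big_addn addnK [leRHS](big_cat_nat (n := m))//= ?leq_addr//.
rewrite -[leLHS]addr0 lerD//; last by rewrite sumr_ge0// => *; exact: expR_ge0.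
apply: ler_sum => j _; rewrite ler_expR !mulNr lerN2 -!mulrA ler_pM2l//.
rewrite exprD -mulrA ler_pM2l//.
have h2 : 0 <= h / 2 by rewrite divr_ge0.
by have := ler_wpM2r h2 bk; lra.
Qed.

Local Notation mu := (@lebesgue_measure R).

Lemma measurable_scale_potential_dist n N (u : R) :
  measurable_fun [set: R] (fun x : R => expR (scale_potential n N `|x - u|)).
Proof.
apply: measurableT_comp => //; apply: measurable_funM => //.
apply: measurable_sum => j; apply: measurableT_comp => //.
by apply: measurable_funM => //; apply: measurableT_comp => //; exact: measurable_funB.
Qed.

Hypothesis om_lt : expR om < b.

(** Bounds the exponential of the potential on the shell b^-(n+1) < |x - u| <= b^-n: scale n costs
    at most [om], and scale n + 1 + i at most [om * expR (- lam * b ^ i)]. *)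
Definition shell_bound : R := expR (om * (1 + lam^-1 * (1 - b^-1)^-1)).

(** The fixed point of c = (e^om / b) c + 2 [shell_bound], the recursion between consecutive balls;
    it is positive because e^om < b. *)
Definition potential_bound : R := 2 * shell_bound / (1 - expR om / b).

Let ball n (u : R) : set R := `[u - b ^- n, u + b ^- n].

Let ballP n u x : ball n u x <-> `|x - u| <= b ^- n.
Proof. by rewrite /ball /= in_itv/= ler_distl. Qed.

Let lebesgue_ball n u : mu (ball n u) = (2 * b ^- n)%:E.
Proof.
rewrite lebesgue_measure_itv /= lte_fin.
have h : 0 < b ^- n by rewrite invr_gt0.
rewrite ifT; last by lra.
by rewrite -EFinB; congr EFin; ring.
Qed.

(* Passing from the ball of radius [b^-n] to that of radius [b^-(n+1)] removes one scale,
   which costs a factor at most [expR om < b]. *)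
Lemma integral_scale_potential_le n N (u : R) :
  (\int[mu]_(x in [set x : R | (`|x - u| <= b ^- n)%R])
     (expR (scale_potential n N `|x - u|))%:E <= (potential_bound * b ^- n)%:E)%E.
Proof.
have ->: [set x : R | `|x - u| <= b ^- n] = ball n u.
  by apply/seteqP; split=> x /ballP.
have q1 : 0 < 1 - expR om / b by rewrite subr_gt0 ltr_pdivrMr// mul1r.
have q1' : 1 - expR om / b <= 1 by rewrite lerBlDr lerDl divr_ge0 ?expR_ge0 ?(ltW b_gt0).
have sb1 : 1 <= shell_bound.
  rewrite /shell_bound -[leLHS]expR0 ler_expR mulr_ge0// addr_ge0// mulr_ge0//.
    by rewrite invr_ge0 ltW.
  by rewrite invr_ge0 subr_ge0 invf_le1// ltW.
have pb : potential_bound = expR om / b * potential_bound + 2 * shell_bound.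
  rewrite /potential_bound; field; rewrite ?gt_eqF//.
  by move: q1; rewrite -(pmulr_lgt0 _ b_gt0) mulrBl mul1r divfK// ?gt_eqF.
have pb2 : 2 * shell_bound <= potential_bound.
  rewrite /potential_bound ler_pdivlMr// ler_piMr// mulr_ge0//.
  exact: le_trans sb1.
have mf n' N' : measurable_fun (ball n' u) (fun x : R => (expR (scale_potential n' N' `|x - u|))%:E).
  by apply/measurable_EFinP; apply: measurable_funTS; exact: measurable_scale_potential_dist.
have mball n' : measurable (ball n' u) by exact: measurable_itv.
have icst n' (c : R) : (\int[mu]_(x in ball n' u) c%:E = (c * (2 * b ^- n'))%:E)%E.
  transitivity (c%:E * mu (ball n' u))%E; first exact: (integral_cst mu (mball n') c%:E).
  by rewrite EFinM; congr (_ * _)%E; exact: lebesgue_ball.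
have base n' N' : (N' <= n')%N -> (\int[mu]_(x in ball n' u)
     (expR (scale_potential n' N' `|x - u|))%:E <= (potential_bound * b ^- n')%:E)%E.
  move=> Nn; rewrite (eq_integral (cst 1%:E)); last first.
    by move=> x _; rewrite /scale_potential big_geq// mulr0 expR0.
  rewrite icst mul1r lee_fin.
  by rewrite ler_pM2r ?invr_gt0//; apply: le_trans pb2; lra.
have [Nn|Nn] := leqP N n; first exact: base.
have -> : N = (n + (N - n))%N by rewrite subnKC// ltnW.
move: (N - n)%N => {Nn}k; elim: k n => [|k IH] n; first by rewrite addn0; exact: base.
have sub : ball n.+1 u `<=` ball n u.
  move=> x /ballP h; apply/ballP; apply: le_trans h _.
  by rewrite lef_pV2 ?posrE// exprS ler_peMl ?ltW.
have -> : ball n u = ball n.+1 u `|` (ball n u `\` ball n.+1 u).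
  apply/seteqP; split=> x; last by move=> [/sub//|[]].
  by move=> h; have [?|?] := pselect (ball n.+1 u x); [left|right].
have mD : measurable (ball n u `\` ball n.+1 u) by exact: measurableD.
rewrite (ge0_integral_setU mu (mball n.+1) mD)//=; last 2 first.
- apply/measurable_EFinP; apply: measurable_funTS; exact: measurable_scale_potential_dist.
- by apply/disj_setPS => x [? []].
have mexp A n' N' : measurable_fun A (fun x : R => (expR (scale_potential n' N' `|x - u|))%:E).
  by apply/measurable_EFinP; apply: measurable_funTS; exact: measurable_scale_potential_dist.
have le_in : (\int[mu]_(x in ball n.+1 u) (expR (scale_potential n (n + k.+1) `|x - u|))%:E
    <= (expR om)%:E * (potential_bound * b ^- n.+1)%:E)%E.
  apply: (@le_trans _ _ (\int[mu]_(x in ball n.+1 u)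
    ((expR om)%:E * (expR (scale_potential n.+1 (n.+1 + k) `|x - u|))%:E))%E).
    apply: (ge0_le_integral mu (mball n.+1)) => //=; [exact: mexp|by apply: measurable_funeM; exact: mexp|].
    - move=> x _; rewrite -EFinM lee_fin -expRD ler_expR /scale_potential addSnnS.
      rewrite big_ltn ?addnS ?ltnS ?leq_addr// mulrDr lerD2r ler_piMr//.
      by rewrite -[leRHS]expR0 ler_expR !mulNr oppr_le0 !mulr_ge0 ?(ltW lam_gt0) ?(ltW (bn_gt0 _)).
  rewrite (ge0_integralZl mu (mball n.+1) (mexp _ _ _))//.
  by rewrite lee_pmul2l// lte_fin expR_gt0.
have le_out : (\int[mu]_(x in ball n u `\` ball n.+1 u)
    (expR (scale_potential n (n + k.+1) `|x - u|))%:E <= (shell_bound * (2 * b ^- n))%:E)%E.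
  apply: (@le_trans _ _ (\int[mu]_(x in ball n u `\` ball n.+1 u) shell_bound%:E)%E).
    apply: (ge0_le_integral mu mD) => //=; first exact: mexp.
    - move=> x [_ /ballP/negP]; rewrite -ltNge => hx.
      rewrite lee_fin ler_expR /scale_potential ler_wpM2l//.
      rewrite big_ltn ?addnS ?ltnS ?leq_addr//; apply: lerD.
        by rewrite -[leRHS]expR0 ler_expR !mulNr oppr_le0 !mulr_ge0 ?(ltW lam_gt0) ?(ltW (bn_gt0 _)).
      rewrite -[n.+1]add0n big_addn big_mkord; apply: le_trans (sum_expR_scales_le _).
      apply: ler_sum => i _; rewrite ler_expR !mulNr lerN2 -mulrA ler_pM2l//.
      rewrite exprD -mulrA ler_peMr ?ltW//.
      by rewrite mulrC -ltr_pdivrMr// div1r.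
  rewrite -icst; apply: (ge0_subset_integral mu mD (mball n)) => [|x _|x []//].
    exact: measurable_cst.
  by rewrite lee_fin /shell_bound expR_ge0.
apply: le_trans (leeD le_in le_out) _.
rewrite -EFinM -EFinD lee_fin [X in _ <= X * _]pb exprS invfM.
by rewrite le_eqVlt; apply/orP; left; apply/eqP; field; rewrite !gt_eqF.
Qed.

End geometric_scales.

(** * Change of variables for a weighted image measure *)

Section weighted_pushforward.
Local Open Scope ereal_scope.
Context d d' (T : measurableType d) (Y : measurableType d') (R : realType).
Variables (mu : {measure set T -> \bar R}) (nu : {measure set Y -> \bar R}).
Variables (phi : T -> Y) (W : T -> R).
Hypothesis mphi : measurable_fun setT phi.
Hypothesis mW : measurable_fun setT W.
Hypothesis W0 : forall x, (0 <= W x)%R.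
Hypothesis nuE : forall B, measurable B -> nu B = \int[mu]_(x in phi @^-1` B) (W x)%:E.

Import HBNNSimple.

Let nnsfunE (h : {nnsfun Y >-> R}) :
  \int[nu]_y (h y)%:E = \int[mu]_x ((h (phi x))%:E * (W x)%:E).
Proof.
have mpre (B : set Y) : measurable B -> measurable (phi @^-1` B).
  by move=> mB; rewrite -[_ @^-1` _]setTI; exact: mphi.
under eq_integral do rewrite fimfunE -fsumEFin//.
rewrite ge0_integral_fsum//; last 2 first.
- by move=> r; exact/measurable_EFinP/measurableT_comp.
- by move=> r y _; rewrite nnfun_muleindic_ge0.
under [RHS]eq_integral => x _.
  rewrite fimfunE -fsumEFin// ge0_mule_fsuml; last first.
    by move=> r; exact: nnfun_muleindic_ge0.
  over.
rewrite ge0_integral_fsum//; last 2 first.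
- move=> r; apply: emeasurable_funM; apply/measurable_EFinP => //.
  apply: measurable_funM => //.
  by apply: (measurableT_comp _ mphi); exact: measurable_indic.
- by move=> r x _; apply: mule_ge0; [exact: nnfun_muleindic_ge0|rewrite lee_fin].
apply: eq_fsbigr => r /[!inE] -[y _ <-].
set k := h y; have k0 : 0 <= k%:E by rewrite lee_fin.
have mA : measurable (h @^-1` [set k]) by exact: measurable_sfunP.
rewrite integralZl_indic_nnsfun// integral_indic// setIT nuE//.
under [RHS]eq_integral do rewrite EFinM -muleA.
rewrite ge0_integralZl//; last 2 first.
- apply: emeasurable_funM; apply/measurable_EFinP => //.
  by apply: (measurableT_comp _ mphi); exact: measurable_indic.
- by move=> x _; rewrite mule_ge0// lee_fin.
congr (_ * _); rewrite integral_mkcond; apply: eq_integral => x _.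
rewrite patchE; case: ifPn => xA.
  by rewrite indicE; move: xA; rewrite !inE => xA; rewrite mem_set// mul1e.
by rewrite indicE; move: xA; rewrite !notin_setE => xA; rewrite memNset// mul0e.
Qed.

(** Both sides agree on simple functions and pass to f by monotone convergence. It serves twice:
    with phi the identity for the density of the marginal law, and with phi a random variable for
    independence. *)
Lemma ge0_integral_weighted_pushforward (f : Y -> \bar R) :
  measurable_fun setT f -> (forall y, 0 <= f y) ->
  \int[nu]_y f y = \int[mu]_x (f (phi x) * (W x)%:E).
Proof.
move=> mf f0; pose f_ := nnsfun_approx measurableT mf.
transitivity (limn (fun n => \int[nu]_y (f_ n y)%:E)).
  rewrite -monotone_convergence//.
  - apply: eq_integral => y _; apply/esym/cvg_lim => //.
    by apply: cvg_nnsfun_approx.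
  - by move=> n; exact/measurable_EFinP.
  - by move=> n y _; rewrite lee_fin.
  - by move=> y _ m n mn; rewrite lee_fin; exact/lefP/nd_nnsfun_approx.
under eq_fun do rewrite nnsfunE.
rewrite -monotone_convergence//.
- apply: eq_integral => x _; apply/cvg_lim => //.
  by apply: cvgeZr => //; exact: cvg_nnsfun_approx.
- move=> n; apply: emeasurable_funM; apply/measurable_EFinP => //.
  exact: measurableT_comp.
- by move=> n x _; rewrite mule_ge0// lee_fin.
- move=> x _ m n mn; apply: lee_wpmul2r; first by rewrite lee_fin.
  by rewrite lee_fin; exact/lefP/nd_nnsfun_approx.
Qed.

End weighted_pushforward.

(** * Product formulas for expectations under independence *)

Section independent_weights.
Local Open Scope ereal_scope.
Context d (T : measurableType d) (R : realType) (P : probability T R).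

Lemma integral_indicM (A : set T) (W : T -> R) : measurable A ->
  \int[P]_w (\1_A w * W w)%:E = \int[P]_(w in A) (W w)%:E.
Proof.
move=> mA; rewrite [RHS]integral_mkcond; apply: eq_integral => w _.
rewrite patchE indicE; case: ifPn => wA; first by rewrite mul1r.
by rewrite mul0r.
Qed.

(** The hypothesis says that the image under U of the measure with density W is c times the law of
    U; f is then integrated against both. *)
Lemma ge0_integral_indep_weight (U W : T -> R) (c : R) (f : R -> R) :
  measurable_fun setT U -> measurable_fun setT W -> (forall w, 0 <= W w)%R ->
  (0 <= c)%R ->
  (forall B, measurable B ->
     \int[P]_w (\1_B (U w) * W w)%:E = c%:E * P (U @^-1` B)) ->
  measurable_fun setT f -> (forall x, 0 <= f x)%R ->
  \int[P]_w (f (U w) * W w)%:E = c%:E * \int[P]_w (f (U w))%:E.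
Proof.
move=> mU mW W0 c0 H mf f0.
have mpre (B : set R) : measurable B -> measurable (U @^-1` B).
  by move=> mB; rewrite -[_ @^-1` _]setTI; exact: mU.
pose U' : {mfun T >-> R} := HB.pack U (isMeasurableFun.Build _ _ _ _ _ mU).
have mfe : measurable_fun setT (EFin \o f) by exact/measurable_EFinP.
have fe0 y : 0 <= (EFin \o f) y by rewrite lee_fin.
have nuE (B : set R) : measurable B ->
    mscale (NngNum c0) (distribution P U') B = \int[P]_(w in U @^-1` B) (W w)%:E.
  move=> mB; rewrite -integral_indicM; last exact: mpre.
  rewrite /mscale /= /distribution /pushforward -H//.
have := ge0_integral_weighted_pushforward mU mW W0 nuE mfe fe0.
rewrite ge0_integral_mscale// ge0_integral_distribution//= => ->.
Qed.

(** Independence passes from indicators to functions one variable at a time: first f against an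
    indicator of V, then g. Finiteness of E f(U) lets it serve as the real constant of the second
    pass. *)
Lemma expectation_indep_pair (U V : T -> R) (f g : R -> R) :
  measurable_fun setT U -> measurable_fun setT V ->
  (forall A B, measurable A -> measurable B ->
    P (U @^-1` A `&` V @^-1` B) = P (U @^-1` A) * P (V @^-1` B)) ->
  measurable_fun setT f -> (forall x, 0 <= f x)%R ->
  measurable_fun setT g -> (forall x, 0 <= g x)%R ->
  \int[P]_w (f (U w))%:E < +oo ->
  \int[P]_w (f (U w) * g (V w))%:E =
  \int[P]_w (f (U w))%:E * \int[P]_w (g (V w))%:E.
Proof.
move=> mU mV indep mf f0 mg g0 foo.
have mpre (Z : T -> R) (B : set R) : measurable_fun setT Z -> measurable B ->
    measurable (Z @^-1` B).
  by move=> mZ mB; rewrite -[_ @^-1` _]setTI; exact: mZ.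
have mI (Z : T -> R) (B : set R) : measurable_fun setT Z -> measurable B ->
    measurable_fun setT (fun w => \1_B (Z w) : R).
  by move=> mZ mB; apply: (measurableT_comp _ mZ); exact: measurable_indic.
have If : 0 <= \int[P]_w (f (U w))%:E by apply: integral_ge0 => w _; rewrite lee_fin.
have Ifin : \int[P]_w (f (U w))%:E \is a fin_num by rewrite ge0_fin_numE.
have step B : measurable B ->
    \int[P]_w (f (U w) * \1_B (V w))%:E = P (V @^-1` B) * \int[P]_w (f (U w))%:E.
  move=> mB; have PVB : P (V @^-1` B) \is a fin_num by exact/fin_num_measure/mpre.
  rewrite -(fineK PVB); apply: ge0_integral_indep_weight => //.
  - exact: mI.
  - exact: fine_ge0.
  move=> A mA; rewrite fineK// muleC -indep//.
  have mAB : measurable (U @^-1` A `&` V @^-1` B) by apply: measurableI; exact: mpre.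
  transitivity (\int[P]_w (\1_(U @^-1` A `&` V @^-1` B) w)%:E).
    2: by rewrite integral_indic// setIT.
  by apply: eq_integral => w _; rewrite !indicE in_setI -natrM mulnb.
rewrite -(fineK Ifin).
under eq_integral do rewrite mulrC.
apply: ge0_integral_indep_weight => //.
- exact: measurableT_comp.
- by rewrite fine_ge0.
- move=> B mB; rewrite fineK// muleC -step//.
  by apply: eq_integral => w _; rewrite mulrC.
Qed.

Lemma expectation_indep_prod n (h : nat -> T -> R) (e : nat -> R) :
  (forall j, measurable_fun setT (h j)) -> (forall j w, 0 <= h j w)%R ->
  (forall B : nat -> set R, (forall j, measurable (B j)) ->
    P (\bigcap_(j in [set` iota 0 n]) (h j @^-1` B j)) =
    \prod_(j <- iota 0 n) P (h j @^-1` B j)) ->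
  (forall j, \int[P]_w (h j w)%:E = (e j)%:E) ->
  \int[P]_w (\prod_(j < n) h j w)%:E = (\prod_(j < n) e j)%:E.
Proof.
move=> mh h0 indep he.
have mpre j (B : set R) : measurable B -> measurable (h j @^-1` B).
  by move=> mB; rewrite -[_ @^-1` _]setTI; exact: mh.
have mI j (B : set R) : measurable B ->
    measurable_fun setT (fun w => \1_B (h j w) : R).
  by move=> mB; apply: (measurableT_comp _ (mh j)); exact: measurable_indic.
have e0 j : (0 <= e j)%R.
  by rewrite -lee_fin -he integral_ge0// => w _; rewrite lee_fin.
(* The first k factors are the variables themselves, the others still indicators: k = 0 is
   independence and k = n the claim. *)
suff step k (B : nat -> set R) : (k <= n)%N -> (forall j, measurable (B j)) ->
    \int[P]_w (\prod_(0 <= j < k) h j w * \prod_(k <= j < n) \1_(B j) (h j w))%:E =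
    (\prod_(0 <= j < k) e j)%:E * \prod_(k <= j < n) P (h j @^-1` B j).
  have := step n (fun=> setT) (leqnn n) (fun=> measurableT).
  rewrite (big_geq (leqnn n)) mule1 !big_mkord => <-.
  by apply: eq_integral => w _; rewrite (big_geq (leqnn n)) mulr1 ?big_mkord.
elim: k B => [|k IH] B kn mB.
  rewrite (big_geq (leqnn 0)) mul1e /index_iota !subn0 -indep//.
  have mB' : measurable (\bigcap_(j in [set` iota 0 n]) (h j @^-1` B j)).
    by apply: bigcap_measurableType => j _; exact: mpre.
  transitivity (\int[P]_w (\1_(\bigcap_(j in [set` iota 0 n]) (h j @^-1` B j)) w)%:E).
    2: by rewrite integral_indic// setIT.
  apply: eq_integral => w _; rewrite big_nil mul1r.
  elim: (iota 0 n) => [|j s IHs].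
    by rewrite big_nil indicE mem_set// => j; rewrite /= in_nil.
  case: IHs => IHs; rewrite big_cons IHs (_ : [set` j :: s] = j |` [set` s]); last first.
    by apply/seteqP; split => i /=; rewrite inE => /predU1P.
  rewrite bigcap_setU1 !indicE in_setI.
  by rewrite -natrM mulnb.
have Hk : (k < n)%N by [].
set W := fun w => (\prod_(0 <= j < k) h j w * \prod_(k.+1 <= j < n) \1_(B j) (h j w))%R.
have W0 w : (0 <= W w)%R.
  by rewrite mulr_ge0// prodr_ge0// => j _; rewrite ?h0// indicE.
have mW : measurable_fun setT W.
  apply: measurable_funM; apply: measurable_prod => j _ //; exact: mI.
pose c := (\prod_(0 <= j < k) e j * fine (\prod_(k.+1 <= j < n) P (h j @^-1` B j)))%R.
have Pfin : \prod_(k.+1 <= j < n) P (h j @^-1` B j) \is a fin_num.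
  by elim/big_ind: _ => //; [exact: fin_numM|move=> j _; exact/fin_num_measure/mpre].
have c0 : (0 <= c)%R.
  rewrite mulr_ge0 ?prodr_ge0// fine_ge0//.
  by elim/big_ind: _ => //; exact: mule_ge0.
have H (A : set R) : measurable A ->
    \int[P]_w (\1_A (h k w) * W w)%:E = c%:E * P (h k @^-1` A).
  (* Choosing A as the k-th event in the induction hypothesis isolates [h k] from the weight W. *)
  move=> mA; pose B' j := if j == k then A else B j.
  have := IH B' (ltnW kn).
  have -> : \prod_(k <= j < n) P (h j @^-1` B' j) =
    P (h k @^-1` A) * \prod_(k.+1 <= j < n) P (h j @^-1` B j).
    rewrite big_ltn// /B' eqxx; congr (_ * _).
    by apply: eq_big_nat => j /andP[kj _]; rewrite gtn_eqF.
  move=> IHk; have {}IHk := IHk _.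
  rewrite /c EFinM fineK// -muleA [X in _ = _ * X]muleC -IHk; last first.
    by move=> j; rewrite /B'; case: ifP.
  apply: eq_integral => w _; congr EFin; rewrite /W mulrCA; congr (_ * _)%R.
  rewrite [RHS]big_ltn// /B' eqxx; congr (_ * _)%R.
  by apply: eq_big_nat => j /andP[kj _]; rewrite gtn_eqF.
have := ge0_integral_indep_weight (mh k) mW W0 c0 H (@normr_measurable R setT)
  (@normr_ge0 _ _).
under eq_integral do rewrite ger0_norm//.
under [X in _ = _ * X -> _]eq_integral do rewrite ger0_norm//.
rewrite he => {}H.
rewrite (eq_integral (fun w => (h k w * W w)%:E)); last first.
  by move=> w _; rewrite big_nat_recr//= /W; congr EFin; ring.
rewrite H /c big_nat_recr//= !EFinM fineK//.
by rewrite -!muleA; congr (_ * _); rewrite muleC.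
Qed.

End independent_weights.

(** * Almost sure convergence from fast convergence in probability *)

Section borel_cantelli_extra.
Local Open Scope ereal_scope.
Context d (T : measurableType d) (R : realType) (P : probability T R).

Lemma ae_eventually_notin (F : (set T)^nat) : (forall n, measurable (F n)) ->
  (forall n, P (F n) <= (1 / (2 ^ n.+1)%:R)%:E) ->
  {ae P, forall w, exists N, forall n, (N <= n)%N -> ~ F n w}.
Proof.
move=> mF PF; exists (lim_sup_set F); split.
- apply: bigcap_measurable => // n _; exact: bigcup_measurable.
- apply: lim_sup_set_cvg0 => //; apply: (@le_lt_trans _ _ 1%:E); last by rewrite ltry.
  by apply: le_trans (epsilon_trick0 xpredT ler01); apply: lee_nneseries => // n _; exact: PF.
- move=> w /= H n _; apply: contrapT => nF; apply: H; exists n => k nk Fk.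
  by apply: nF; exists k.
Qed.

Lemma ae_cvg_fast (V : nat -> T -> R) (J : T -> R) :
  (forall n, measurable_fun setT (V n)) -> measurable_fun setT J ->
  (forall n, P [set w | (1 / (2 ^ n.+1)%:R <= `|V n w - J w|)%R] <=
     (1 / (2 ^ n.+1)%:R)%:E) ->
  {ae P, forall w, V n w @[n --> \oo] --> J w}.
Proof.
move=> mV mJ PV; apply: filterS (ae_eventually_notin _ PV).
  move=> w [N HN]; apply/cvgrPdist_lt => e e0; near=> n.
  have Nn : (N <= n)%N by near: n; exists N.
  have /negP := HN n Nn; rewrite -ltNge distrC => /lt_le_trans; apply.
  apply: (@le_trans _ _ (1 / 2 ^+ n)%R).
    by rewrite natrX !div1r lef_pV2 ?posrE// ler_weXn2l// ler1n.
  near: n; have := near_infty_natSinv_expn_lt (PosNum e0).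
  by apply: filterS => n /ltW.
move=> n; rewrite -[X in measurable X]setTI.
apply: measurable_fun_ler => //.
by apply: measurableT_comp => //; exact: measurable_funB.
Unshelve. all: end_near.
Qed.

End borel_cantelli_extra.

(** * Measurable versions of limits and of stochastic integrals *)

Section adapted.
Context d (T : measurableType d) (R : realType) (P : probability T R).

Definition adapted (G : set (set T)) (f : T -> R) : Prop :=
  measurable_fun [set: g_sigma_algebraType G] (f : g_sigma_algebraType G -> R).

Variable G : set (set T).

Lemma adapted_preimage f (B : set R) : adapted G f -> measurable B -> <<s G >> (f @^-1` B).
Proof. by move=> mf mB; rewrite -[f @^-1` B]setTI; exact: mf. Qed.

Hypothesis mG : G `<=` measurable.

Lemma adapted_measurable f : adapted G f -> measurable_fun setT f.
Proof.
move=> mf _ B mB; rewrite setTI.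
have := adapted_preimage mf mB; apply: smallest_sub => //.
exact: sigma_algebra_measurable.
Qed.

(** The upper limit is measurable for every sequence and agrees with the limit wherever there is
    one. *)
Lemma adapted_limit (V : nat -> T -> R) (J : T -> R) : (forall n, adapted G (V n)) ->
  {ae P, forall w, V n w @[n --> \oo] --> J w} ->
  exists2 J', adapted G J' & {ae P, forall w, J w = J' w}.
Proof.
move=> aV VJ; exists (fun w => fine (limn_esup (fun n => (V n w)%:E))).
  apply: (measurableT_comp (@fine_measurable R setT measurableT)).
  by apply: measurable_fun_limn_esup => n; apply/measurable_EFinP; exact: aV.
apply: filterS VJ => w VJ; have VJe : (V n w)%:E @[n --> \oo] --> (J w)%:E.
  by apply: cvg_EFin => //; exact: nearW.
by rewrite is_cvg_limn_esupE ?(cvg_lim _ VJe)//; apply/cvg_ex; exists (J w)%:E.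
Qed.

(** A limit in probability is determined only up to null sets, so that J itself need not be
    measurable for the sigma-algebra of L. Riemann sums that approach it fast converge almost
    everywhere, and their limit has a measurable version. *)
Lemma stochastic_integral_adapted (f : R -> R) (L : R -> T -> R) (a b : R) (J : T -> R) :
  a <= b -> (forall u, a <= u -> adapted G (L u)) ->
  stochastic_integral P f L a b J ->
  exists2 J', adapted G J' & {ae P, forall w, J w = J' w}.
Proof.
move=> ab aL [mJ HJ].
have [V HV] : {V : nat -> T -> R & forall n, adapted G (V n) /\
    (P [set w | (1 / (2 ^ n.+1)%:R <= `|V n w - J w|)%R] <= (1 / (2 ^ n.+1)%:R)%:E)%E}.
  apply: (@choice _ _ (fun n V => adapted G V /\ (P [set w | (1 / (2 ^ n.+1)%:R <= `|V w - J w|)%R] <= (1 / (2 ^ n.+1)%:R)%:E)%E)) => n.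
  have e0 : 0 < 1 / (2 ^ n.+1)%:R :> R by rewrite divr_gt0// ltr0n expn_gt0.
  have [eta eta0 Heta] := HJ _ e0.
  (* Enough cells for the uniform mesh (b - a)/m to be smaller than eta. *)
  pose m := (Num.truncn ((b - a) / eta)).+1.
  have m0 : 0 < m%:R :> R by rewrite ltr0n.
  pose u (k : nat) := a + (b - a) * (k%:R / m%:R).
  have au k : a <= u k by rewrite lerDl mulr_ge0 ?subr_ge0// divr_ge0.
  have uS k : u k.+1 - u k = (b - a) / m%:R.
    by rewrite /u -natr1; field; rewrite gt_eqF.
  exists (fun w => \sum_(k < m) f (u k) * (L (u k.+1) w - L (u k) w)); split.
    apply: measurable_sum => k; apply: measurable_funM => //.
    by apply: measurable_funB; exact: aL.
  apply: Heta; split.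
  - by rewrite /u mul0r mulr0 addr0.
  - by rewrite /u divff ?gt_eqF// mulr1 addrC subrK.
  - move=> k km; split => //.
      by rewrite -subr_ge0 uS divr_ge0 ?subr_ge0.
    rewrite uS ltr_pdivrMr// -ltr_pdivrMl// mulrC.
    exact: truncnS_gt.
have aV n : adapted G (V n) by have [] := HV n.
apply: (adapted_limit aV); apply: ae_cvg_fast => // n; last by have [] := HV n.
exact: adapted_measurable.
Qed.

End adapted.

(** * Exponential moments determined by finite-dimensional distributions *)

Section finite_dimensional.
Context d (T : measurableType d) (R : realType) (P : probability T R).

Lemma measurable_at_times n (t : n.-tuple R) (X : R -> T -> R) : process X ->
  (forall i, 0 <= tnth t i) -> measurable_fun setT (at_times t X).
Proof.
move=> pX t0; apply/measurable_fun_tnthP => i.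
rewrite (_ : _ \o _ = X (tnth t i)); first exact: pX.
by apply/funext => w /=; rewrite tnth_mktuple.
Qed.

(** Pairing each time with a coefficient allows an arbitrary power at time 0 next to unit powers at
    the other times. *)
Lemma same_fdd_expectation (X Y : R -> T -> R) (phi : R -> R) (cus : seq (R * R)) :
  process X -> process Y -> same_fdd P X Y -> measurable_fun setT phi ->
  {in cus, forall p, 0 <= p.2} ->
  (\int[P]_w (expR (\sum_(p <- cus) p.1 * phi (X p.2 w)))%:E =
   \int[P]_w (expR (\sum_(p <- cus) p.1 * phi (Y p.2 w)))%:E)%E.
Proof.
move=> pX pY fdd mphi cus0.
pose t := map_tuple snd (in_tuple cus).
have t0 i : 0 <= tnth t i by rewrite tnth_map; apply: cus0; exact: mem_tnth.
pose f (v : (size cus).-tuple (measurableTypeR R)) : R :=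
  expR (\sum_(i < size cus) (tnth (in_tuple cus) i).1 * phi (tnth v i)).
have mf : measurable_fun setT (EFin \o f).
  apply/measurable_EFinP; apply: measurableT_comp => //.
  apply: measurable_sum => i; apply: measurable_funM => //.
  by apply: measurableT_comp => //; exact: measurable_tnth.
have E (Z : R -> T -> R) (w : T) :
    expR (\sum_(p <- cus) p.1 * phi (Z p.2 w)) = f (at_times t Z w).
  rewrite /f big_tnth; congr expR; apply: eq_bigr => i _.
  by rewrite tnth_mktuple tnth_map.
under eq_integral do rewrite E.
under [RHS]eq_integral do rewrite E.
have mX := measurable_at_times pX t0.
have mY := measurable_at_times pY t0.
have f0 : {in [set: (size cus).-tuple (measurableTypeR R)], forall v, (0 <= (EFin \o f) v)%E}.
  by move=> v _; rewrite lee_fin expR_ge0.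
have := ge0_integral_pushforward mX P measurableT mf f0.
have := ge0_integral_pushforward mY P measurableT mf f0.
rewrite !preimage_setT /comp => <- <-.
apply: eq_measure_integral => B mB _; exact: fdd.
Qed.

End finite_dimensional.

(** * The moment generating function of the marginal law *)

Section ornstein_uhlenbeck.
Context d (T : measurableType d) (R : realType) (P : probability T R).
Variables (kappa delta lam gamma : R) (X : R -> T -> R).
Hypothesis kappa01 : 0 < kappa < 1.
Hypothesis lam_gt0 : 0 < lam.
Hypothesis X_OU : stationary_OU P lam (tempered_stable kappa delta gamma) X.

Local Notation g := (gamma `^ kappa^-1).
Local Notation cum := (cumulant kappa delta gamma).

Lemma ou_process : process X. Proof. by have [] := X_OU. Qed.

(** Exponential tilting: the density of X(0) times exp(theta x) is, up to a constant, the stable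
    density tilted by [zeta = g / 2 - theta]. *)
Lemma ou_mgf (theta : R) : 2 * theta <= g ->
  (\int[P]_w (expR (theta * X 0 w))%:E = (expR (cum theta))%:E)%E.
Proof.
move=> thg; have [pX _ [s [ms s0 s1 sL] XE] _] := X_OU.
have mX0 : measurable_fun setT (X 0) := pX 0 (lexx 0).
pose X0 : {mfun T >-> R} := HB.pack (X 0) (isMeasurableFun.Build _ _ _ _ _ mX0).
pose dens x := expR (delta * gamma) * s x * expR (- (x / 2) * g).
pose W (x : R) : R := \1_(`]0%R, +oo[%classic : set R) x * dens x.
have mdens : measurable_fun [set: R] dens.
  apply: measurable_funM; first exact: measurable_funM.
  apply: measurableT_comp => //; apply: measurable_funM => //.
  by apply: measurableT_comp => //; exact: measurable_funM.
have dens0 x : 0 <= dens x by rewrite !mulr_ge0 ?expR_ge0.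
have mW : measurable_fun [set: R] W.
  by apply: measurable_funM => //; exact: measurable_indic.
have W0 x : 0 <= W x by rewrite mulr_ge0// indicE.
have iW (B : set R) (h : R -> R) :
    (\int[lebesgue_measure]_(x in B `&` `]0%R, +oo[) (h x * dens x)%:E =
     \int[lebesgue_measure]_(x in B) (h x * W x)%:E)%E.
  rewrite integral_mkcondr; apply: eq_integral => x _; rewrite patchE /W indicE.
  by case: ifPn => _; rewrite ?mul1r// mul0r mulr0.
have nuE (B : set R) : measurable B ->
    (distribution P X0 B = \int[lebesgue_measure]_(x in id @^-1` B) (W x)%:E)%E.
  move=> mB; rewrite /distribution /= XE//.
  have := iW B (cst 1); under eq_integral do rewrite mul1r.
  by under [RHS]eq_integral do rewrite mul1r.
have mexp : measurable_fun [set: R] (fun x : R => (expR (theta * x))%:E).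
  by apply/measurable_EFinP; apply: measurableT_comp => //; exact: measurable_funM.
transitivity (\int[distribution P X0]_x (expR (theta * x))%:E)%E.
  by rewrite ge0_integral_distribution// => x; rewrite lee_fin expR_ge0.
rewrite (@ge0_integral_weighted_pushforward _ _ (measurableTypeR R) R R
  lebesgue_measure (distribution P X0) id W (@measurable_id _ _ setT) mW W0 nuE _ mexp)//.
under eq_integral do rewrite -EFinM.
rewrite -(iW setT (fun x => expR (theta * x))) setTI.
pose zeta := g / 2 - theta.
have -> : (\int[lebesgue_measure]_(x in `]0%R, +oo[) (expR (theta * x) * dens x)%:E =
  (expR (delta * gamma))%:E *
    \int[lebesgue_measure]_(x in `]0%R, +oo[) (expR (- zeta * x) * s x)%:E)%E.
  rewrite -ge0_integralZl//.
  - apply: eq_integral => x _; rewrite -EFinM /dens; congr EFin.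
    have -> : expR (- zeta * x) = expR (theta * x) * expR (- (x / 2) * g).
      by rewrite -expRD /zeta; congr expR; field.
    by ring.
  - apply/measurable_EFinP; apply: measurable_funTS; apply: measurable_funM => //.
    by apply: measurableT_comp => //; exact: measurable_funM.
  - by move=> x _; rewrite lee_fin mulr_ge0 ?expR_ge0.
have z2 : 2 * zeta = g - 2 * theta by rewrite /zeta; field.
(* At the end point 2 theta = g the tilt disappears, and the total mass of the stable density
   replaces its Laplace transform, which is given for positive arguments only. *)
have [zeta0|zeta0] := eqVneq zeta 0.
  under eq_integral do rewrite zeta0 oppr0 mul0r expR0 mul1r.
  rewrite s1 mule1 /cumulant -z2 zeta0 mulr0 powR0 ?mulr0 ?subr0// gt_eqF//.
  by case/andP: kappa01.
rewrite sL; last by rewrite lt_neqAle eq_sym zeta0 /zeta; lra.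
by rewrite -EFinM -expRD z2 mulNr.
Qed.

End ornstein_uhlenbeck.

(** * Joint exponential moments of the Ornstein-Uhlenbeck process *)

Section ou_joint.
Context d (T : measurableType d) (R : realType) (P : probability T R).
Variables (kappa delta lam gamma : R) (X : R -> T -> R).
Hypothesis kappa01 : 0 < kappa < 1.
Hypothesis delta_gt0 : 0 < delta.
Hypothesis lam_gt0 : 0 < lam.
Hypothesis gamma_ge0 : 0 <= gamma.
Hypothesis X_OU : stationary_OU P lam (tempered_stable kappa delta gamma) X.

Local Notation g := (gamma `^ kappa^-1).
Local Notation cum := (cumulant kappa delta gamma).

(** One sigma-algebra, that of the driving process, serves all times: X(0) has to be independent of
    the remainders at several times jointly, and not only of each of them. *)
Lemma ou_decomposition : exists G J, [/\ G `<=` measurable,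
  forall t : R, 0 <= t -> adapted G (J t),
  forall t : R, 0 <= t -> {ae P, forall w, X t w = expR (- lam * t) * X 0 w + J t w} &
  forall A B, measurable A -> <<s G >> B -> P (X 0 @^-1` A `&` B) = (P (X 0 @^-1` A) * P B)%E].
Proof.
have [pX _ _ [Z [[pZ _ _] indep OU]]] := X_OU.
pose G := \bigcup_(t in `[0, +oo[) sigma_rv (Z t).
have mG : G `<=` measurable.
  by move=> A [t /= /[!in_itv]/= /andP[t0 _] [B mB <-]]; exact: pZ.
have aZ u : 0 <= u -> adapted G (Z u).
  move=> u0 _ B mB; rewrite setTI; apply: sub_sigma_algebra; exists u.
    by rewrite /= in_itv/= u0.
  by exists B => //; rewrite setTI.
have H t : exists Jt, 0 <= t -> adapted G Jt /\
    {ae P, forall w, X t w = expR (- lam * t) * X 0 w + Jt w}.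
  (* [X 0] is a default value for negative times. *)
  have [t0|t0] := leP 0 t; last by exists (X 0).
  have [J SI XJ] := OU t t0.
  have aL u : 0 <= u -> adapted G (Z (lam * u)).
    by move=> u0; apply: aZ; rewrite mulr_ge0// ltW.
  have [J' aJ' JJ'] := stochastic_integral_adapted mG t0 aL SI.
  exists J' => _; split => //.
  by apply: filterS2 XJ JJ' => w -> ->.
have [J HJ] := choice H.
exists G, J; split => //.
- by move=> t t0; have [] := HJ t t0.
- by move=> t t0; have [] := HJ t t0.
- move=> A B mA mB; apply: indep => //.
  by exists A => //; rewrite setTI.
Qed.

(** By the recursion the sum of the X(u) is lag X(0) + V, with V independent of X(0). The law of V
    is never computed: its exponential moment cancels between the exponents a and 0. *)
Lemma ou_affine (a : R) (us : seq R) : {in us, forall u : R, 0 <= u} ->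
  2 * (a + lag lam 0 us) <= g -> 2 * lag lam 0 us <= g ->
  (\int[P]_w (expR (a * X 0 w + \sum_(u <- us) X u w))%:E =
   (expR (cum (a + lag lam 0 us) - cum (lag lam 0 us)))%:E *
   \int[P]_w (expR (\sum_(u <- us) X u w))%:E)%E.
Proof.
move=> us0 ag xg; have [G [J [mG aJ XJ indep]]] := ou_decomposition.
have pX := ou_process X_OU; have mX0 : measurable_fun setT (X 0) by exact: pX.
set x := lag lam 0 us in ag xg *.
pose V w := \sum_(u <- us) J u w.
have XV : {ae P, forall w, \sum_(u <- us) X u w = x * X 0 w + V w}.
  rewrite /x /V /lag; elim: us us0 {ag xg x V} => [|u us IH] us0.
    by apply: aeW => w; rewrite !big_nil mul0r addr0.
  have {}IH : {ae P, forall w, _} := IH (fun v vs => us0 v (mem_behead (s := u :: us) vs)).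
  have u0 : 0 <= u by apply: us0; rewrite inE eqxx.
  apply: filterS2 (XJ u u0) IH => w H1 H2.
  by rewrite !big_cons H1 H2 subr0; ring.
have aV : adapted G V.
  rewrite /V; elim: us us0 {ag xg x V XV} => [|u us IH] us0.
    by under eq_fun do rewrite big_nil; exact: measurable_cst.
  under eq_fun do rewrite big_cons; apply: measurable_funD.
    by apply: aJ; apply: us0; rewrite inE eqxx.
  by apply: IH => v vs; apply: us0; rewrite inE vs orbT.
have mV := adapted_measurable mG aV.
have mS : measurable_fun setT (fun w => \sum_(u <- us) X u w).
  elim: us us0 {ag xg x V XV aV mV} => [|u us IH] us0.
    by under eq_fun do rewrite big_nil; exact: measurable_cst.
  under eq_fun do rewrite big_cons; apply: measurable_funD.
    by apply: pX; apply: us0; rewrite inE eqxx.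
  by apply: IH => v vs; apply: us0; rewrite inE vs orbT.
have key (c : R) : 2 * (c + x) <= g ->
    (\int[P]_w (expR (c * X 0 w + \sum_(u <- us) X u w))%:E =
     (expR (cum (c + x)))%:E * \int[P]_w (expR (V w))%:E)%E.
  move=> cg; rewrite -(ou_mgf kappa01 X_OU cg).
  transitivity (\int[P]_w (expR ((c + x) * X 0 w) * expR (V w))%:E)%E.
    apply: ge0_ae_eq_integral => //.
    - apply/measurable_EFinP; apply: measurableT_comp => //.
      by apply: measurable_funD => //; exact: measurable_funM.
    - apply/measurable_EFinP; apply: measurable_funM; apply: measurableT_comp => //.
      exact: measurable_funM.
    - by apply: filterS XV => w H _; rewrite H -expRD; congr (expR _)%:E; ring.
  apply: (@expectation_indep_pair _ _ _ P (X 0) V (fun y => expR ((c + x) * y)) expR) => //.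
  - by move=> A B mA mB; apply: indep => //; exact: adapted_preimage.
  - by apply: measurableT_comp => //; exact: measurable_funM.
  - by rewrite (ou_mgf kappa01 X_OU cg) ltry.
have := key 0; rewrite add0r => /(_ xg).
under eq_integral do rewrite mul0r add0r.
move=> ->; rewrite (key a ag) muleA -EFinM -expRD; congr ((expR _)%:E * _)%E.
by rewrite subrK.
Qed.

Lemma ou_shift (h : R) (us : seq R) : 0 <= h -> {in us, forall u : R, 0 <= u} ->
  (\int[P]_w (expR (\sum_(u <- us) X (u + h) w))%:E =
   \int[P]_w (expR (\sum_(u <- us) X u w))%:E)%E.
Proof.
move=> h0 us0; have pX := ou_process X_OU.
have pXh : process (fun t => X (t + h)) by move=> t t0; apply: pX; rewrite addr_ge0.
have st : same_fdd P (fun t => X (t + h)) X by have [_ + _ _] := X_OU; exact.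
have := @same_fdd_expectation _ _ _ P _ _ id [seq (1, u) | u <- us] pXh pX st.
under eq_integral do rewrite big_map /=.
under [X in _ = X]eq_integral do rewrite big_map /=.
under eq_integral do under eq_bigr do rewrite mul1r.
under [X in _ = X]eq_integral do under eq_bigr do rewrite mul1r.
apply; first exact: measurable_id.
by move=> p /mapP[u /us0 u0 ->].
Qed.

Local Notation c := (cum 1).

Lemma ou_center (us : seq R) : {in us, forall u : R, 0 <= u} ->
  (\int[P]_w (expR (\sum_(u <- us) (X u w - c)))%:E =
   (expR (- c * (size us)%:R))%:E * \int[P]_w (expR (\sum_(u <- us) X u w))%:E)%E.
Proof.
move=> us0; have pX := ou_process X_OU.
have mS : measurable_fun setT (fun w => \sum_(u <- us) X u w).
  elim: us us0 => [|u us IH] us0.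
    by under eq_fun do rewrite big_nil; exact: measurable_cst.
  under eq_fun do rewrite big_cons; apply: measurable_funD.
    by apply: pX; apply: us0; rewrite inE eqxx.
  by apply: IH => v vs; apply: us0; rewrite inE vs orbT.
rewrite -ge0_integralZl//.
- apply: eq_integral => w _; rewrite -EFinM -expRD big_split /=; congr (expR _)%:E.
  by rewrite big_const_seq count_predT iter_addr_0 addrC mulr_natr.
- by apply/measurable_EFinP; exact: measurableT_comp.
Qed.

Lemma lag_itv s (us : seq R) : path <=%R s us -> 0 <= lag lam s us <= (size us)%:R.
Proof.
move=> ss; rewrite sumr_ge0 => [|*]; last exact: expR_ge0.
rewrite /lag -[leRHS]mulr1 mulr_natl -iter_addr_0 -(count_predT us) -big_const_seq.
rewrite big_seq [leRHS]big_seq; apply: ler_sum => u us'.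
rewrite -[leRHS]expR0 ler_expR mulNr oppr_le0 mulr_ge0 ?(ltW lam_gt0) ?subr_ge0//.
by have /allP/(_ u us') := order_path_min le_trans ss.
Qed.

(** By stationarity the first time can be moved to 0, where [ou_affine] with a = 1 splits off one
    [increment]. *)
Lemma ou_joint (us : seq R) : sorted <=%R us -> {in us, forall u : R, 0 <= u} ->
  2 * (size us)%:R <= g ->
  (\int[P]_w (expR (\sum_(u <- us) (X u w - c)))%:E =
   (expR (log_joint kappa delta gamma lam us))%:E)%E.
Proof.
elim: us => [_ _ _|s us IH sus us0 szg].
  under eq_integral do rewrite big_nil expR0.
  by rewrite integral_cst//= probability_setT mule1 expR0.
have uS0 : {in us, forall u : R, 0 <= u} by move=> u uu; apply: us0; rewrite inE uu orbT.
have szg' : 2 * (size us)%:R <= g by apply: le_trans szg; rewrite ler_pM2l// ler_nat.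
have {}IH := IH (path_sorted sus) uS0 szg'.
have s0 : 0 <= s by apply: us0; rewrite inE eqxx.
pose us' := [seq u - s | u <- us].
have us'0 : {in us', forall u : R, 0 <= u}.
  move=> v /mapP[u uu ->]; rewrite subr_ge0.
  by have /allP/(_ u uu) := order_path_min le_trans sus.
have lagE : lag lam 0 us' = lag lam s us.
  by rewrite /lag big_map; apply: eq_bigr => u _; rewrite subr0.
have /andP[x0 xs] := lag_itv sus.
have szE : (size (s :: us))%:R = 1 + (size us)%:R :> R by rewrite nat1r.
have g1 : 2 * (1 + lag lam 0 us') <= g.
  by rewrite lagE (le_trans _ szg)// ler_pM2l// szE lerD2l.
have g2 : 2 * lag lam 0 us' <= g.
  by rewrite lagE (le_trans _ szg')// ler_pM2l.
have shift1 := ou_shift s0 us'0.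
have us''0 : {in 0 :: us', forall u : R, 0 <= u}.
  by move=> v; rewrite inE => /predU1P[->//|]; exact: us'0.
have shift2 := ou_shift s0 us''0.
have := ou_affine us'0 g1 g2.
under eq_integral do rewrite mul1r.
move: shift2; under [X in _ = X -> _]eq_integral do rewrite big_cons.
move=> <-; rewrite -shift1.
under eq_integral do rewrite big_cons big_map add0r.
under eq_integral do under eq_bigr do rewrite subrK.
under [X in _ = (_ * X)%E -> _]eq_integral do rewrite big_map.
under [X in _ = (_ * X)%E -> _]eq_integral do under eq_bigr do rewrite subrK.
move=> E; rewrite ou_center//.
under eq_integral do rewrite big_cons.
rewrite E.
move: IH; rewrite ou_center// => IH.
rewrite -[log_joint _ _ _ _ (s :: us)]/(increment kappa delta gamma (lag lam s us) +
  log_joint kappa delta gamma lam us) [in RHS]expRD [RHS]EFinM -IH !muleA -!EFinM -!expRD.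
congr ((expR _)%:E * _)%E.
by rewrite lagE szE /increment (addrC 1 (lag _ _ _)); ring.
Qed.

End ou_joint.

(** * Moments of the independent copies *)

Section copies.
Context d (T : measurableType d) (R : realType) (P : probability T R).
Variables (kappa delta lam gamma : R) (X : R -> T -> R) (Lj : nat -> R -> T -> R).
Hypothesis kappa01 : 0 < kappa < 1.
Hypothesis delta_gt0 : 0 < delta.
Hypothesis lam_gt0 : 0 < lam.
Hypothesis gamma_ge0 : 0 <= gamma.
Hypothesis X_OU : stationary_OU P lam (tempered_stable kappa delta gamma) X.
Hypothesis Lj_copies : independent_copies P
  (geometric_process (c_X kappa delta gamma) X) Lj.

Local Notation g := (gamma `^ kappa^-1).
Local Notation cum := (cumulant kappa delta gamma).
Local Notation c := (cum 1).

Lemma c_XE : c_X kappa delta gamma = c.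
Proof. by rewrite /c_X /cumulant mulr1. Qed.

(* Working with logarithms keeps all products positive, even on the null sets where a
   copy is not; truncating the time at 0 makes them jointly measurable on the whole
   space. *)
Definition log_copy (j : nat) (s : R) (w : T) : R := ln (Lj j (Num.max s 0) w).

Lemma copy_measurable2 j :
  measurable_fun setT (fun z : measurableTypeR R * T => Lj j (Num.max z.1 0) z.2).
Proof.
have [_ /(_ j)[mp _] _] := Lj_copies.
have mt : measurable_fun setT
    (fun z : measurableTypeR R * T => (Num.max z.1 0 : measurableTypeR R, z.2)).
  apply: measurable_fun_pair => //; apply: measurable_maxr => //.
apply: (measurable_comp _ _ mp mt); last first.
  by move=> _ [z _ <-] /=; split => //=; rewrite le_max lexx orbT.
apply: measurableX => //.
have -> : [set t : measurableTypeR R | 0 <= t] = `[0, +oo[%classic.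
  by apply/seteqP; split => t /=; rewrite in_itv/= andbT.
exact: measurable_itv.
Qed.

Lemma log_copy_measurable2 j :
  measurable_fun setT (fun z : measurableTypeR R * T => log_copy j z.1 z.2).
Proof. exact: (measurableT_comp (@measurable_ln R) (copy_measurable2 j)). Qed.

Lemma log_copy_measurable j s : measurable_fun setT (log_copy j s).
Proof.
have [/(_ j)[pL _] _ _] := Lj_copies.
by apply: (measurableT_comp (@measurable_ln R)); apply: pL; rewrite le_max lexx orbT.
Qed.

Lemma log_copy_expectation j (a : R) (us : seq R) : {in us, forall u : R, 0 <= u} ->
  (\int[P]_w (expR (a * log_copy j 0 w + \sum_(u <- us) log_copy j u w))%:E =
   \int[P]_w (expR (a * (X 0 w - c) + \sum_(u <- us) (X u w - c)))%:E)%E.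
Proof.
move=> us0; have [/(_ j)[pL fddL] _ _] := Lj_copies.
have pX := ou_process X_OU.
have pG : process (geometric_process (c_X kappa delta gamma) X).
  move=> t t0; apply: measurableT_comp => //; apply: measurable_funB => //.
  exact: pX.
have := @same_fdd_expectation _ _ _ P _ _ (@ln R) ((a, 0) :: [seq (1, u) | u <- us])
  pL pG fddL (@measurable_ln R).
have H : {in (a, 0) :: [seq (1, u) | u <- us], forall p : R * R, 0 <= p.2}.
  by move=> p; rewrite inE => /predU1P[->//|/mapP[u /us0 u0 ->]].
move=> /(_ H) E.
transitivity (\int[P]_w (expR (\sum_(p <- (a, 0) :: [seq (1, u) | u <- us])
    p.1 * ln (Lj j p.2 w)))%:E)%E.
  apply: eq_integral => w _; congr (expR _)%:E; rewrite big_cons big_map /=.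
  rewrite /log_copy max_l//; congr (_ + _).
  by apply: eq_big_seq => u /us0 u0; rewrite mul1r max_l.
rewrite E; apply: eq_integral => w _; congr (expR _)%:E; rewrite big_cons big_map /=.
rewrite /geometric_process expRK c_XE; congr (_ + _).
by apply: eq_bigr => u _; rewrite mul1r expRK.
Qed.

(* The logarithm of [E (Lambda(0)^a * prod_u Lambda(u))]. *)
Definition log_anchored (a : R) (us : seq R) : R :=
  - a * c + cum (a + lag lam 0 us) - cum (lag lam 0 us)
  + log_joint kappa delta gamma lam (insertion_sort us).

Lemma lag0_itv (us : seq R) : {in us, forall u : R, 0 <= u} ->
  0 <= lag lam 0 us <= (size us)%:R.
Proof.
move=> us0; rewrite sumr_ge0 => [|*]; last exact: expR_ge0.
rewrite /lag -[leRHS]mulr1 mulr_natl -iter_addr_0 -(count_predT us) -big_const_seq.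
rewrite big_seq [leRHS]big_seq; apply: ler_sum => u us'.
by rewrite subr0 -[leRHS]expR0 ler_expR mulNr oppr_le0 mulr_ge0 ?(ltW lam_gt0) ?us0.
Qed.

(** [ou_affine] handles the power at time 0, and [ou_joint] the other times after sorting, which the
    product does not see. *)
Lemma log_copy_moment j (a : R) (us : seq R) : {in us, forall u : R, 0 <= u} ->
  2 * (a + (size us)%:R) <= g -> 2 * (size us)%:R <= g ->
  (\int[P]_w (expR (a * log_copy j 0 w + \sum_(u <- us) log_copy j u w))%:E =
   (expR (log_anchored a us))%:E)%E.
Proof.
move=> us0 ag sg; rewrite log_copy_expectation//.
have /andP[x0 x1] := lag0_itv us0.
have g1 : 2 * (a + lag lam 0 us) <= g.
  by rewrite (le_trans _ ag)// ler_pM2l// lerD2l.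
have g2 : 2 * lag lam 0 us <= g by rewrite (le_trans _ sg)// ler_pM2l.
have pX := ou_process X_OU.
have mS : measurable_fun setT (fun w => \sum_(u <- us) X u w).
  elim: us us0 {ag sg x0 x1 g1 g2} => [|u us IH] us0.
    by under eq_fun do rewrite big_nil; exact: measurable_cst.
  under eq_fun do rewrite big_cons; apply: measurable_funD.
    by apply: pX; apply: us0; rewrite inE eqxx.
  by apply: IH => v vs; apply: us0; rewrite inE vs orbT.
transitivity ((expR (- a * c - c * (size us)%:R))%:E *
    \int[P]_w (expR (a * X 0 w + \sum_(u <- us) X u w))%:E)%E.
  rewrite -ge0_integralZl//.
  - apply: eq_integral => w _; rewrite -EFinM -expRD big_split /=; congr (expR _)%:E.
    rewrite big_const_seq count_predT iter_addr_0 -mulr_natr; ring.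
  - apply/measurable_EFinP; apply: measurableT_comp => //.
    apply: measurable_funD => //; apply: measurable_funM => //.
    exact: pX.
rewrite (ou_affine kappa01 lam_gt0 X_OU us0 g1 g2).
have perm := perm_insertion_sort us.
have us0' : {in insertion_sort us, forall u : R, 0 <= u}.
  by move=> u; rewrite (perm_mem perm); exact: us0.
have sg' : 2 * (size (insertion_sort us))%:R <= g by rewrite (perm_size perm).
have := ou_joint kappa01 lam_gt0 X_OU (sorted_insertion_sort us) us0' sg'.
rewrite (ou_center X_OU us0') (perm_size perm).
under eq_integral do rewrite (perm_big us)//=.
rewrite muleA -EFinM -expRD.
move=> E; rewrite /log_anchored [in RHS]expRD [RHS]EFinM -E !muleA -!EFinM -!expRD.
by congr ((expR _)%:E * _)%E; ring.
Qed.

Lemma log_copies_moment N (a : nat -> R) (l : nat -> seq R) :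
  (forall j, {in l j, forall u : R, 0 <= u}) ->
  (forall j, 2 * (a j + (size (l j))%:R) <= g) ->
  (forall j, 2 * (size (l j))%:R <= g) ->
  (\int[P]_w (expR (\sum_(j < N) (a j * log_copy j 0 w + \sum_(u <- l j) log_copy j u w)))%:E =
   (expR (\sum_(j < N) log_anchored (a j) (l j)))%:E)%E.
Proof.
move=> l0 ag sg; have [Lfdd _ indep] := Lj_copies.
under eq_integral do rewrite expR_sum.
rewrite expR_sum.
pose h j w := expR (a j * log_copy j 0 w + \sum_(u <- l j) log_copy j u w).
pose G j := \bigcup_(t in `[0, +oo[) sigma_rv (Lj j t).
have aL j t : 0 <= t -> adapted (G j) (Lj j t).
  move=> t0 _ B mB; rewrite setTI; apply: sub_sigma_algebra; exists t.
    by rewrite /= in_itv/= t0.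
  by exists B => //; rewrite setTI.
have axi j s : adapted (G j) (log_copy j s).
  apply: (measurableT_comp (@measurable_ln R)); apply: aL.
  by rewrite le_max lexx orbT.
have ah j : adapted (G j) (h j).
  apply: measurableT_comp => //; apply: measurable_funD.
    by apply: measurable_funM => //; exact: axi.
  by apply: measurable_sum => u; exact: axi.
have mG j : G j `<=` measurable.
  move=> A [t /= /[!in_itv]/= /andP[t0 _] [B mB <-]].
  by have [pL _] := Lfdd j; exact: pL.
apply: (@expectation_indep_prod _ _ _ P N h (fun j => expR (log_anchored (a j) (l j)))).
- by move=> j; apply: adapted_measurable (ah j); exact: mG.
- by move=> j w; exact: expR_ge0.
- move=> B mB; apply: indep; first exact: iota_uniq.
  by move=> j _; exact: adapted_preimage (ah j) (mB j).
- by move=> j; exact: log_copy_moment.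
Qed.

End copies.

(** * Moments of a time integral by Tonelli's theorem *)

Section tonelli_moments.
Context d (T : measurableType d) (R : realType) (P : probability T R).
Local Open Scope ereal_scope.
Local Notation mu := (@lebesgue_measure R).
Variables (Y : R -> T -> R) (t : R).
Hypothesis mY : measurable_fun setT (fun z : measurableTypeR R * T => Y z.1 z.2).
Hypothesis Y0 : forall s w, (0 <= Y s w)%R.

(** Kept in the extended reals, so that Tonelli's theorem applies before finiteness is known. *)
Definition mass (w : T) : \bar R := \int[mu]_(s in `[0%R, t]) (Y s w)%:E.

(** The weight W collects the values Y(s) already extracted from the power, which makes an induction
    on k possible. *)
Definition mass_moment (k : nat) (W : T -> R) : \bar R := \int[P]_w ((W w)%:E * mass w ^+ k).

Let cut (s : R) : R := \1_(`[0%R, t]%classic : set R) s.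

Let mcut : measurable_fun setT (fun z : measurableTypeR R * T => cut z.1 * Y z.1 z.2)%R.
Proof.
apply: measurable_funM => //; apply: (measurableT_comp (f := cut)) => //.
by apply: measurable_indic; exact: measurable_itv.
Qed.

Let integral_cut (f : R -> \bar R) :
  \int[mu]_(s in `[0%R, t]) f s = \int[mu]_s ((cut s)%:E * f s).
Proof.
rewrite integral_mkcond; apply: eq_integral => s _.
by rewrite patchE /cut indicE; case: ifPn; rewrite ?mul1e ?mul0e.
Qed.

Lemma measurable_section s : measurable_fun setT (Y s).
Proof. exact: (measurableT_comp mY (measurable_pair1 (s : measurableTypeR R))). Qed.

Lemma mass_ge0 w : 0 <= mass w.
Proof. by apply: integral_ge0 => s _; rewrite lee_fin. Qed.

Lemma measurable_mass : measurable_fun setT mass.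
Proof.
have mf : measurable_fun setT
    (fun z : measurableTypeR R * T => (cut z.1 * Y z.1 z.2)%:E) by exact/measurable_EFinP.
have f0 (z : measurableTypeR R * T) : 0 <= (cut z.1 * Y z.1 z.2)%:E.
  by rewrite lee_fin mulr_ge0.
have := measurable_fun_fubini_tonelli_G (m1 := mu) _ mf f0.
apply: eq_measurable_fun => w _; rewrite /fubini_G /mass integral_cut.
by apply: eq_integral => s _; rewrite EFinM.
Qed.

Let measurable_kernel k (W : T -> R) : measurable_fun setT W ->
  measurable_fun setT (fun z : measurableTypeR R * T =>
    (W z.2)%:E * mass z.2 ^+ k * (cut z.1 * Y z.1 z.2)%:E).
Proof.
move=> mW; apply: emeasurable_funM; last exact/measurable_EFinP.
apply: emeasurable_funM.
  by apply/measurable_EFinP; exact: (measurableT_comp mW measurable_snd).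
have mp : measurable_fun setT (fun w => mass w ^+ k).
  elim: k => [|k IH]; first by under eq_fun do rewrite expe0; exact: measurable_cst.
  under eq_fun do rewrite expeS; apply: emeasurable_funM => //.
  exact: measurable_mass.
exact: (measurableT_comp mp measurable_snd).
Qed.

Let kernel_ge0 k (W : T -> R) : (forall w, 0 <= W w)%R ->
  forall z : measurableTypeR R * T,
    0 <= (W z.2)%:E * mass z.2 ^+ k * (cut z.1 * Y z.1 z.2)%:E.
Proof.
move=> W0 z; apply: mule_ge0; last by rewrite lee_fin mulr_ge0.
by apply: mule_ge0; [rewrite lee_fin|apply/expe_ge0/mass_ge0].
Qed.

Let kernelE k (W : T -> R) s : (forall w, 0 <= W w)%R -> measurable_fun setT W ->
  \int[P]_w ((W w)%:E * mass w ^+ k * (cut s * Y s w)%:E) =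
  (cut s)%:E * mass_moment k (fun w => W w * Y s w)%R.
Proof.
move=> W0 mW; rewrite /mass_moment -ge0_integralZl//.
- apply: eq_integral => w _; rewrite !EFinM -[LHS]muleA [X in _ * X = _]muleC.
  by rewrite -!muleA [LHS]muleCA.
- have mWY : measurable_fun setT (fun w => W w * Y s w)%R.
    by apply: measurable_funM => //; exact: measurable_section.
  apply: emeasurable_funM; first exact/measurable_EFinP.
  elim: k => [|k IH]; first by under eq_fun do rewrite expe0; exact: measurable_cst.
  under eq_fun do rewrite expeS; apply: emeasurable_funM => //.
  exact: measurable_mass.
- move=> w _; apply: mule_ge0; first by rewrite lee_fin mulr_ge0.
  exact/expe_ge0/mass_ge0.
- by rewrite lee_fin.
Qed.

Lemma mass_momentS k (W : T -> R) : measurable_fun setT W -> (forall w, 0 <= W w)%R ->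
  mass_moment k.+1 W =
  \int[mu]_(s in `[0%R, t]) mass_moment k (fun w => W w * Y s w)%R.
Proof.
move=> mW W0; rewrite integral_cut.
have := fubini_tonelli (m1 := mu) (m2 := P) _ (measurable_kernel k mW) (kernel_ge0 k W0).
under [X in X = _ -> _]eq_integral do rewrite /= kernelE//.
move=> ->; apply: eq_integral => w _; rewrite [X in _ * X]expeS muleA muleAC.
rewrite [RHS](_ : _ = \int[mu]_s ((W w)%:E * mass w ^+ k * (cut s * Y s w)%:E))//.
rewrite ge0_integralZl//.
- congr (_ * _); rewrite /mass integral_cut.
  by apply: eq_integral => s _; rewrite EFinM.
- apply/measurable_EFinP.
  exact: (measurableT_comp mcut (measurable_pair2 w)).
- by move=> s _; rewrite lee_fin mulr_ge0.
- by apply: mule_ge0; [rewrite lee_fin|apply/expe_ge0/mass_ge0].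
Qed.

Lemma measurable_mass_moment k (W : T -> R) : measurable_fun setT W ->
  (forall w, 0 <= W w)%R ->
  measurable_fun (`[0%R, t]%classic : set (measurableTypeR R))
    (fun s => mass_moment k (fun w => W w * Y s w)%R).
Proof.
move=> mW W0.
have := measurable_fun_fubini_tonelli_F (m2 := P) _ (measurable_kernel k mW) (kernel_ge0 k W0).
move=> H; apply: (eq_measurable_fun _ _ (measurable_funTS H)) => s /set_mem st.
by rewrite /fubini_F /= kernelE// /cut indicE mem_set// mul1e.
Qed.

End tonelli_moments.

(** * Comparison of mixed moments through joint moments at finitely many times *)

Section moment_bounds.
Context d (T : measurableType d) (R : realType) (P : probability T R).
Local Open Scope ereal_scope.
Local Notation mu := (@lebesgue_measure R).
Variables (Y : R -> T -> R) (t : R).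
Hypothesis mY : measurable_fun setT (fun z : measurableTypeR R * T => Y z.1 z.2).
Hypothesis Y0 : forall s w, (0 <= Y s w)%R.

Local Notation within_time := (fun ss : seq R => {in ss, forall s : R, (0 <= s <= t)%R}).

Let mWY (W : T -> R) s : measurable_fun setT W -> measurable_fun setT (fun w => W w * Y s w)%R.
Proof. by move=> mW; apply: measurable_funM => //; exact: measurable_section. Qed.

Let WY0 (W : T -> R) s : (forall w, 0 <= W w)%R -> (forall w, 0 <= W w * Y s w)%R.
Proof. by move=> W0 w; exact: mulr_ge0. Qed.

Lemma mass_moment0 (W : T -> R) : mass_moment P Y t 0 W = \int[P]_w (W w)%:E.
Proof. by apply: eq_integral => w _; rewrite expe0 mule1. Qed.

Lemma mass_moment_ge0 k (W : T -> R) : (forall w, 0 <= W w)%R -> 0 <= mass_moment P Y t k W.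
Proof.
move=> W0; apply: integral_ge0 => w _; apply: mule_ge0; first by rewrite lee_fin.
exact/expe_ge0/mass_ge0.
Qed.

Lemma mass_moment_eq k (W W' : T -> R) :
  measurable_fun setT W -> (forall w, 0 <= W w)%R ->
  measurable_fun setT W' -> (forall w, 0 <= W' w)%R ->
  (forall ss, size ss = k -> within_time ss ->
    \int[P]_w (W w * \prod_(s <- ss) Y s w)%:E = \int[P]_w (W' w * \prod_(s <- ss) Y s w)%:E) ->
  mass_moment P Y t k W = mass_moment P Y t k W'.
Proof.
elim: k W W' => [|k IH] W W' mW W0 mW' W0' H.
  rewrite !mass_moment0; have := H [::] erefl.
  under eq_integral do rewrite big_nil mulr1.
  by under [X in _ = X]eq_integral do rewrite big_nil mulr1; apply.
rewrite (mass_momentS P t mY Y0 k mW W0) (mass_momentS P t mY Y0 k mW' W0').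
apply: eq_integral => s; rewrite inE/= in_itv/= => st.
apply: IH; [exact: mWY|exact: WY0|exact: mWY|exact: WY0|].
move=> ss sz sst; have := H (s :: ss); rewrite /= sz => /(_ erefl).
under eq_integral do rewrite big_cons mulrA.
under [X in _ = X]eq_integral do rewrite big_cons mulrA.
by apply => u; rewrite inE => /predU1P[->//|]; exact: sst.
Qed.

Variables (K : nat) (B : seq R -> R) (ker : seq R -> R -> R) (Q : R).
Hypothesis t0 : (0 <= t)%R.
Hypothesis B0 : forall ss, (0 <= B ss)%R.
Hypothesis Q0 : (0 <= Q)%R.
Hypothesis mker : forall ss, measurable_fun [set: R] (ker ss).
Hypothesis B_cons : forall s ss, ss != [::] -> (size ss < K)%N ->
  (B (s :: ss) <= B ss * ker ss s)%R.
Hypothesis ker_ge0 : forall ss s, (0 <= ker ss s)%R.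
Hypothesis ker_int : forall ss, within_time ss -> (size ss < K)%N ->
  \int[mu]_(s in `[0%R, t]) (ker ss s)%:E <= Q%:E.

(** The times [ss] are already extracted; each of the k remaining integrations multiplies the bound
    by an integral of [ker], at most Q. *)
Let mass_moment_cons_le k (W : T -> R) ss :
  measurable_fun setT W -> (forall w, 0 <= W w)%R ->
  (forall ss', size ss' = K -> within_time ss' ->
     \int[P]_w (W w * \prod_(s <- ss') Y s w)%:E <= (B ss')%:E) ->
  ss != [::] -> (size ss + k)%N = K -> within_time ss ->
  mass_moment P Y t k (fun w => W w * \prod_(s <- ss) Y s w)%R <= (B ss * Q ^+ k)%:E.
Proof.
move=> mW W0 H; elim: k ss => [|k IH] ss ss0 sz sst.
  by rewrite mass_moment0 expr0 mulr1 H// -sz addn0.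
have mWss : measurable_fun setT (fun w => W w * \prod_(s <- ss) Y s w)%R.
  apply: measurable_funM => //; apply: measurable_prod => s _.
  exact: measurable_section.
have Wss0 w : (0 <= W w * \prod_(s <- ss) Y s w)%R.
  by rewrite mulr_ge0// prodr_ge0.
have szK : (size ss < K)%N by rewrite -sz addnS ltnS leq_addr.
rewrite (mass_momentS P t mY Y0 k mWss Wss0).
apply: (@le_trans _ _ (\int[mu]_(s in `[0%R, t]) ((B ss * Q ^+ k)%:E * (ker ss s)%:E))).
  apply: ge0_le_integral => //.
  - by move=> s _; apply: mass_moment_ge0; exact: WY0.
  - exact: measurable_mass_moment.
  - apply: emeasurable_funM => //; apply/measurable_EFinP; apply: measurable_funTS.
    exact: mker.
  move=> s /=; rewrite in_itv/= => st.
  have sst' : within_time (s :: ss).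
    by move=> u; rewrite inE => /predU1P[->//|]; exact: sst.
  have := IH (s :: ss) isT _ sst'; rewrite /= addSnnS => /(_ sz).
  under [X in X <= _ -> _]eq_integral do rewrite big_cons (mulrC (Y _ _)) mulrA.
  move/le_trans; apply; rewrite -EFinM lee_fin mulrAC ler_wpM2r ?exprn_ge0//.
  exact: B_cons.
rewrite ge0_integralZl//.
- by rewrite exprSr mulrA [leRHS]EFinM lee_wpmul2l// ?ker_int// lee_fin mulr_ge0// exprn_ge0.
- apply/measurable_EFinP; apply: measurable_funTS; exact: mker.
- by move=> s _; rewrite lee_fin.
- by rewrite lee_fin mulr_ge0// exprn_ge0.
Qed.

(** The first time extracted has no other to interact with: it contributes the constant C and the
    length t, and each of the K - 1 others a factor Q. *)
Lemma mass_moment_le (W : T -> R) (C : R) : (0 < K)%N ->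
  measurable_fun setT W -> (forall w, 0 <= W w)%R ->
  (forall ss, size ss = K -> within_time ss ->
     \int[P]_w (W w * \prod_(s <- ss) Y s w)%:E <= (B ss)%:E) ->
  (forall s, B [:: s] <= C)%R ->
  mass_moment P Y t K W <= (C * Q ^+ K.-1 * t)%:E.
Proof.
move=> K_gt0 mW W0 H BC.
rewrite -{1}(prednK K_gt0) (mass_momentS P t mY Y0 _ mW W0).
apply: (@le_trans _ _ (\int[mu]_(s in `[0%R, t]) (C * Q ^+ K.-1)%:E)).
  apply: ge0_le_integral => //.
  - by move=> s _; apply: mass_moment_ge0; exact: WY0.
  - exact: measurable_mass_moment.
  move=> s /=; rewrite in_itv/= => st.
  have sst : within_time [:: s] by move=> u; rewrite inE => /eqP ->.
  have := mass_moment_cons_le mW W0 H (isT : [:: s] != [::]) _ sst (k := K.-1).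
  rewrite add1n prednK// => /(_ erefl).
  under [X in X <= _ -> _]eq_integral do rewrite big_seq1.
  by move/le_trans; apply; rewrite lee_fin ler_wpM2r ?exprn_ge0.
rewrite integral_cst//= lebesgue_measure_itv/= lte_fin.
case: ltP => [_|t0']; first by rewrite sube0 EFinM.
by rewrite mule0 (le_anti (introT andP (conj t0' t0))) mulr0.
Qed.

End moment_bounds.

(** * Anchored moments of the cascade, with coarse scales frozen at time 0 *)

Section cascade.
Context d (T : measurableType d) (R : realType) (P : probability T R).
Variables (kappa delta lam gamma : R) (X : R -> T -> R) (Lj : nat -> R -> T -> R).
Hypothesis kappa01 : 0 < kappa < 1.
Hypothesis delta_gt0 : 0 < delta.
Hypothesis lam_gt0 : 0 < lam.
Hypothesis gamma_ge0 : 0 <= gamma.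
Hypothesis X_OU : stationary_OU P lam (tempered_stable kappa delta gamma) X.
Hypothesis Lj_copies : independent_copies P
  (geometric_process (c_X kappa delta gamma) X) Lj.
Variables (p : nat) (b : R).

Local Notation g := (gamma `^ kappa^-1).
Local Notation cum := (cumulant kappa delta gamma).
Local Notation lm := (log_moment kappa delta gamma).
Local Notation om := (decay_rate kappa delta gamma p).
Local Notation xi := (log_copy Lj).
Local Notation logE := (log_anchored kappa delta lam gamma).

Hypothesis p_ge2 : (2 <= p)%N.
Hypothesis p_le : 2 * p%:R <= g.
Hypothesis om_lt : expR om < b.

Lemma om_ge0 : 0 <= om.
Proof. exact: decay_rate_ge0. Qed.

Lemma b_gt1 : 1 < b.
Proof. by apply: le_lt_trans om_lt; rewrite -[leLHS]expR0 ler_expR om_ge0. Qed.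

Let b_gt0 : 0 < b. Proof. exact: lt_trans b_gt1. Qed.
Let bn_gt0 n : 0 < b ^+ n. Proof. exact: exprn_gt0. Qed.

Definition cascade N (s : R) (w : T) : R := expR (\sum_(j < N) xi j (s * b ^+ j) w).

(* On [0, b^-n] the n coarsest factors of the cascade hardly move from their value
   [anchor n 1] at time 0. *)
Definition anchor n (a : R) (w : T) : R := expR (\sum_(j < n) a * xi j 0 w).

Lemma measurable_cascade N :
  measurable_fun setT (fun z : measurableTypeR R * T => cascade N z.1 z.2).
Proof.
apply: measurableT_comp => //; apply: measurable_sum => j.
have mt : measurable_fun setT (fun z : measurableTypeR R * T =>
    (z.1 * b ^+ j : measurableTypeR R, z.2)).
  by apply: measurable_fun_pair => //; apply: measurable_funM.
exact: (measurableT_comp (log_copy_measurable2 Lj_copies j) mt).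
Qed.

Lemma cascade_ge0 N s w : 0 <= cascade N s w. Proof. exact: expR_ge0. Qed.

Lemma measurable_anchor n a : measurable_fun setT (anchor n a).
Proof.
apply: measurableT_comp => //; apply: measurable_sum => j.
apply: measurable_funM => //; exact: (log_copy_measurable Lj_copies).
Qed.

Lemma anchor_ge0 n a w : 0 <= anchor n a w. Proof. exact: expR_ge0. Qed.

(** Independence of the copies makes the logarithm a sum over scales. Two lists are kept for the
    martingale identity, where cascades of different depths are multiplied; the times of [l2] are
    absent from scale M on. *)
Lemma cascade_moment N n M (a : R) (l1 l2 : seq R) : (n <= N)%N -> (M <= N)%N ->
  {in l1 ++ l2, forall s : R, 0 <= s} ->
  (size (l1 ++ l2) <= p)%N -> a + (size (l1 ++ l2))%:R <= p%:R ->
  (\int[P]_w (anchor n a w * \prod_(s <- l1) cascade N s w * \prod_(s <- l2) cascade M s w)%:E =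
   (expR (\sum_(j < N) logE (if (j < n)%N then a else 0)
      [seq s * b ^+ j | s <- l1 ++ (if (j < M)%N then l2 else [::])]))%:E)%E.
Proof.
move=> nN MN l0 szp ap.
pose al j := if (j < n)%N then a else 0.
pose l j := [seq s * b ^+ j | s <- l1 ++ (if (j < M)%N then l2 else [::])].
have sl j : (size (l j) <= size (l1 ++ l2))%N.
  by rewrite size_map !size_cat leq_add2l; case: ifP.
have g2 (x : R) : x <= p%:R -> 2 * x <= g.
  by move=> xp; apply: le_trans p_le; rewrite ler_pM2l.
have := @log_copies_moment _ _ _ P _ _ _ _ X Lj kappa01 lam_gt0 X_OU Lj_copies N al l.
move=> <-.
- apply: eq_integral => w _; congr EFin.
  rewrite /anchor /cascade -!expR_sum -!expRD; congr expR.
  rewrite big_split /= -addrA; congr (_ + _).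
    rewrite (big_ord_widen_cond N xpredT (fun j => a * xi j 0 w))//= big_mkcond /=.
    by apply: eq_bigr => j _; rewrite /al; case: ifP; rewrite ?mul0r.
  under [RHS]eq_bigr do rewrite /l big_map big_cat /=.
  rewrite big_split /= exchange_big /=; congr (_ + _).
  rewrite exchange_big /=.
  rewrite (big_ord_widen_cond N xpredT (fun j => \sum_(s <- l2) xi j (s * b ^+ j) w))//=.
  rewrite big_mkcond /=; apply: eq_bigr => j _.
  by case: ifP => // _; rewrite big_nil.
- move=> j u /mapP[s sl' ->]; rewrite mulr_ge0 ?(ltW (bn_gt0 _))// l0//.
  by move: sl'; rewrite !mem_cat; case: ifP => // _; rewrite in_nil orbF => ->.
- move=> j; apply: g2; rewrite /al; case: ifP => _.
    by apply: le_trans ap; rewrite lerD2l ler_nat.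
  by rewrite add0r ler_nat (leq_trans (sl j)).
- by move=> j; apply: g2; rewrite ler_nat (leq_trans (sl j)).
Qed.

Lemma log_anchored0 us : logE 0 us = log_joint kappa delta gamma lam (insertion_sort us).
Proof. by rewrite /log_anchored oppr0 mul0r !add0r subrr add0r. Qed.

Lemma log_anchored_nil a : logE a [::] = lm a.
Proof.
rewrite /log_anchored /lag big_nil addr0 (cumulant0 _ kappa01 gamma_ge0)//=.
by rewrite subr0 addr0 /log_moment mulNr addrC.
Qed.

(** At scale j every gap is multiplied by b^j, so that summing [log_joint_le] over the scales gives
    the potential of each gap. *)
Lemma log_joint_scale_le us n N : (size us <= p)%N ->
  \sum_(n <= j < N) log_joint kappa delta gamma lam (insertion_sort [seq s * b ^+ j | s <- us]) <=
  gap_sum (scale_potential lam b om n N) (insertion_sort us).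
Proof.
move=> szp; rewrite gap_sumZ gap_sum_sum mulr_sumr; apply: ler_sum => j _.
have -> : [seq s * b ^+ j | s <- us] = [seq b ^+ j * s | s <- us].
  by apply: eq_map => s; rewrite mulrC.
apply: (le_trans (log_joint_le kappa01 delta_gt0 gamma_ge0 lam_gt0 p_ge2 p_le _ _)).
- exact: sorted_insertion_sort.
- by rewrite (perm_size (perm_insertion_sort _)) size_map.
rewrite insertion_sort_scale// gap_sum_scale.
by under [in leRHS]eq_fun do rewrite -mulrA.
Qed.

Lemma one_sub_expR_le (x : R) : 1 - expR (- x) <= x.
Proof. by have := expR_ge1Dx (- x); lra. Qed.

Let kappa_gt0 : 0 < kappa. Proof. by case/andP: kappa01. Qed.

Lemma powR_le_mono (x y : R) : 0 <= x -> x <= y -> x `^ kappa <= y `^ kappa.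
Proof. by move=> x0 xy; rewrite ge0_ler_powR ?nnegrE ?(ltW kappa_gt0)//; apply: le_trans xy. Qed.

(** For times up to h, [lag] is within p lam h of p, so that moving them to 0 costs a Hoelder error
    in the cumulant. The interaction [log_joint] is at most [lm p], its value at coinciding times.
    The sign of a keeps a + p in the domain of the cumulant. *)
Lemma log_anchored_le (a h : R) us : size us = p -> {in us, forall u : R, 0 <= u <= h} ->
  0 <= h -> a <= 0 ->
  logE a us <= lm (a + p%:R) + delta * (2 * p%:R * lam * h) `^ kappa.
Proof.
move=> szp ush h0 a0.
have us0 : {in us, forall u : R, 0 <= u} by move=> u /ush /andP[].
have /andP[x0 x1] := lag0_itv lam_gt0 us0.
rewrite szp in x1.
have xg : 2 * p%:R <= g := p_le.
have h1 : cum (a + lag lam 0 us) <= cum (a + p%:R).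
  by apply: cumulant_nondecreasing => //; lra.
have h2 : cum p%:R - cum (lag lam 0 us) <= delta * (2 * (p%:R - lag lam 0 us)) `^ kappa.
  exact: cumulant_holder.
have h3 : log_joint kappa delta gamma lam (insertion_sort us) <= lm p%:R.
  have := @log_joint_le _ kappa delta gamma kappa01 delta_gt0 gamma_ge0 lam lam_gt0 p p_ge2 p_le
    (insertion_sort us) (sorted_insertion_sort _).
  rewrite (perm_size (perm_insertion_sort _)) szp leqnn => /(_ isT) /le_trans; apply.
  rewrite (log_moment_p _ _ _ p_ge2) ler_wpM2l ?om_ge0//.
  case: (insertion_sort us) (sorted_insertion_sort us) (perm_size (perm_insertion_sort us)).
    by rewrite /gap_sum ler0n.
  move=> s ss; rewrite szp => pth <-; rewrite -[_.-1]/(size ss).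
  elim: ss s pth => [|v ss IH] s; first by rewrite /gap_sum /= big_nil.
  move=> /andP[sv pv]; rewrite gap_sum_cons2 -[size _]/(size ss).+1 -nat1r lerD ?IH//.
  by rewrite -[leRHS]expR0 ler_expR mulNr oppr_le0 mulr_ge0 ?(ltW lam_gt0) ?subr_ge0.
have h4 : (2 * (p%:R - lag lam 0 us)) `^ kappa <= (2 * p%:R * lam * h) `^ kappa.
  apply: powR_le_mono; first by rewrite mulr_ge0// subr_ge0.
  rewrite -!mulrA ler_pM2l//.
  have -> : p%:R - lag lam 0 us = \sum_(u <- us) (1 - expR (- lam * u)).
    rewrite sumrB /lag big_const_seq count_predT iter_addr_0 szp; congr (_ - _).
    by apply: eq_bigr => u _; rewrite subr0.
  rewrite -szp mulr_natl -iter_addr_0 -(count_predT us) -big_const_seq.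
  rewrite big_seq [leRHS]big_seq; apply: ler_sum => u /ush /andP[u0 uh].
  rewrite mulNr; apply: le_trans (one_sub_expR_le _) _.
  by rewrite ler_pM2l.
have := ler_wpM2l (ltW delta_gt0) h4.
by move: h1 h2 h3; rewrite /log_anchored /log_moment; lra.
Qed.

(** A single time has no interaction: monotonicity replaces [cum y] by [cum 1], and only the Hoelder
    loss from moving u to 0 remains. *)
Lemma log_anchored1_ge (q u : R) : 0 <= u -> q <= p%:R ->
  lm q - delta * (2 * lam * u) `^ kappa <= logE (q - 1) [:: u].
Proof.
move=> u0 qp; rewrite /log_anchored /= /lag !big_nil big_seq1 (increment0 _ kappa01)//.
rewrite subr0 !addr0.
set y := expR _.
have y1 : y <= 1.
  by rewrite /y -[leRHS]expR0 ler_expR mulNr oppr_le0 mulr_ge0 ?(ltW lam_gt0).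
have g2 : 2 * 1 <= g.
  by rewrite (le_trans _ p_le)// ler_pM2l// ler1n (leq_trans _ p_ge2).
have h1 : cum y <= cum 1 by exact: cumulant_nondecreasing.
have h2 : cum q - cum (q - 1 + y) <= delta * (2 * (q - (q - 1 + y))) `^ kappa.
  apply: cumulant_holder => //; first by lra.
  by rewrite (le_trans _ p_le)// ler_pM2l.
have h4 : (2 * (q - (q - 1 + y))) `^ kappa <= (2 * lam * u) `^ kappa.
  apply: powR_le_mono; first by lra.
  by have := one_sub_expR_le (lam * u); rewrite -mulNr -/y; lra.
have := ler_wpM2l (ltW delta_gt0) h4.
by move: h1 h2; rewrite /log_moment; lra.
Qed.

Local Notation ratio := (b^-1 `^ kappa).

(** Total error of freezing the scales j < n on [0, b^-n]: from the finest of them to the coarsest,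
    the errors decrease geometrically with ratio b^-kappa, whatever n. *)
Definition holder_bound : R := delta * (2 * p%:R * lam) `^ kappa * (1 - ratio)^-1.

Let ratio01 : 0 <= ratio < 1.
Proof.
rewrite powR_ge0/=; have := @gt0_ltr_powR R _ kappa_gt0 b^-1 1.
rewrite powR1 !nnegrE invr_ge0 (ltW b_gt0) ler01; apply => //.
by rewrite invf_lt1// b_gt1.
Qed.

Let powR_exprn (x : R) m : 0 <= x -> (x ^+ m) `^ kappa = (x `^ kappa) ^+ m.
Proof. by move=> x0; rewrite -powR_mulrn// powRAC powR_mulrn// powR_ge0. Qed.

Lemma sum_holder_le n (x t : R) : 0 <= t <= b ^- n -> 0 <= x -> x <= 2 * p%:R * lam ->
  \sum_(j < n) delta * (x * (t * b ^+ j)) `^ kappa <= holder_bound.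
Proof.
move=> /andP[t0 tn] x0 xp; rewrite /holder_bound -mulr_sumr -mulrA ler_pM2l//.
apply: (@le_trans _ _ (\sum_(j < n) (2 * p%:R * lam) `^ kappa * ratio ^+ (rev_ord j))).
  apply: ler_sum => j _; rewrite powRM ?mulr_ge0 ?(ltW (bn_gt0 _))//.
  apply: ler_pM; rewrite ?powR_ge0//; first exact: powR_le_mono.
  rewrite -powR_exprn ?invr_ge0 ?(ltW b_gt0)//; apply: powR_le_mono.
    by rewrite mulr_ge0// ltW.
  apply: (@le_trans _ _ (b ^- n * b ^+ j)); first by rewrite ler_wpM2r// ltW.
  rewrite exprVn; set m := nat_of_ord (rev_ord j).
  have -> : b ^+ n = b ^+ m * b ^+ j * b.
    by rewrite -exprD -exprSr; congr (b ^+ _); rewrite /m /= -addnS subnK.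
  have -> : (b ^+ m * b ^+ j * b)^-1 * b ^+ j = b ^- m * b^-1.
    by field; rewrite !gt_eqF.
  by rewrite ler_piMr// ?invr_ge0 ?(ltW (bn_gt0 _))// invf_le1 ?ltW ?b_gt1.
rewrite -mulr_sumr ler_wpM2l ?powR_ge0//.
rewrite (reindex_inj rev_ord_inj); under eq_bigr do rewrite rev_ordK.
exact: geometric_sum_le.
Qed.

(** Bernoulli's inequality; the exponent feeds [scale_potential_half]. *)
Lemma exists_doubling : exists k, 2 <= b ^+ k.
Proof.
have b1 : 0 < b - 1 by rewrite subr_gt0 b_gt1.
pose k := (Num.truncn (b - 1)^-1).+1; exists k.
have H : 1 <= k%:R * (b - 1) by rewrite -ler_pdivrMr// div1r ltW// truncnS_gt.
have : 1 + k%:R * (b - 1) <= b ^+ k; last by lra.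
rewrite {H}; elim: k => [|k IH]; first by rewrite mul0r addr0 expr0.
have k0 : 0 <= k%:R :> R by [].
rewrite exprS -natr1; have := ler_wpM2l (ltW b_gt0) IH.
by have := mulr_ge0 (mulr_ge0 k0 (ltW b1)) (ltW b1); lra.
Qed.

Lemma anchor_expectation n (q : R) : q <= p%:R ->
  (\int[P]_w (anchor n q w)%:E = (expR (n%:R * lm q))%:E)%E.
Proof.
move=> qp.
have := @cascade_moment n n n q [::] [::] (leqnn _) (leqnn _); rewrite /= addr0.
under eq_integral do rewrite !big_nil !mulr1.
move=> ->//; congr (expR _)%:E.
under eq_bigr => j _ do rewrite ltn_ord /= log_anchored_nil.
by rewrite sumr_const card_ord mulr_natl.
Qed.

Lemma mass_anchor_lower n N (q t : R) : (n <= N)%N -> q <= p%:R -> 0 <= t <= b ^- n ->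
  ((t * expR (n%:R * lm q - holder_bound))%:E <=
   mass_moment P (cascade N) t 1 (anchor n (q - 1)))%E.
Proof.
move=> nN qp /andP[t0 tn].
rewrite (mass_momentS P t (measurable_cascade N) (cascade_ge0 N) _
  (measurable_anchor n _) (anchor_ge0 n _)).
apply: (@le_trans _ _ (\int[lebesgue_measure]_(s in `[0%R, t])
  (expR (n%:R * lm q - holder_bound))%:E)%E).
  rewrite integral_cst//= lebesgue_measure_itv/= lte_fin.
  case: ltP => [_|t0']; first by rewrite sube0 -EFinM mulrC.
  by rewrite (le_anti (introT andP (conj t0' t0))) mul0r mule0.
apply: ge0_le_integral => //.
- exact: (measurable_mass_moment P (measurable_cascade N) (cascade_ge0 N) _
    (measurable_anchor n _) (anchor_ge0 n _)).
move=> s /=; rewrite in_itv/= => /andP[s0 st]; rewrite mass_moment0.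
have s0' : {in [:: s] ++ [::], forall u : R, 0 <= u} by move=> u; rewrite inE => /eqP ->.
have p1 : (size ([:: s] ++ [::] : seq R) <= p)%N by rewrite (leq_trans _ p_ge2).
have ap : q - 1 + (size ([:: s] ++ [::] : seq R))%:R <= p%:R by rewrite subrK.
have := @cascade_moment N n N (q - 1) [:: s] [::] nN (leqnn _) s0' p1 ap.
under eq_integral do rewrite big_seq1 big_nil mulr1.
move=> ->.
rewrite lee_fin ler_expR.
have -> : \sum_(j < N) logE (if (j < n)%N then q - 1 else 0)
    [seq s0 * b ^+ j | s0 <- [:: s] ++ (if (j < N)%N then [::] else [::])] =
    \sum_(j < n) logE (q - 1) [:: s * b ^+ j].
  rewrite (big_ord_widen_cond N xpredT (fun j => logE (q - 1) [:: s * b ^+ j]))//=.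
  rewrite [RHS]big_mkcond /=; apply: eq_bigr => j _; rewrite ltn_ord.
  case: ifP => // _; rewrite log_anchored0 /= /lag big_nil.
  by rewrite (increment0 _ kappa01)// addr0.
rewrite lerBlDr; apply: (@le_trans _ _ (\sum_(j < n) (logE (q - 1) [:: s * b ^+ j] +
    delta * (2 * lam * (s * b ^+ j)) `^ kappa))).
  rewrite mulr_natl -[n in leLHS]card_ord -sumr_const; apply: ler_sum => j _.
  by rewrite -lerBlDr log_anchored1_ge// mulr_ge0// ltW.
rewrite big_split /= lerD2l; apply: sum_holder_le.
- by rewrite s0 (le_trans st).
- by rewrite mulr_ge0// ltW.
- rewrite -mulrA ler_pM2l// -[leLHS]mul1r ler_wpM2r ?(ltW lam_gt0)//.
  by rewrite ler1n (leq_trans _ p_ge2).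
Qed.

(** Freezing the scales below n costs [holder_bound] and completes the anchor to the power q. The
    scales from n on interact through the potential, whose exponential has an integral of order b^-n
    over [0, t]. The constant is uniform in n, N, q and t. *)
Lemma mass_anchor_upper : exists2 C : R, 0 < C &
  forall n N (q t : R), (n <= N)%N -> q <= p%:R -> 0 <= t <= b ^- n ->
  (mass_moment P (cascade N) t p (anchor n (q - p%:R)) <=
   (C * expR (n%:R * lm q) * b ^- n ^+ p)%:E)%E.
Proof.
have [k0 bk0] := exists_doubling.
pose cc := om * k0%:R.
have cc0 : 0 <= cc by rewrite mulr_ge0// om_ge0.
have p_gt0 : (0 < p)%N by rewrite (leq_trans _ p_ge2).
pose pb := potential_bound lam b om.
pose C := expR holder_bound * (1 + expR cc * p%:R * pb) ^+ p.-1.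
have b1 : 0 < 1 - b^-1 by rewrite subr_gt0 invf_lt1// b_gt1.
have pb0 : 0 <= pb.
  have q1 : 0 < 1 - expR om / b by rewrite subr_gt0 ltr_pdivrMr// mul1r.
  by rewrite /pb /potential_bound /shell_bound divr_ge0 ?(ltW q1)// mulr_ge0 ?expR_ge0.
have C1 : 1 <= 1 + expR cc * p%:R * pb.
  by rewrite lerDl; apply: mulr_ge0 => //; exact: mulr_ge0 (expR_ge0 _) (ler0n _ _).
exists C.
  by apply: mulr_gt0; [exact: expR_gt0|apply: exprn_gt0; exact: lt_le_trans C1].
move=> n N q t nN qp /andP[t0 tn].
pose psi := scale_potential lam b om n N.
(* B depends on the times only through their sorted gaps, so that an additional time is one
   insertion. *)
pose B (ss : seq R) := expR (n%:R * lm q + holder_bound) * expR (gap_sum psi (insertion_sort ss)).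
pose ker (ss : seq R) (s : R) := expR cc * \sum_(u <- ss) expR (psi `|s - u|).
(* [expR cc] is the constant of an insertion, p bounds the number of potentials, and [pb * b ^- n]
   bounds the integral for each: as t <= b^-n, [0, t] lies in the ball of radius b^-n about any of
   its points. *)
pose Q := expR cc * p%:R * (pb * b ^- n).
have := @mass_moment_le _ _ _ P (cascade N) t (measurable_cascade N) (cascade_ge0 N) p B ker Q t0.
have psum (ss : seq R) s : \sum_(u <- insertion_sort ss) expR (psi `|s - u|) =
    \sum_(u <- ss) expR (psi `|s - u|).
  by apply: perm_big; exact: perm_insertion_sort.
have B0 ss : 0 <= B ss by rewrite mulr_ge0 ?expR_ge0.
have Q0 : 0 <= Q.
  apply: mulr_ge0; first exact: mulr_ge0 (expR_ge0 _) (ler0n _ _).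
  by apply: mulr_ge0 => //; rewrite invr_ge0 ltW.
move=> /(_ B0 Q0) H.
have mker ss : measurable_fun [set: R] (ker ss).
  apply: measurable_funM => //; apply: measurable_sum => u.
  exact: measurable_scale_potential_dist.
have B_cons s (ss : seq R) : ss != [::] -> (size ss < p)%N -> B (s :: ss) <= B ss * ker ss s.
  move=> ss0 _; rewrite /B /ker -mulrA ler_wpM2l ?expR_ge0// -psum mulrA.
  rewrite (mulrC (expR (gap_sum _ _)))/=; apply: gap_sum_insert => //.
  - by move=> h h' h0 hh; apply: scale_potential_nonincreasing => //; [exact: b_gt1|exact: om_ge0].
  - by move=> h h0; apply: scale_potential_half => //; [exact: b_gt1|exact: om_ge0].
  - by apply: contra ss0 => /eqP E; rewrite -size_eq0 -(perm_size (perm_insertion_sort ss)) E.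
  - exact: sorted_insertion_sort.
have ker0 ss s : 0 <= ker ss s.
  by rewrite mulr_ge0 ?expR_ge0// sumr_ge0// => *; exact: expR_ge0.
have ker_int (ss : seq R) : {in ss, forall s : R, 0 <= s <= t} -> (size ss < p)%N ->
    (\int[lebesgue_measure]_(s in `[0%R, t]) (ker ss s)%:E <= Q%:E)%E.
  move=> sst szp.
  have mpsi (A : set (measurableTypeR R)) u : measurable_fun A (fun s : R => (expR (psi `|s - u|))%:E).
    apply/measurable_EFinP; apply: measurable_funTS.
    exact: measurable_scale_potential_dist.
  rewrite /ker; under eq_integral do rewrite EFinM -sumEFin.
  rewrite ge0_integralZl//; last 2 first.
  - by apply: emeasurable_sum => u.
  - by move=> s _; apply: sume_ge0 => u _; rewrite lee_fin expR_ge0.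
  rewrite ge0_integral_sum//.
  rewrite /Q -mulrA EFinM lee_wpmul2l ?lee_fin ?expR_ge0//.
  apply: (@le_trans _ _ (\sum_(u <- ss) (pb * b ^- n)%:E)%E).
    rewrite big_seq [leRHS]big_seq; apply: lee_sum => u /sst /andP[u0 ut].
    apply: le_trans (integral_scale_potential_le lam_gt0 b_gt1 om_ge0 om_lt n N u).
    apply: ge0_subset_integral => //=.
    - have -> : [set x : R | `|x - u| <= b ^- n] = `[u - b ^- n, u + b ^- n]%classic.
        by apply/seteqP; split=> x /=; rewrite in_itv/= ler_distl.
      exact: measurable_itv.
    - move=> s /=; rewrite in_itv/= => /andP[s0 st]; rewrite ler_distl.
      by move: tn; lra.
  rewrite sumEFin lee_fin big_const_seq count_predT iter_addr_0 -[leLHS]mulr_natl.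
  apply: ler_wpM2r; last by rewrite ler_nat ltnW.
  by apply: mulr_ge0 => //; rewrite invr_ge0 ltW.
have {}H := H mker B_cons ker0 ker_int _ _ p_gt0 (measurable_anchor n (q - p%:R)) (anchor_ge0 n _).
apply: le_trans (H (expR (n%:R * lm q + holder_bound)) _ _) _.
- move=> ss szss sst.
  have ss0 : {in ss, forall s : R, 0 <= s} by move=> s /sst /andP[].
  have := @cascade_moment N n N (q - p%:R) ss [::] nN (leqnn _).
  under eq_integral do rewrite big_nil mulr1.
  rewrite cats0 szss subrK => ->//; rewrite lee_fin /B -expRD ler_expR.
  have -> : \sum_(j < N) logE (if (j < n)%N then q - p%:R else 0)
      [seq s0 * b ^+ j | s0 <- ss ++ (if (j < N)%N then [::] else [::])] =
      \sum_(0 <= j < n) logE (q - p%:R) [seq s * b ^+ j | s <- ss] +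
      \sum_(n <= j < N) log_joint kappa delta gamma lam (insertion_sort [seq s * b ^+ j | s <- ss]).
    rewrite -(big_mkord xpredT (fun j => logE (if (j < n)%N then q - p%:R else 0)
      [seq s0 * b ^+ j | s0 <- ss ++ (if (j < N)%N then [::] else [::])])).
    rewrite (big_cat_nat (n := n))//=; congr (_ + _); apply: eq_big_nat => j /andP[j1 j2].
      by rewrite j2 if_same cats0.
    by rewrite ltnNge j1 /= if_same cats0 log_anchored0.
  apply: lerD; last by apply: log_joint_scale_le; rewrite szss.
  rewrite big_mkord; apply: (@le_trans _ _ (\sum_(j < n) (lm q +
      delta * (2 * p%:R * lam * (t * b ^+ j)) `^ kappa))).
    apply: ler_sum => j _; have := @log_anchored_le (q - p%:R) (t * b ^+ j) [seq s * b ^+ j | s <- ss].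
    rewrite subrK size_map szss; apply => //.
    - move=> u /mapP[s /sst /andP[s0 st] ->].
      by rewrite mulr_ge0 ?(ltW (bn_gt0 _))//= ler_wpM2r// ltW.
    - by rewrite mulr_ge0// ltW.
    - by rewrite subr_le0.
  rewrite big_split /= sumr_const card_ord -(mulr_natl (lm q)) lerD2l; apply: sum_holder_le => //.
    by rewrite t0.
  by rewrite !mulr_ge0// ltW.
- by move=> s; rewrite /B /= /gap_sum /= big_nil expR0 mulr1.
rewrite lee_fin /C expRD -[p in b ^- n ^+ p](prednK p_gt0) exprSr.
have -> : expR holder_bound * (1 + expR cc * p%:R * pb) ^+ p.-1 * expR (n%:R * lm q) *
  (b ^- n ^+ p.-1 * b ^- n) = expR (n%:R * lm q) * expR holder_bound *
  ((1 + expR cc * p%:R * pb) * b ^- n) ^+ p.-1 * b ^- n.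
  by rewrite [(_ * b ^- n) ^+ p.-1]exprMn; ring.
apply: ler_pM => //.
- by rewrite !mulr_ge0 ?expR_ge0// exprn_ge0.
- rewrite ler_wpM2l ?mulr_ge0 ?expR_ge0// lerXn2r ?nnegrE//.
    by rewrite mulr_ge0 ?invr_ge0 ?(ltW (bn_gt0 _))// (le_trans _ C1).
  by rewrite /Q mulrA ler_wpM2r ?invr_ge0 ?(ltW (bn_gt0 _))// lerDr.
Qed.

End cascade.

(** * Power inequalities and fast Cauchy sequences *)

Section Lp_martingale.
Context {R : realType}.

(* Taylor's formula for the convex function [x^(m+2)], with the remainder bounded below. *)
Lemma power_gap (a b : R) m : 0 <= a -> 0 <= b ->
  `|b - a| ^+ m.+2 + m.+2%:R * (a ^+ m.+1 * b) <= b ^+ m.+2 + m.+1%:R * a ^+ m.+2.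
Proof.
move=> a0 b0; elim: m => [|m IH].
  by rewrite real_normK ?num_real// le_eqVlt; apply/orP; left; apply/eqP; ring.
set d := `|b - a| in IH *; set x := a ^+ m.+1 in IH.
have x0 : 0 <= x by rewrite exprn_ge0.
have d0 : 0 <= d by rewrite normr_ge0.
have d2 : (b - a) ^+ 2 = d ^+ 2 by rewrite /d real_normK ?num_real.
have ea : a ^+ m.+2 = a * x by rewrite exprS.
have ea3 : a ^+ m.+3 = a ^+ 2 * x by rewrite exprS ea; ring.
rewrite ea in IH; rewrite ea3 ea.
have IHb := ler_wpM2l b0 IH.
(* This is what remains once the induction hypothesis is multiplied by b. For a <= b the first term
   suffices because d <= b, otherwise the second because d <= a. *)
have dm : d ^+ m.+3 <= b * d ^+ m.+2 + m.+2%:R * x * d ^+ 2.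
  have [ab|ba] := leP a b.
    have db : d <= b by rewrite /d ger0_norm ?subr_ge0// gerBl.
    rewrite exprS -[leLHS]addr0 lerD ?ler_wpM2r ?exprn_ge0//.
    by rewrite !mulr_ge0 ?exprn_ge0.
  have da : d <= a by rewrite /d ltr0_norm ?subr_lt0// opprB gerBl.
  have -> : d ^+ m.+3 = d ^+ m.+1 * d ^+ 2 by rewrite -exprD addn2.
  rewrite -[leLHS]add0r lerD//.
    by rewrite mulr_ge0 ?exprn_ge0.
  rewrite ler_wpM2r ?exprn_ge0// (@le_trans _ _ x)//.
    by rewrite lerXn2r ?nnegrE.
  by rewrite ler_peMl// ler1n.
have e3 : b ^+ m.+3 = b * b ^+ m.+2 by rewrite exprS.
have s1 : m.+3%:R = m.+2%:R + 1 :> R by rewrite natr1.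
have s2 : m.+1%:R = m.+2%:R - 1 :> R by rewrite -[m.+2%:R]natr1 addrK.
rewrite e3 s1; rewrite s2 in IHb; rewrite -d2 in dm.
by move: IHb dm; set M := m.+2%:R; set D := d ^+ m.+2; set D' := d ^+ m.+3; set BB := b ^+ m.+2; lra.
Qed.

Lemma cvg_of_fast_increments (u : R^nat) N :
  (forall n, (N <= n)%N -> `|u n.+1 - u n| <= 1 / (2 ^ n.+1)%:R) -> cvgn u.
Proof.
move=> H; pose v n := u (n + N)%N.
suff : cvgn v by move=> /cvg_ex[l vl]; apply/cvg_ex; exists l; rewrite -(cvg_shiftn N).
have -> : v = (fun n => v 0%N + series (telescope v) n).
  by apply/funext => n; rewrite -eq_sum_telescope.
apply: is_cvgD; first exact: is_cvg_cst.
apply: normed_cvg; apply: (@series_le_cvg _ _ (geometric 1 2^-1)) => //.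
- by move=> n /=; exact: normr_ge0.
- by move=> n /=; rewrite mul1r exprn_ge0// invr_ge0.
- move=> n; rewrite -[leLHS]/(`|u (n + N).+1 - u (n + N)%N|) [leRHS]/=.
  apply: le_trans (H _ (leq_addl _ _)) _.
  rewrite !mul1r natrX exprVn lef_pV2 ?posrE ?exprn_gt0//.
  by rewrite ler_weXn2l ?ler1n// -addnS leq_addr.
- by apply: is_cvg_geometric_series; rewrite ger0_norm ?invr_ge0// invf_lt1// ltr1n.
Qed.

End Lp_martingale.

(** * Convergence in L_p of a bounded nonnegative martingale *)

Section Lp_limit.
Context d (T : measurableType d) (R : realType) (P : probability T R).
Variables (A : nat -> T -> R) (m : nat) (C : R).
Local Notation p := m.+2.
Hypothesis mA : forall n, measurable_fun setT (A n).
Hypothesis A0 : forall n w, 0 <= A n w.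
Hypothesis A_bound : forall n, (\int[P]_w (A n w ^+ p)%:E <= C%:E)%E.
Hypothesis A_martingale : forall M N, (M <= N)%N ->
  (\int[P]_w (A N w * A M w ^+ m.+1)%:E = \int[P]_w (A M w ^+ p)%:E)%E.

Let e n := fine (\int[P]_w (A n w ^+ p)%:E)%E.

Let mX (f : T -> R) k : measurable_fun setT f -> measurable_fun setT (fun w => (f w ^+ k)%:E).
Proof. by move=> mf; apply/measurable_EFinP; exact: measurable_funX. Qed.

Let eE n : (\int[P]_w (A n w ^+ p)%:E = (e n)%:E)%E.
Proof.
rewrite /e fineK// ge0_fin_numE; first by rewrite (le_lt_trans (A_bound n)) ?ltry.
by apply: integral_ge0 => w _; rewrite lee_fin exprn_ge0.
Qed.

Let e_le n : e n <= C. Proof. by rewrite -lee_fin -eE. Qed.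

(** [power_gap] is integrated with a = A_M and b = A_N: by the martingale identity the cross term is
    p times e_M, which leaves e_N - e_M. *)
Let dist_le M N : (M <= N)%N ->
  (\int[P]_w (`|A N w - A M w| ^+ p)%:E <= (e N - e M)%:E)%E.
Proof.
move=> MN.
have mAA : measurable_fun setT (fun w => (A M w ^+ m.+1 * A N w)%:E).
  by apply/measurable_EFinP; apply: measurable_funM => //; exact: measurable_funX.
have mdist : measurable_fun setT (fun w => (`|A N w - A M w| ^+ p)%:E).
  by apply: mX; apply: measurableT_comp => //; exact: measurable_funB.
have : (\int[P]_w ((`|A N w - A M w| ^+ p)%:E + p%:R%:E * (A M w ^+ m.+1 * A N w)%:E) <=
        \int[P]_w ((A N w ^+ p)%:E + m.+1%:R%:E * (A M w ^+ p)%:E))%E.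
  apply: ge0_le_integral => //.
  - move=> w _; apply: adde_ge0; first by rewrite lee_fin exprn_ge0.
    by rewrite -EFinM lee_fin mulr_ge0// mulr_ge0// exprn_ge0.
  - by apply: emeasurable_funD => //; exact: measurable_funeM.
  - by apply: emeasurable_funD; [exact: mX|apply: measurable_funeM; exact: mX].
  - by move=> w _; rewrite -!EFinM -!EFinD lee_fin power_gap.
have AA0 w : (0 <= (A M w ^+ m.+1 * A N w)%:E)%E by rewrite lee_fin mulr_ge0 ?exprn_ge0.
have Ap0 n w : (0 <= (A n w ^+ p)%:E)%E by rewrite lee_fin exprn_ge0.
have d0 w : (0 <= (`|A N w - A M w| ^+ p)%:E)%E by rewrite lee_fin exprn_ge0.
have pAA0 w : (0 <= p%:R%:E * (A M w ^+ m.+1 * A N w)%:E)%E.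
  by apply: mule_ge0; [rewrite lee_fin|exact: AA0].
have mAp0 w : (0 <= m.+1%:R%:E * (A M w ^+ p)%:E)%E.
  by apply: mule_ge0; [rewrite lee_fin|exact: Ap0].
have mpAA := measurable_funeM p%:R%:E mAA.
have mAp n := mX p (mA n).
have mmA := measurable_funeM m.+1%:R%:E (mAp M).
rewrite (ge0_integralD P measurableT (fun w _ => d0 w) mdist (fun w _ => pAA0 w) mpAA).
rewrite (ge0_integralD P measurableT (fun w _ => Ap0 N w) (mAp N) (fun w _ => mAp0 w) mmA).
rewrite (ge0_integralZl P measurableT mAA (fun w _ => AA0 w)) ?lee_fin//.
rewrite (ge0_integralZl P measurableT (mAp M) (fun w _ => Ap0 M w)) ?lee_fin//.
under [X in (_ + _ * X <= _)%E -> _]eq_integral do rewrite mulrC.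
rewrite A_martingale// !eE -!EFinM -EFinD.
rewrite -leeBrDr// -EFinB => /le_trans; apply.
by rewrite lee_fin -[m.+2%:R]natr1; lra.
Qed.

Let e_mono : {homo e : M N / (M <= N)%N >-> M <= N}.
Proof.
move=> M N /dist_le; rewrite -subr_ge0 -lee_fin; apply: le_trans.
by apply: integral_ge0 => w _; rewrite lee_fin exprn_ge0.
Qed.

Let E := sup (range e).

Let e_cvg : e n @[n --> \oo] --> E.
Proof. by apply: nondecreasing_cvgn; [exact: e_mono|exists C => _ [n _ <-]]. Qed.

Let e_leE n : e n <= E.
Proof. by rewrite -(cvg_lim _ e_cvg)//; apply: nondecreasing_cvgn_le => //; apply/cvg_ex; exists E. Qed.

Let dist_leE M N : (M <= N)%N ->
  (\int[P]_w (`|A N w - A M w| ^+ p)%:E <= (E - e M)%:E)%E.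
Proof. by move=> /dist_le/le_trans; apply; rewrite lee_fin lerD2r. Qed.

Let eps (k : nat) : R := 1 / (2 ^ k.+1)%:R.

Let eps_gt0 k : 0 < eps k.
Proof. by rewrite divr_gt0// ltr0n expn_gt0. Qed.

(** The moments e_n increase to a finite limit, so that late increments have p-th moment at most
    eps^(p+1). Markov's inequality then gives probability at most eps to an increment of size eps,
    and Borel-Cantelli applies. *)
Lemma martingale_subsequence : exists nk : nat -> nat,
  (forall k, (k <= nk k)%N) /\ {ae P, forall w, cvgn (fun k => A (nk k) w)}.
Proof.
have H k : exists n, forall N, (n <= N)%N -> E - e N <= eps k ^+ p.+1.
  have /cvgrPdist_le/(_ _ (exprn_gt0 p.+1 (eps_gt0 k)))[n _ Hn] := e_cvg.
  by exists n => N nN; have := Hn N nN; rewrite ger0_norm// subr_ge0.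
have [f Hf] := choice H.
(* Partial sums are nondecreasing, at least k, and at least f k, all at once. *)
pose nk k := (\sum_(i < k.+1) (f i).+1)%N.
have nkS k : (nk k <= nk k.+1)%N by rewrite /nk [leqRHS]big_ord_recr /= leq_addr.
exists nk; split.
  elim=> [//|k IH]; rewrite /nk big_ord_recr /= -/(nk k) addnS ltnS.
  exact: leq_trans IH (leq_addr _ _).
have fnk k : (f k <= nk k)%N.
  by rewrite /nk big_ord_recr /= (leq_trans (leqnSn _))// leq_addl.
pose F k := [set w | eps k <= `|A (nk k.+1) w - A (nk k) w|].
have mdist k : measurable_fun setT (fun w => `|A (nk k.+1) w - A (nk k) w|).
  by apply: measurableT_comp => //; exact: measurable_funB.
have mF k : measurable (F k).
  by rewrite -[F k]setTI; apply: measurable_fun_ler.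
have PF k : (P (F k) <= (eps k)%:E)%E.
  have : ((eps k ^+ p)%:E * P (F k) <= (eps k ^+ p.+1)%:E)%E.
    apply: (@le_trans _ _ (\int[P]_w (`|A (nk k.+1) w - A (nk k) w| ^+ p)%:E)%E); last first.
      by apply: (le_trans (dist_leE (nkS k))); rewrite lee_fin Hf.
    rewrite -[F k]setIT -integral_indic// -ge0_integralZl//.
    - apply: ge0_le_integral => //.
      + by move=> w _; rewrite -EFinM lee_fin mulr_ge0// exprn_ge0// ltW.
      + by apply: measurable_funeM; apply/measurable_EFinP; exact: measurable_indic.
      + exact: mX.
      + move=> w _; rewrite -EFinM lee_fin indicE.
        case: (boolP (w \in F k)) => [/set_mem Fw|_].
          by rewrite mulr1 lerXn2r ?nnegrE ?(ltW (eps_gt0 k)).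
        by rewrite mulr0 exprn_ge0.
    - by apply/measurable_EFinP; exact: measurable_indic.
    - by rewrite lee_fin exprn_ge0// ltW.
  rewrite -(fineK (fin_num_measure P _ (mF k))).
  by rewrite -EFinM !lee_fin [_ ^+ p.+1]exprSr ler_pM2l// exprn_gt0.
apply: filterS (ae_eventually_notin mF PF) => w [N HN].
apply: (@cvg_of_fast_increments _ _ N) => k Nk.
by have /negP := HN k Nk; rewrite -ltNge => /ltW.
Qed.

Theorem martingale_Lp_limit : exists L : T -> R,
  [/\ measurable_fun setT L, forall w, 0 <= L w &
      (\int[P]_w (`|A n w - L w| ^+ p)%:E @[n --> \oo] --> 0)%E].
Proof.
have [nk [nkk cvgA]] := martingale_subsequence.
(* The upper limit is measurable in any case, and the absolute value makes L nonnegative also where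
   the subsequence diverges. *)
pose L (w : T) : R := `|fine (limn_esup (fun k => (A (nk k) w)%:E))|.
have mL : measurable_fun setT L.
  apply: measurableT_comp => //.
  apply: (measurableT_comp (@fine_measurable R setT measurableT)).
  by apply: measurable_fun_limn_esup => k; apply/measurable_EFinP.
have AL : {ae P, forall w, A (nk k) w @[k --> \oo] --> L w}.
  apply: filterS cvgA => w /cvg_ex[l Al].
  have Ale : (A (nk k) w)%:E @[k --> \oo] --> l%:E by apply: cvg_EFin => //; exact: nearW.
  have l0 : 0 <= l.
    by rewrite -(cvg_lim _ Al)//; apply: limr_ge; [apply/cvg_ex; exists l|exact: nearW].
  suff -> : L w = l by [].
  rewrite /L is_cvg_limn_esupE; last by apply/cvg_ex; exists l%:E.
  by rewrite (cvg_lim _ Ale)//= ger0_norm.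
(* Fatou's lemma along the subsequence controls the distance to L of every term of the whole
   sequence. *)
have bound n : (\int[P]_w (`|A n w - L w| ^+ p)%:E <= (E - e n)%:E)%E.
  pose f k w := (`|A (nk (k + n)%N) w - A n w| ^+ p)%:E.
  have mf k : measurable_fun setT (f k).
    by apply: mX; apply: measurableT_comp => //; exact: measurable_funB.
  have f0 k w : setT w -> (0 <= f k w)%E by move=> _; rewrite lee_fin exprn_ge0.
  have -> : (\int[P]_w (`|A n w - L w| ^+ p)%:E = \int[P]_w limn_einf (f^~ w))%E.
    apply: ae_eq_integral => //.
    - by apply: mX; apply: measurableT_comp => //; exact: measurable_funB.
    - have mNf k : measurable_fun setT (fun w => - f k w)%E by exact: measurableT_comp.
      apply: (eq_measurable_fun (fun w => - limn_esup (fun k => - f k w))%E).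
        move=> w _; rewrite -limn_einfN; congr limn_einf.
        by apply/funext => k /=; rewrite opprK.
      by apply: measurableT_comp => //; exact: measurable_fun_limn_esup.
    - apply: filterS AL => w Aw _.
      have fl : f k w @[k --> \oo] --> (`|A n w - L w| ^+ p)%:E.
        apply: cvg_EFin; first exact: nearW.
        rewrite distrC; apply: (@cvg_comp _ _ _ (fun k => `|A (nk (k + n)%N) w - A n w|)
          (fun x : R => x ^+ p) _ _ _ _ (@exprn_continuous R p `|L w - A n w|)).
        apply: cvg_norm; apply: cvgB; last exact: cvg_cst.
        have := Aw; rewrite -(cvg_shiftn n); exact.
      by rewrite is_cvg_limn_einfE ?(cvg_lim _ fl)//; apply/cvg_ex; exists (`|A n w - L w| ^+ p)%:E.
  apply: (le_trans (fatou P measurableT mf f0)).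
  rewrite limn_einf_lim; apply: lime_le; first exact: is_cvg_einfs.
  apply: nearW => k; rewrite /einfs /=; apply: (@le_trans _ _ (\int[P]_w f k w)%E).
    by apply: ereal_inf_lbound; exists k => /=.
  by apply: dist_leE; apply: leq_trans (nkk _); rewrite leq_addl.
exists L; split => //; first by move=> w; exact: normr_ge0.
have cE : (E - e n)%:E @[n --> \oo] --> 0%E.
  apply: cvg_EFin; first exact: nearW.
  by rewrite -[X in _ --> X](subrr E); apply: cvgB; [exact: cvg_cst|exact: e_cvg].
have z : (fun _ : nat => 0%E : \bar R) n @[n --> \oo] --> (0%E : \bar R) by exact: cvg_cst.
apply: (squeeze_cvge _ z cE); apply: nearW => n; rewrite bound andbT.
by apply: integral_ge0 => w _; rewrite lee_fin exprn_ge0.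
Qed.

End Lp_limit.

(** * Pointwise comparison of real and integer powers *)

Section power_comparison.
Context {R : realType}.

Lemma powR_split (x a c : R) : 0 < x -> x `^ (a + c) = x `^ a * x `^ c.
Proof. by move=> x0; rewrite powRD// (gt_eqF x0) implybT. Qed.

(** For A <= s the first term dominates; for A > s the second does, because A^(q-p) <= s^(q-p). *)
Lemma powR_le_pM (A s q : R) (p : nat) : 0 <= A -> 0 < s -> 0 <= q <= p%:R ->
  A `^ q <= s `^ q + s `^ (q - p%:R) * A ^+ p.
Proof.
move=> A0 s0 /andP[q0 qp]; have [As|sA] := leP A s.
  have h : A `^ q <= s `^ q by apply: ge0_ler_powR; rewrite ?nnegrE ?(ltW s0).
  by apply: (le_trans h); rewrite lerDl mulr_ge0 ?powR_ge0 ?exprn_ge0.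
have A1 : 0 < A by exact: lt_trans sA.
rewrite -[leLHS]add0r lerD ?powR_ge0// -powR_mulrn//.
rewrite -[in A `^ p%:R](subrK q p%:R) (@powR_split A)// mulrA -[leLHS]mul1r.
rewrite ler_wpM2r ?powR_ge0// -(opprB p%:R q) powRN ler_pdivlMl ?powR_gt0// mulr1.
by rewrite ge0_ler_powR ?nnegrE ?subr_ge0// ltW.
Qed.

(** The minimum covers both signs of q - 1: the worst point is the lower end of the window for q >=
    1 and the upper end for q < 1. *)
Lemma powR_window (e K A s q : R) : 0 < e -> 0 < K -> 0 < s -> e * s <= A <= K * s ->
  Num.min (e `^ (q - 1)) (K `^ (q - 1)) * s `^ (q - 1) <= A `^ (q - 1).
Proof.
move=> e0 K0 s0 /andP[eA AK].
have A0 : 0 < A by apply: lt_le_trans eA; exact: mulr_gt0.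
have [q1|q1] := leP 1 q.
  apply: (@le_trans _ _ (e `^ (q - 1) * s `^ (q - 1))).
    by rewrite ler_wpM2r ?powR_ge0// ge_min lexx.
  by rewrite -powRM ?(ltW e0) ?(ltW s0)// ge0_ler_powR ?nnegrE ?subr_ge0 ?mulr_ge0 ?(ltW e0) ?(ltW s0) ?(ltW A0).
apply: (@le_trans _ _ (K `^ (q - 1) * s `^ (q - 1))).
  by rewrite ler_wpM2r ?powR_ge0// ge_min lexx orbT.
rewrite -powRM ?(ltW K0) ?(ltW s0)// -(opprB 1 q) !powRN lef_pV2 ?posrE ?powR_gt0 ?mulr_gt0//.
by rewrite ge0_ler_powR ?nnegrE ?subr_ge0 ?mulr_ge0 ?(ltW K0) ?(ltW s0) ?(ltW A0) ?(ltW q1).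
Qed.

(* In the window [e * s <= A <= K * s] the powers [A^q] and [s^(q-1) * A] are comparable;
   outside of it one of the two other terms dominates. *)
Lemma powR_ge_pM (e K A s q : R) (m : nat) : 0 < e -> 1 <= K -> 0 <= A -> 0 < s -> 0 < q ->
  let eta : R := Num.min (e `^ (q - 1)) (K `^ (q - 1)) in
  eta * (s `^ (q - 1) * A) <=
  A `^ q + eta * e * s `^ q + eta * K^-1 * (s `^ (q - m.+2%:R) * A ^+ m.+2).
Proof.
move=> e0 K1 A0 s0 q0; set eta := Num.min _ _ => /=; have K0 : 0 < K by exact: lt_le_trans K1.
have eta0 : 0 <= eta by rewrite le_min !powR_ge0.
have t1 : 0 <= A `^ q by exact: powR_ge0.
have t2 : 0 <= eta * e * s `^ q by rewrite !mulr_ge0 ?powR_ge0// ltW.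
have t3 : 0 <= eta * K^-1 * (s `^ (q - m.+2%:R) * A ^+ m.+2).
  apply: mulr_ge0; first by rewrite mulr_ge0// invr_ge0 ltW.
  by rewrite mulr_ge0 ?powR_ge0 ?exprn_ge0.
have [Ae|eA] := ltP A (e * s).
  apply: (@le_trans _ _ (eta * e * s `^ q)); last by lra.
  have -> : s `^ q = s `^ (q - 1) * s by rewrite -{3}(powRr1 (ltW s0)) -powR_split// subrK.
  rewrite -!mulrA ler_wpM2l// mulrCA ler_wpM2l ?powR_ge0//; exact: ltW.
have A1 : 0 < A by apply: lt_le_trans eA; exact: mulr_gt0.
have [AK|KA] := leP A (K * s).
  apply: (@le_trans _ _ (A `^ q)); last by lra.
  have -> : A `^ q = A `^ (q - 1) * A by rewrite -{3}(powRr1 A0) -powR_split// subrK.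
  by rewrite mulrA ler_wpM2r// powR_window// eA.
apply: (@le_trans _ _ (eta * K^-1 * (s `^ (q - m.+2%:R) * A ^+ m.+2))); last by lra.
rewrite -mulrA ler_wpM2l//.
have -> : s `^ (q - 1) = s `^ (q - m.+2%:R) * s ^+ m.+1.
  rewrite -powR_mulrn ?(ltW s0)// -powR_split//; congr (_ `^ _).
  by rewrite -(natr1 m.+1); ring.
rewrite mulrCA -mulrA ler_wpM2l ?powR_ge0// [A ^+ m.+2]exprSr mulrA ler_wpM2r//.
rewrite ler_pdivlMl//; apply: (@le_trans _ _ ((K * s) ^+ m.+1)).
  rewrite exprMn ler_wpM2r ?exprn_ge0 ?(ltW s0)//.
  by rewrite -[leLHS]expr1 ler_weXn2l.
by rewrite lerXn2r ?nnegrE ?mulr_ge0 ?(ltW K0) ?(ltW s0) ?(ltW KA).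
Qed.

End power_comparison.

(** * The total mass: finiteness, martingale identity and boundedness *)

Section total_mass.
Context d (T : measurableType d) (R : realType) (P : probability T R).
Variables (kappa delta lam gamma : R) (X : R -> T -> R) (Lj : nat -> R -> T -> R).
Hypothesis kappa01 : 0 < kappa < 1.
Hypothesis delta_gt0 : 0 < delta.
Hypothesis lam_gt0 : 0 < lam.
Hypothesis gamma_ge0 : 0 <= gamma.
Hypothesis X_OU : stationary_OU P lam (tempered_stable kappa delta gamma) X.
Hypothesis Lj_copies : independent_copies P
  (geometric_process (c_X kappa delta gamma) X) Lj.
Variables (p : nat) (b : R).

Local Notation g := (gamma `^ kappa^-1).
Local Notation cum := (cumulant kappa delta gamma).
Local Notation om := (decay_rate kappa delta gamma p).
Local Notation logE := (log_anchored kappa delta lam gamma).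

Hypothesis p_ge2 : (2 <= p)%N.
Hypothesis p_le : 2 * p%:R <= g.
Hypothesis om_lt : expR om < b.

Local Notation Y := (cascade Lj b).
Let mY N := measurable_cascade Lj_copies b N.
Let Y0 N := cascade_ge0 Lj b N.
Let mYs N s : measurable_fun setT (Y N s).
Proof. exact: (measurable_section (mY N)). Qed.

Definition total_mass N t w : R := fine (mass (Y N) t w).

Lemma total_mass_ge0 N t w : 0 <= total_mass N t w.
Proof. exact/fine_ge0/mass_ge0. Qed.

Lemma measurable_total_mass N t : measurable_fun setT (total_mass N t).
Proof. by apply: measurableT_comp => //; exact: (measurable_mass t (mY N) (Y0 N)). Qed.

Lemma anchor0 a w : anchor Lj 0 a w = 1.
Proof. by rewrite /anchor big_ord0 expR0. Qed.

Lemma log_anchored0_seq1 u : logE 0 [:: u] = 0.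
Proof. by rewrite log_anchored0 /= /lag big_nil (increment0 _ kappa01)// addr0. Qed.

(* Stands in for the martingale property: no conditional expectation is needed, since only
   joint moments with powers of an earlier total mass are used. *)
Lemma cascade_mean_step M N s ss : (M <= N)%N -> 0 <= s ->
  {in ss, forall u : R, 0 <= u} -> (size ss < p)%N ->
  (\int[P]_w ((\prod_(u <- ss) Y M u w) * Y N s w)%:E =
   \int[P]_w ((\prod_(u <- ss) Y M u w) * Y M s w)%:E)%E.
Proof.
move=> MN s0 ss0 szp.
have l0 : {in [:: s] ++ ss, forall u : R, 0 <= u}.
  by move=> u; rewrite inE => /predU1P[->//|/ss0].
have ap : 0 + (size ([:: s] ++ ss))%:R <= p%:R :> R by rewrite add0r ler_nat.
have H K := @cascade_moment _ _ _ _ _ _ _ _ _ _ kappa01 delta_gt0 lam_gt0 gamma_ge0 X_OU Lj_copies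
  _ _ p_ge2 p_le om_lt K 0%N M 0 [:: s] ss (leq0n _).
have E K w : \prod_(u <- ss) Y M u w * Y K s w =
    anchor Lj 0 0 w * \prod_(u <- [:: s]) Y K u w * \prod_(u <- ss) Y M u w.
  by rewrite anchor0 mul1r big_seq1 mulrC.
under eq_integral do rewrite E; under [RHS]eq_integral do rewrite E.
rewrite !H//; congr (expR _)%:E.
rewrite -(subnKC MN) big_split_ord /= [X in _ + X]big1 ?addr0//.
by move=> j _; rewrite ltnNge leq_addr /= log_anchored0_seq1.
Qed.

Lemma mass_mean N t : 0 <= t -> mass_moment P (Y N) t 1 (cst 1) = t%:E.
Proof.
move=> t0.
rewrite (mass_momentS P t (mY N) (Y0 N) 0 (measurable_cst _) (fun=> ler01)).
transitivity (\int[lebesgue_measure]_(s in `[0%R, t]) (cst 1 s : \bar R))%E.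
  apply: eq_integral => s /set_mem /=; rewrite in_itv/= => /andP[s0 st]; rewrite mass_moment0.
  have := @cascade_mean_step 0%N N s [::] (leq0n _) s0.
  under eq_integral do rewrite big_nil.
  move=> ->//; last by rewrite (leq_trans _ p_ge2).
  under eq_integral do rewrite big_nil mul1r /cascade big_ord0 expR0.
  by rewrite integral_cst// mul1e; exact: probability_setT.
rewrite integral_cst//= lebesgue_measure_itv/= lte_fin mul1e.
case: ltP => [_|t0']; first by rewrite sube0.
by rewrite (le_anti (introT andP (conj t0' t0))).
Qed.

Lemma mass_total_mass N t : 0 <= t ->
  {ae P, forall w, mass (Y N) t w = (total_mass N t w)%:E}.
Proof.
move=> t0.
have mm := measurable_mass t (mY N) (Y0 N).
have : P.-integrable setT (mass (Y N) t).
  apply/integrableP; split => //.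
  rewrite (_ : integral _ _ _ = t%:E) ?ltry// -(mass_mean N t0).
  by apply: eq_integral => w _; rewrite mul1e gee0_abs ?mass_ge0.
move=> /(integrable_ae measurableT); apply: filterS => w /(_ Logic.I) fw.
by rewrite /total_mass fineK.
Qed.

Lemma total_mass_moment N t k (W : T -> R) : 0 <= t ->
  measurable_fun setT W -> (forall w, 0 <= W w) ->
  (\int[P]_w (W w * total_mass N t w ^+ k)%:E = mass_moment P (Y N) t k W)%E.
Proof.
move=> t0 mW W0; apply: ge0_ae_eq_integral => //.
- apply/measurable_EFinP; apply: measurable_funM => //.
  by apply: measurable_funX; exact: measurable_total_mass.
- apply: emeasurable_funM; first exact/measurable_EFinP.
  elim: k => [|k IH]; first by under eq_fun do rewrite expe0; exact: measurable_cst.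
  by under eq_fun do rewrite expeS; apply: emeasurable_funM => //; exact: measurable_mass.
- by move=> w _; rewrite lee_fin mulr_ge0// exprn_ge0// total_mass_ge0.
- by move=> w _; rewrite mule_ge0 ?lee_fin// expe_ge0// mass_ge0.
- have := mass_total_mass N t0; apply: filterS => w E _.
  by rewrite E EFinM EFin_expe.
Qed.

(** [mass_moment_eq] compares the weights at depths N and M through their joint moments with k < p
    values of the M-cascade. There the factors beyond M occur at a single time and have mean 1. *)
Lemma total_mass_martingale M N k t : (M <= N)%N -> (k < p)%N -> 0 <= t ->
  (\int[P]_w (total_mass N t w * total_mass M t w ^+ k)%:E =
   \int[P]_w (total_mass M t w ^+ k.+1)%:E)%E.
Proof.
move=> MN kp t0.
under [RHS]eq_integral do rewrite exprS.
have mA K := measurable_total_mass K t.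
have A0 K w := total_mass_ge0 K t w.
rewrite (total_mass_moment M k t0 (mA N) (A0 N)) (total_mass_moment M k t0 (mA M) (A0 M)).
apply: (mass_moment_eq (mY M) (Y0 M) (mA N) (A0 N) (mA M) (A0 M)) => ss szs sst.
have ss0 : {in ss, forall u : R, 0 <= u} by move=> u /sst /andP[].
have mss : measurable_fun setT (fun w => \prod_(u <- ss) Y M u w).
  by apply: measurable_prod => u _; exact: mYs.
have pss w : 0 <= \prod_(u <- ss) Y M u w by apply: prodr_ge0 => u _; exact: Y0.
under eq_integral do rewrite mulrC -[total_mass _ _ _]expr1.
under [RHS]eq_integral do rewrite mulrC -[total_mass _ _ _]expr1.
rewrite (total_mass_moment N 1 t0 mss pss) (total_mass_moment M 1 t0 mss pss).
rewrite (mass_momentS P t (mY N) (Y0 N) 0 mss pss) (mass_momentS P t (mY M) (Y0 M) 0 mss pss).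
apply: eq_integral => s /set_mem /=; rewrite in_itv/= => /andP[s0 st].
by rewrite !mass_moment0 cascade_mean_step// szs.
Qed.

(** The case n = 0, q = p of [mass_anchor_upper], in which nothing is frozen. *)
Lemma total_mass_bounded : exists2 C : R, 0 < C &
  forall N t, 0 <= t <= 1 -> (\int[P]_w (total_mass N t w ^+ p)%:E <= C%:E)%E.
Proof.
have [C C0 H] := mass_anchor_upper kappa01 delta_gt0 lam_gt0 gamma_ge0 X_OU Lj_copies p_ge2 p_le om_lt.
exists C => // N t /andP[t0 t1].
have := H 0%N N p%:R t (leq0n _) (lexx _); rewrite expr0 invr1 t0 t1 => /(_ isT).
rewrite mul0r expR0 expr1n !mulr1; apply: le_trans.
rewrite -(total_mass_moment N p t0 (measurable_anchor Lj_copies 0 _) (anchor_ge0 Lj 0 _)).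
by under [leRHS]eq_integral do rewrite anchor0 mul1r.
Qed.

End total_mass.

(** * Scaling of the moments at finite depth *)

Section scaling.
Context d (T : measurableType d) (R : realType) (P : probability T R).
Variables (kappa delta lam gamma : R) (X : R -> T -> R) (Lj : nat -> R -> T -> R).
Hypothesis kappa01 : 0 < kappa < 1.
Hypothesis delta_gt0 : 0 < delta.
Hypothesis lam_gt0 : 0 < lam.
Hypothesis gamma_ge0 : 0 <= gamma.
Hypothesis X_OU : stationary_OU P lam (tempered_stable kappa delta gamma) X.
Hypothesis Lj_copies : independent_copies P
  (geometric_process (c_X kappa delta gamma) X) Lj.
Variables (p : nat) (b : R).

Local Notation g := (gamma `^ kappa^-1).
Local Notation cum := (cumulant kappa delta gamma).
Local Notation lm := (log_moment kappa delta gamma).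
Local Notation om := (decay_rate kappa delta gamma p).

Hypothesis p_ge2 : (2 <= p)%N.
Hypothesis p_le : 2 * p%:R <= g.
Hypothesis om_lt : expR om < b.

Local Notation A := (total_mass Lj b).
Local Notation zeta q := (q - lm q / ln b).
Let mA N t := measurable_total_mass Lj_copies b N t.
Let b1 : 1 < b. Proof. exact: (b_gt1 kappa01 delta_gt0 gamma_ge0 p_ge2 p_le om_lt). Qed.
Let b0 : 0 < b. Proof. exact: lt_trans b1. Qed.

Lemma powR_anchor n t (a : R) w : 0 <= t ->
  (t * anchor Lj n 1 w) `^ a = t `^ a * anchor Lj n a w.
Proof.
move=> t0; rewrite powRM ?anchor_ge0//; congr (_ * _).
rewrite /powR gt_eqF ?expR_gt0// expRK mulr_sumr; congr expR.
by apply: eq_bigr => j _; rewrite mul1r.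
Qed.

(** n is the integer part of [- ln t / ln b]; the rounding error, below 1, is multiplied by
    [lm q]. *)
Lemma exists_scale (t : R) : 0 < t <= 1 -> exists n : nat,
  t <= b ^- n <= b * t /\ forall q, `|n%:R * lm q - (zeta q - q) * ln t| <= `|lm q|.
Proof.
move=> /andP[t0 t1]; have lb : 0 < ln b by exact: ln_gt0.
pose x := - ln t / ln b.
have x0 : 0 <= x by rewrite divr_ge0 ?(ltW lb)// oppr_ge0 ln_le0.
have /andP[nx xn] := truncn_itv x0; exists (Num.truncn x); split.
  have E (y : R) (n : nat) : 0 < y -> (y <= b ^- n) = (ln y <= - (n%:R * ln b)).
    move=> y0; rewrite -[in RHS]mulrN mulr_natl -lnV ?posrE// -lnXn ?invr_gt0// exprVn.
    by rewrite ler_ln// posrE invr_gt0 exprn_gt0.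
  have E' (y : R) (n : nat) : 0 < y -> (b ^- n <= y) = (- (n%:R * ln b) <= ln y).
    move=> y0; rewrite -[in RHS]mulrN mulr_natl -lnV ?posrE// -lnXn ?invr_gt0// exprVn.
    by rewrite ler_ln// posrE invr_gt0 exprn_gt0.
  rewrite E// E' ?mulr_gt0// lnM ?posrE//.
  rewrite ler_pdivlMr// in nx; rewrite ltr_pdivrMr// -natr1 mulrDl mul1r in xn.
  by apply/andP; split; lra.
move=> q.
have -> : (zeta q - q) * ln t = x * lm q by rewrite /x; field; rewrite gt_eqF.
rewrite -mulrBl normrM ler_piMl// distrC ger0_norm; last by rewrite subr_ge0.
by rewrite -natr1 in xn; lra.
Qed.

(** The depth N has to reach the last frozen scale, hence a threshold that depends on t, whereas the
    constants do not. *)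
Lemma total_mass_scaling q : 0 < q <= p%:R -> exists Clow Cup : R, [/\ 0 < Clow, 0 < Cup &
  forall t, 0 < t <= 1 -> exists N0, forall N, (N0 <= N)%N ->
    ((Clow * t `^ (zeta q))%:E <= \int[P]_w (A N t w `^ q)%:E <= (Cup * t `^ (zeta q))%:E)%E].
Proof.
move=> /andP[q0 qp].
have [C C0 HC] := mass_anchor_upper kappa01 delta_gt0 lam_gt0 gamma_ge0 X_OU Lj_copies p_ge2 p_le om_lt.
have HL := mass_anchor_lower kappa01 delta_gt0 lam_gt0 gamma_ge0 X_OU Lj_copies p_ge2 p_le om_lt.
have HG := anchor_expectation kappa01 delta_gt0 lam_gt0 gamma_ge0 X_OU Lj_copies p_ge2 p_le om_lt.
have HM N := total_mass_moment kappa01 delta_gt0 lam_gt0 gamma_ge0 X_OU Lj_copies p_ge2 p_le om_lt N.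
pose S := holder_bound kappa delta lam p b.
(* The factor b^p pays for replacing b^-n by b t in the p-th moment. *)
pose D := C * b ^+ p; have D0 : 0 < D by rewrite mulr_gt0// exprn_gt0.
(* Up to the factor eta, the mixed first moment is at least 4 e v. The part with A < e s costs at
   most e v, and the part with A > K s at most D v / K <= e v by the choice of K, so that 2 e v
   remains. *)
pose e := expR (- S) / 4; have e0 : 0 < e by rewrite divr_gt0// expR_gt0.
pose K := 1 + D / e; have K1 : 1 <= K by rewrite lerDl divr_ge0 ?(ltW D0) ?(ltW e0).
pose eta := Num.min (e `^ (q - 1)) (K `^ (q - 1)).
have K0 : 0 < K by exact: lt_le_trans K1.
have eta0 : 0 < eta by rewrite lt_min !powR_gt0.
have DK : D / K <= e.
  rewrite ler_pdivrMr// /K mulrDr mulr1 mulrCA divff ?gt_eqF// mulr1.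
  by rewrite lerDr ltW.
exists (eta * (2 * e) * expR (- `|lm q|)), ((1 + D) * expR `|lm q|); split.
- by rewrite !mulr_gt0// expR_gt0.
- by rewrite mulr_gt0 ?expR_gt0// ltr_wpDl.
move=> t /andP[t0 t1].
have [n [/andP[tn bn] nq]] : exists n : nat, t <= b ^- n <= b * t /\
  forall q, `|n%:R * lm q - (zeta q - q) * ln t| <= `|lm q| by apply: exists_scale; rewrite t0.
exists n => N nN.
have t01 : 0 <= t <= b ^- n by rewrite (ltW t0).
pose v := t `^ q * expR (n%:R * lm q).
have v0 : 0 < v by rewrite mulr_gt0 ?powR_gt0 ?expR_gt0.
have vE : t `^ zeta q = t `^ q * expR ((zeta q - q) * ln t).
  by rewrite -[in LHS](subrK q (zeta q)) addrC powR_split// [X in _ * X]/powR gt_eqF.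
have := nq q; rewrite ler_norml => /andP[nq1 nq2].
have v_lo : expR (- `|lm q|) * t `^ zeta q <= v.
  by rewrite vE mulrCA -expRD ler_wpM2l ?powR_ge0// ler_expR; lra.
have v_up : v <= expR `|lm q| * t `^ zeta q.
  by rewrite vE mulrCA -expRD ler_wpM2l ?powR_ge0// ler_expR; lra.
have A0 w : 0 <= A N t w by exact: total_mass_ge0.
have mG a : measurable_fun setT (anchor Lj n a) by exact: (measurable_anchor Lj_copies).
have G0 a w : 0 <= anchor Lj n a w by exact: anchor_ge0.
have s0 w : 0 < t * anchor Lj n 1 w by rewrite mulr_gt0// expR_gt0.
have mAq : measurable_fun setT (fun w => A N t w `^ q).
  by apply: (measurableT_comp (measurable_powR q)); exact: mA.
have mGA a k : measurable_fun setT (fun w => anchor Lj n a w * A N t w ^+ k).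
  by apply: measurable_funM => //; apply: measurable_funX; exact: mA.
have Eanchor : (\int[P]_w (t `^ q * anchor Lj n q w)%:E = v%:E)%E.
  under eq_integral do rewrite EFinM.
  rewrite ge0_integralZl_EFin ?powR_ge0//; last 2 first.
  - by move=> w _; rewrite lee_fin.
  - exact/measurable_EFinP.
  by rewrite HG.
have Etop : (\int[P]_w (t `^ (q - p%:R) * (anchor Lj n (q - p%:R) w * A N t w ^+ p))%:E
    <= (D * v)%:E)%E.
  under eq_integral do rewrite EFinM.
  rewrite ge0_integralZl_EFin ?powR_ge0//; last 2 first.
  - by move=> w _; rewrite lee_fin mulr_ge0// exprn_ge0.
  - exact/measurable_EFinP.
  rewrite HM ?(ltW t0)//.
  apply: (@le_trans _ _ ((t `^ (q - p%:R))%:E * (C * expR (n%:R * lm q) * b ^- n ^+ p)%:E)%E).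
    by rewrite lee_wpmul2l ?lee_fin ?powR_ge0// HC.
  rewrite -EFinM lee_fin.
  apply: (@le_trans _ _ (t `^ (q - p%:R) * (C * expR (n%:R * lm q) * (b * t) ^+ p))).
    rewrite ler_wpM2l ?powR_ge0// ler_wpM2l//.
      by rewrite mulr_ge0 ?expR_ge0// ltW.
    by rewrite lerXn2r ?nnegrE ?mulr_ge0 ?(ltW b0) ?(ltW t0)// invr_ge0 exprn_ge0// ltW.
  rewrite /v /D exprMn.
  have -> : t `^ q = t `^ (q - p%:R) * t ^+ p.
    by rewrite -powR_mulrn ?(ltW t0)// -powR_split// subrK.
  by rewrite le_eqVlt; apply/orP; left; apply/eqP; ring.
have up : (\int[P]_w (A N t w `^ q)%:E <= ((1 + D) * v)%:E)%E.
  apply: (@le_trans _ _ (\int[P]_w ((t `^ q * anchor Lj n q w)%:E +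
     (t `^ (q - p%:R) * (anchor Lj n (q - p%:R) w * A N t w ^+ p))%:E))%E).
    apply: ge0_le_integral => //.
    - by move=> w _; rewrite lee_fin powR_ge0.
    - exact/measurable_EFinP.
    - by apply: emeasurable_funD; apply/measurable_EFinP; exact: measurable_funM.
    move=> w _; rewrite -EFinD lee_fin mulrA -!powR_anchor ?(ltW t0)//.
    by apply: powR_le_pM => //; rewrite (ltW q0).
  rewrite ge0_integralD//; last 4 first.
  - by move=> w _; rewrite lee_fin mulr_ge0 ?powR_ge0.
  - by apply/measurable_EFinP; exact: measurable_funM.
  - by move=> w _; rewrite lee_fin !mulr_ge0 ?powR_ge0// exprn_ge0.
  - by apply/measurable_EFinP; exact: measurable_funM.
  by rewrite Eanchor mulrDl mul1r EFinD leeD2l.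
have fin : (\int[P]_w (A N t w `^ q)%:E)%E \is a fin_num.
  rewrite ge0_fin_numE ?(le_lt_trans up) ?ltry//.
  by apply: integral_ge0 => w _; rewrite lee_fin powR_ge0.
apply/andP; split; last first.
  apply: le_trans up _; rewrite lee_fin -mulrA ler_wpM2l//.
  by rewrite addr_ge0// ltW.
have low : ((eta * (4 * e * v))%:E <= \int[P]_w (A N t w `^ q)%:E +
    (eta * e * v)%:E + (eta * K^-1 * (D * v))%:E)%E.
  apply: (@le_trans _ _ (\int[P]_w (eta * (t `^ (q - 1) * (anchor Lj n (q - 1) w * A N t w ^+ 1)))%:E)%E).
    under eq_integral do rewrite (mulrA eta) EFinM.
    rewrite ge0_integralZl_EFin ?mulr_ge0 ?powR_ge0 ?(ltW eta0)//; last 2 first.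
    - by move=> w _; rewrite lee_fin mulr_ge0 ?exprn_ge0.
    - exact/measurable_EFinP.
    rewrite HM ?(ltW t0)//.
    apply: (@le_trans _ _ ((eta * t `^ (q - 1))%:E * (t * expR (n%:R * lm q - S))%:E)%E).
      rewrite -EFinM lee_fin -(mulrA eta) ler_wpM2l ?(ltW eta0)// /v /e.
      have -> : t `^ q = t `^ (q - 1) * t.
        by rewrite -[X in _ * X](powRr1 (ltW t0)) -powR_split// subrK.
      by rewrite expRD le_eqVlt; apply/orP; left; apply/eqP; field.
    by rewrite lee_wpmul2l ?lee_fin ?mulr_ge0 ?powR_ge0 ?(ltW eta0)// HL.
  apply: (@le_trans _ _ (\int[P]_w ((A N t w `^ q)%:E + (eta * e)%:E * (t `^ q * anchor Lj n q w)%:E +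
     (eta * K^-1)%:E * (t `^ (q - p%:R) * (anchor Lj n (q - p%:R) w * A N t w ^+ p))%:E))%E).
    apply: ge0_le_integral => //.
    - by move=> w _; rewrite lee_fin !mulr_ge0 ?powR_ge0 ?(ltW eta0)// exprn_ge0.
    - by apply/measurable_EFinP; apply: measurable_funM => //; exact: measurable_funM.
    - apply: emeasurable_funD; [apply: emeasurable_funD|].
      + exact/measurable_EFinP.
      + by apply/measurable_EFinP; apply: measurable_funM => //; exact: measurable_funM.
      + by apply/measurable_EFinP; apply: measurable_funM => //; exact: measurable_funM.
    move=> w _; rewrite -!EFinM -!EFinD lee_fin !(mulrA (t `^ _)) -!powR_anchor ?(ltW t0)// expr1.
    case: p p_ge2 => [//|[//|m]] _.
    exact: powR_ge_pM.
  have m1 : measurable_fun setT (fun w => (A N t w `^ q)%:E) by exact/measurable_EFinP.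
  have m2 : measurable_fun setT (fun w => (t `^ q * anchor Lj n q w)%:E).
    by apply/measurable_EFinP; exact: measurable_funM.
  have m3 : measurable_fun setT
      (fun w => (t `^ (q - p%:R) * (anchor Lj n (q - p%:R) w * A N t w ^+ p))%:E).
    by apply/measurable_EFinP; exact: measurable_funM.
  have p1 w : (0 <= (A N t w `^ q)%:E)%E by rewrite lee_fin powR_ge0.
  have p2 w : (0 <= (t `^ q * anchor Lj n q w)%:E)%E by rewrite lee_fin mulr_ge0 ?powR_ge0.
  have p3 w : (0 <= (t `^ (q - p%:R) * (anchor Lj n (q - p%:R) w * A N t w ^+ p))%:E)%E.
    by rewrite lee_fin !mulr_ge0 ?powR_ge0// exprn_ge0.
  have c1 : 0 <= eta * e by rewrite mulr_ge0 ?ltW.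
  have c2 : 0 <= eta * K^-1 by rewrite mulr_ge0 ?invr_ge0 ?ltW.
  rewrite ge0_integralD//; last 4 first.
  - by move=> w _; apply: adde_ge0 => //; apply: mule_ge0; rewrite // lee_fin.
  - by apply: emeasurable_funD => //; exact: emeasurable_funM.
  - by move=> w _; apply: mule_ge0; rewrite // lee_fin.
  - exact: emeasurable_funM.
  rewrite ge0_integralD//; last 2 first.
  - by move=> w _; apply: mule_ge0; rewrite // lee_fin.
  - exact: emeasurable_funM.
  rewrite !ge0_integralZl_EFin// Eanchor -!EFinM leeD2l//.
  by rewrite [leRHS]EFinM lee_wpmul2l ?lee_fin.
rewrite -(fineK fin) in low *; rewrite -!EFinD lee_fin in low; rewrite lee_fin.
have h1 : eta * K^-1 * (D * v) <= eta * e * v.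
  rewrite mulrA ler_wpM2r ?(ltW v0)// -mulrA ler_wpM2l ?(ltW eta0)//.
  by rewrite mulrC.
have h2 : eta * (2 * e) * (expR (- `|lm q|) * t `^ zeta q) <= eta * (2 * e) * v.
  by rewrite ler_wpM2l// !mulr_ge0 ?(ltW eta0) ?(ltW e0).
rewrite -(mulrA (eta * (2 * e))); apply: le_trans h2 _.
have -> : eta * (2 * e) * v = eta * (4 * e * v) - eta * e * v - eta * e * v by ring.
by lra.
Qed.

End scaling.

(** * Passage of moments to the limit *)

Section moment_limits.
Context d (T : measurableType d) (R : realType) (P : probability T R).
Local Open Scope ereal_scope.

Lemma cvg0_near (u : nat -> \bar R) (e : R) : u n @[n --> \oo] --> 0 -> (0 < e)%R ->
  \forall n \near \oo, u n <= e%:E.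
Proof.
move=> /fine_cvgP[fu cu] e0.
move/cvgr0Pnorm_le : cu => /(_ _ e0) cu.
near=> n; have fn : u n \is a fin_num by near: n.
rewrite -(fineK fn) lee_fin; apply: le_trans (ler_norm _) _; near: n; exact: cu.
Unshelve. all: by end_near. Qed.

Lemma cvg0_of_near (u : nat -> \bar R) : (forall n, 0 <= u n) ->
  (forall e : R, (0 < e)%R -> \forall n \near \oo, u n <= e%:E) -> u n @[n --> \oo] --> 0.
Proof.
move=> u0 H; have fin : \forall n \near \oo, u n \is a fin_num.
  have := H 1%R ltr01; apply: filterS => n un; rewrite ge0_fin_numE//.
  by apply: le_lt_trans un _; exact: ltry.
apply/fine_cvgP; split => //; apply/cvgr0Pnorm_le => e e0.
near=> n; have fn : u n \is a fin_num by near: n.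
rewrite ger0_norm ?fine_ge0// -lee_fin fineK//; near: n; exact: H.
Unshelve. all: by end_near. Qed.

Lemma powRD_le (x y q : R) : (0 <= x)%R -> (0 <= y)%R -> (0 <= q)%R ->
  ((x + y) `^ q <= 2 `^ q * (x `^ q + y `^ q))%R.
Proof.
move=> x0 y0 q0; apply: (@le_trans _ _ ((2 * Num.max x y) `^ q)%R).
  apply: ge0_ler_powR; rewrite ?nnegrE ?addr_ge0 ?mulr_ge0 ?le_max ?x0//.
  by rewrite mulr_natl mulr2n lerD// le_max lexx ?orbT.
rewrite powRM ?le_max ?x0//; apply: ler_wpM2l; first exact: powR_ge0.
by case: (leP x y) => _; rewrite ?lerDl ?lerDr powR_ge0.
Qed.

Lemma measurable_powRC q (f : T -> R) : measurable_fun setT f ->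
  measurable_fun setT (fun w => (f w `^ q)%:E).
Proof.
move=> mf; apply/measurable_EFinP.
exact: (measurableT_comp (measurable_powR q)).
Qed.

Lemma moment_transfer (q : R) (f g : T -> R) : (0 <= q)%R ->
  measurable_fun setT f -> measurable_fun setT g -> (forall w, 0 <= f w)%R -> (forall w, 0 <= g w)%R ->
  \int[P]_w (f w `^ q)%:E <=
  (2 `^ q)%:E * (\int[P]_w (g w `^ q)%:E + \int[P]_w (`|f w - g w| `^ q)%:E).
Proof.
move=> q0 mf mg f0 g0.
have mfg : measurable_fun setT (fun w => `|f w - g w|%R).
  by apply: measurableT_comp => //; exact: measurable_funB.
have m1 := measurable_powRC q mf; have m2 := measurable_powRC q mg.
have m3 := measurable_powRC q mfg.
have pos (h : T -> R) w : 0 <= (h w `^ q)%:E by rewrite lee_fin powR_ge0.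
rewrite -ge0_integralD//.
rewrite -ge0_integralZl_EFin ?powR_ge0//; last 2 first.
- by move=> w _; apply: adde_ge0; [exact: (pos g)|exact: (pos (fun w => `|f w - g w|%R))].
- exact: emeasurable_funD.
apply: ge0_le_integral => //.
- by apply: emeasurable_funM => //; exact: emeasurable_funD.
move=> w _; rewrite -EFinD -EFinM lee_fin; apply: le_trans (powRD_le (g0 w) (normr_ge0 _) q0).
apply: ge0_ler_powR; rewrite ?nnegrE ?addr_ge0//.
by have := ler_norm (f w - g w); lra.
Qed.

Lemma mean_transfer (f g : T -> R) :
  measurable_fun setT f -> measurable_fun setT g -> (forall w, 0 <= f w)%R -> (forall w, 0 <= g w)%R ->
  \int[P]_w (f w)%:E <= \int[P]_w (g w)%:E + \int[P]_w (`|f w - g w|)%:E.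
Proof.
move=> mf mg f0 g0.
have mfg : measurable_fun setT (fun w => `|f w - g w|%R).
  by apply: measurableT_comp => //; exact: measurable_funB.
have m1 : measurable_fun setT (fun w => (f w)%:E) by exact/measurable_EFinP.
have m2 : measurable_fun setT (fun w => (g w)%:E) by exact/measurable_EFinP.
have m3 : measurable_fun setT (fun w => (`|f w - g w|)%:E) by exact/measurable_EFinP.
have p1 w : setT w -> 0 <= (f w)%:E by rewrite lee_fin.
have p2 w : setT w -> 0 <= (g w)%:E by rewrite lee_fin.
rewrite -ge0_integralD//; apply: ge0_le_integral => //.
  exact: emeasurable_funD.
by move=> w _; rewrite -EFinD lee_fin; have := ler_norm (f w - g w); lra.
Qed.

(** Young's inequality with a free weight e: unlike [moment_transfer] it loses no fixed constant, as
    the variance bound requires. *)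
Lemma square_transfer (e : R) (f g : T -> R) : (0 < e)%R ->
  measurable_fun setT f -> measurable_fun setT g ->
  \int[P]_w (f w ^+ 2)%:E <=
  (1 + e)%:E * \int[P]_w (g w ^+ 2)%:E + (1 + e^-1)%:E * \int[P]_w (`|f w - g w| ^+ 2)%:E.
Proof.
move=> e0 mf mg.
have mfg : measurable_fun setT (fun w => (`|f w - g w| ^+ 2)%:E).
  apply/measurable_EFinP; apply: measurable_funX.
  by apply: measurableT_comp => //; exact: measurable_funB.
have mg2 : measurable_fun setT (fun w => (g w ^+ 2)%:E).
  by apply/measurable_EFinP; exact: measurable_funX.
have e1 : (0 <= 1 + e)%R by rewrite addr_ge0// ltW.
have e2 : (0 <= 1 + e^-1)%R by rewrite addr_ge0// invr_ge0 ltW.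
have p1 w : 0 <= (g w ^+ 2)%:E by rewrite lee_fin sqr_ge0.
have p2 w : 0 <= (`|f w - g w| ^+ 2)%:E by rewrite lee_fin sqr_ge0.
rewrite -!ge0_integralZl_EFin// -ge0_integralD//; last 4 first.
- by move=> w _; apply: mule_ge0; rewrite // lee_fin.
- exact: emeasurable_funM.
- by move=> w _; apply: mule_ge0; rewrite // lee_fin.
- exact: emeasurable_funM.
apply: ge0_le_integral => //.
- by move=> w _; rewrite lee_fin sqr_ge0.
- by apply/measurable_EFinP; exact: measurable_funX.
- by apply: emeasurable_funD; exact: emeasurable_funM.
move=> w _; rewrite -!EFinM -EFinD lee_fin real_normK ?num_real// -subr_ge0.
set x := (f w)%R; set y := (g w)%R.
have -> : ((1 + e) * y ^+ 2 + (1 + e^-1) * (x - y) ^+ 2 - x ^+ 2 =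
    e^-1 * (e * y - (x - y)) ^+ 2)%R by field; rewrite gt_eqF.
by rewrite mulr_ge0 ?sqr_ge0// invr_ge0 ltW.
Qed.

Variables (A : nat -> T -> R) (L : T -> R).
Hypothesis mA : forall n, measurable_fun setT (A n).
Hypothesis mL : measurable_fun setT L.
Hypothesis A0 : forall n w, (0 <= A n w)%R.
Hypothesis L0 : forall w, (0 <= L w)%R.

(** [powR_le_pM] at a level s with s^q = e/2: the other term is a fixed multiple of a p-th moment
    that tends to 0. *)
Lemma cvg_Lp_lower (p : nat) (q : R) : (0 < q <= p%:R)%R ->
  \int[P]_w (`|A n w - L w| ^+ p)%:E @[n --> \oo] --> 0 ->
  \int[P]_w (`|A n w - L w| `^ q)%:E @[n --> \oo] --> 0.
Proof.
move=> /andP[q0 qp] H; apply: cvg0_of_near.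
  by move=> n; apply: integral_ge0 => w _; rewrite lee_fin powR_ge0.
move=> e e0; pose s := ((e / 2) `^ q^-1)%R.
have e2 : (0 < e / 2)%R by rewrite divr_gt0.
have s0 : (0 < s)%R by rewrite powR_gt0.
have sq : (s `^ q = e / 2)%R by rewrite -powRrM mulVf ?gt_eqF// powRr1// ltW.
have sp0 : (0 < s `^ (q - p%:R))%R by exact: powR_gt0.
have := @cvg0_near _ (e / 2 / s `^ (q - p%:R))%R H (divr_gt0 e2 sp0).
apply: filterS => n un.
have mD : measurable_fun setT (fun w => `|A n w - L w|%R).
  by apply: measurableT_comp => //; exact: measurable_funB.
have mp : measurable_fun setT (fun w => (`|A n w - L w| ^+ p)%:E).
  by apply/measurable_EFinP; exact: measurable_funX.
have pp w : 0 <= (`|A n w - L w| ^+ p)%:E by rewrite lee_fin exprn_ge0.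
apply: (@le_trans _ _ (\int[P]_w ((s `^ q)%:E + (s `^ (q - p%:R))%:E * (`|A n w - L w| ^+ p)%:E))).
  apply: ge0_le_integral => //.
  - exact: measurable_powRC.
  - by apply: emeasurable_funD => //; exact: emeasurable_funM.
  move=> w _; rewrite -EFinM -EFinD lee_fin; apply: powR_le_pM => //.
  by rewrite (ltW q0).
rewrite ge0_integralD//; last 3 first.
- by move=> w _; rewrite lee_fin powR_ge0.
- by move=> w _; apply: mule_ge0; rewrite // lee_fin powR_ge0.
- exact: emeasurable_funM.
rewrite ge0_integralZl_EFin ?powR_ge0// integral_cst//= probability_setT mule1 sq.
rewrite [leRHS](_ : _ = (e / 2)%:E + (s `^ (q - p%:R))%:E * (e / 2 / s `^ (q - p%:R))%:E).
  by rewrite leeD2l// lee_wpmul2l// lee_fin powR_ge0.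
rewrite -EFinM -EFinD; congr EFin; field.
by rewrite gt_eqF.
Qed.

(** The factor 2^q is harmless for estimates up to constants, and allows q < 1 and q >= 1 to be
    treated alike. *)
Lemma lim_moment_le (q B : R) : (0 <= q)%R ->
  \int[P]_w (`|A n w - L w| `^ q)%:E @[n --> \oo] --> 0 ->
  (\forall n \near \oo, \int[P]_w (A n w `^ q)%:E <= B%:E) ->
  \int[P]_w (L w `^ q)%:E <= (2 `^ q * B)%:E.
Proof.
move=> q0 H HB; apply/lee_addgt0Pr => e e0.
have [n [h1 h2]] : exists n, \int[P]_w (A n w `^ q)%:E <= B%:E /\
    \int[P]_w (`|A n w - L w| `^ q)%:E <= (e / 2 `^ q)%:E.
  have e2 : (0 < e / 2 `^ q)%R by rewrite divr_gt0// powR_gt0.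
  have [N _ HN] := filterI HB (cvg0_near H e2).
  by exists N; exact: (HN N (leqnn _)).
apply: le_trans (moment_transfer q0 mL (mA n) L0 (A0 n)) _.
under [X in _ + X]eq_integral do rewrite distrC.
apply: (@le_trans _ _ ((2 `^ q)%:E * (B%:E + (e / 2 `^ q)%:E))).
  by rewrite lee_wpmul2l ?lee_fin ?powR_ge0// leeD.
rewrite -EFinD -EFinM -EFinD lee_fin mulrDr mulrCA divff ?mulr1//.
Qed.

Lemma lim_moment_ge (q B : R) : (0 <= q)%R ->
  \int[P]_w (`|A n w - L w| `^ q)%:E @[n --> \oo] --> 0 ->
  (\forall n \near \oo, B%:E <= \int[P]_w (A n w `^ q)%:E) ->
  B%:E <= (2 `^ q)%:E * \int[P]_w (L w `^ q)%:E.
Proof.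
move=> q0 H HB; apply/lee_addgt0Pr => e e0.
have [n [h1 h2]] : exists n, B%:E <= \int[P]_w (A n w `^ q)%:E /\
    \int[P]_w (`|A n w - L w| `^ q)%:E <= (e / 2 `^ q)%:E.
  have e2 : (0 < e / 2 `^ q)%R by rewrite divr_gt0// powR_gt0.
  have [N _ HN] := filterI HB (cvg0_near H e2).
  by exists N; exact: (HN N (leqnn _)).
apply: le_trans h1 _; apply: le_trans (moment_transfer q0 (mA n) mL (A0 n) L0) _.
have Lq0 : 0 <= \int[P]_w (L w `^ q)%:E.
  by apply: integral_ge0 => w _; rewrite lee_fin powR_ge0.
have Dq0 : 0 <= \int[P]_w (`|A n w - L w| `^ q)%:E.
  by apply: integral_ge0 => w _; rewrite lee_fin powR_ge0.
rewrite ge0_muleDr// leeD2l//.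
apply: (@le_trans _ _ ((2 `^ q)%:E * (e / 2 `^ q)%:E)).
  by rewrite lee_wpmul2l ?lee_fin ?powR_ge0.
rewrite -EFinM lee_fin mulrCA divff ?mulr1//.
Qed.

Lemma lim_mean (m : R) : \int[P]_w (`|A n w - L w| `^ 1)%:E @[n --> \oo] --> 0 ->
  (forall n, \int[P]_w (A n w)%:E = m%:E) -> \int[P]_w (L w)%:E = m%:E.
Proof.
move=> H Hm; apply/eqP; rewrite eq_le; apply/andP.
have E n : \int[P]_w (`|A n w - L w| `^ 1)%:E = \int[P]_w (`|A n w - L w|)%:E.
  by apply: eq_integral => w _; rewrite powRr1.
have HN (e : R) : (0 < e)%R -> exists n, \int[P]_w (`|A n w - L w|)%:E <= e%:E.
  move=> e0; have [n _ Hn] := cvg0_near H e0.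
  by exists n; rewrite -E; exact: (Hn n (leqnn _)).
split; apply/lee_addgt0Pr => e /HN[n hn].
  apply: le_trans (mean_transfer mL (mA n) L0 (A0 n)) _.
  by under [X in _ + X]eq_integral do rewrite distrC; rewrite Hm leeD2l.
rewrite -(Hm n); apply: le_trans (mean_transfer (mA n) mL (A0 n) L0) _.
by rewrite leeD2l.
Qed.

Lemma lim_square_ge (m : R) : \int[P]_w (`|A n w - L w| `^ 2)%:E @[n --> \oo] --> 0 ->
  (\forall n \near \oo, m%:E <= \int[P]_w (A n w ^+ 2)%:E) ->
  \int[P]_w (L w ^+ 2)%:E \is a fin_num ->
  m%:E <= \int[P]_w (L w ^+ 2)%:E.
Proof.
move=> H Hm fin; apply/lee_addgt0Pr => e e0.
pose v := fine (\int[P]_w (L w ^+ 2)%:E).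
have v0 : (0 <= v)%R.
  by apply/fine_ge0/integral_ge0 => w _; rewrite lee_fin sqr_ge0.
(* With this weight [h * v] is at most e/2; the other e/2 is spent on the distance to the limit. *)
pose h := (e / 2 / (1 + v))%R.
have h0 : (0 < h)%R by rewrite !divr_gt0// ltr_wpDr.
pose k := (1 + h^-1)%R; have k0 : (0 < k)%R by rewrite addr_gt0// invr_gt0.
have ek : (0 < e / 2 / k)%R by rewrite !divr_gt0.
have [N _ HN] := filterI Hm (cvg0_near H ek).
have [h1 h2] := HN N (leqnn _).
apply: le_trans h1 _; apply: le_trans (square_transfer h0 (mA N) mL) _.
rewrite -(fineK fin) -/v -/k.
apply: (@le_trans _ _ ((1 + h)%:E * v%:E + k%:E * (e / 2 / k)%:E)).
  rewrite leeD2l// lee_wpmul2l ?lee_fin ?(ltW k0)//.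
  apply: le_trans h2; rewrite le_eqVlt; apply/orP; left; apply/eqP.
  by apply: eq_integral => w _; rewrite powR_mulrn.
rewrite -!EFinM -!EFinD lee_fin.
have -> : (k * (e / 2 / k) = e / 2)%R by field; rewrite gt_eqF.
have : (h * v <= e / 2)%R.
  rewrite /h mulrAC ler_pdivrMr ?ltr_wpDr// ler_wpM2l ?(ltW (divr_gt0 e0 _))//.
  by rewrite lerDr.
by lra.
Qed.

End moment_limits.

(** * Measurability and almost sure equality of time integrals *)

Section time_integral.
Context d (T : measurableType d) (R : realType) (P : probability T R).
Local Notation mu := (@lebesgue_measure R).
Local Open Scope ereal_scope.

(** Positive and negative parts are treated apart, since a copy may be negative on a null set. *)
Lemma measurable_time_integral (F : R -> T -> R) (t : R) :
  measurable_fun setT (fun z : measurableTypeR R * T => F z.1 z.2) ->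
  measurable_fun setT (fun w => \int[mu]_(s in `[0%R, t]) (F s w)%:E).
Proof.
move=> mF; pose Fp s w := Num.max (F s w) 0%R; pose Fn s w := Num.max (- F s w)%R 0%R.
have mp : measurable_fun setT (fun z : measurableTypeR R * T => Fp z.1 z.2).
  exact: measurable_maxr.
have mn : measurable_fun setT (fun z : measurableTypeR R * T => Fn z.1 z.2).
  by apply: measurable_maxr => //; exact: measurableT_comp.
have p0 s w : (0 <= Fp s w)%R by rewrite le_max lexx orbT.
have n0 s w : (0 <= Fn s w)%R by rewrite le_max lexx orbT.
have := emeasurable_funB (measurable_mass t mp p0) (measurable_mass t mn n0).
apply: eq_measurable_fun => w _; rewrite integralE /mass; congr (_ - _).
  by apply: eq_integral => s _; rewrite funeposE /Fp EFin_max.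
by apply: eq_integral => s _; rewrite funenegE /Fn -EFinN EFin_max.
Qed.

(** The exceptional null set depends on the time. By Tonelli's theorem |F - G| has integral 0 over
    time and probability, so that almost every w has paths that agree at almost every time. *)
Lemma ae_eq_time_integral (F G : R -> T -> R) (t : R) :
  measurable_fun setT (fun z : measurableTypeR R * T => F z.1 z.2) ->
  measurable_fun setT (fun z : measurableTypeR R * T => G z.1 z.2) ->
  (forall s : R, (0 <= s)%R -> {ae P, forall w, F s w = G s w}) ->
  {ae P, forall w, \int[mu]_(s in `[0%R, t]) (F s w)%:E = \int[mu]_(s in `[0%R, t]) (G s w)%:E}.
Proof.
move=> mF mG FG; pose H s w := `|F s w - G s w|%R.
have mH : measurable_fun setT (fun z : measurableTypeR R * T => H z.1 z.2).
  by apply: measurableT_comp => //; exact: measurable_funB.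
have H0 s w : (0 <= H s w)%R by exact: normr_ge0.
have E : mass_moment P H t 1 (cst 1%R) = 0.
  rewrite (mass_momentS P t mH H0 0 (measurable_cst _) (fun=> ler01)).
  apply: integral0_eq => s /=; rewrite in_itv/= => /andP[s0 _].
  rewrite /mass_moment (ge0_ae_eq_integral (g := cst 0))//.
  - exact: integral0.
  - under eq_fun do rewrite mul1r mule1; apply/measurable_EFinP.
    exact: (measurable_section mH).
  - by move=> w _; rewrite mul1r mule1 lee_fin.
  - have := FG s s0; apply: filterS => w FGw _.
    by rewrite /H FGw subrr normr0 mulr0 mul0e.
have mm := measurable_mass t mH H0.
have : ae_eq P setT (mass H t) (cst 0).
  apply/ae_eq_integral_abs => //; rewrite -[RHS]E.
  by apply: eq_integral => w _; rewrite mul1e gee0_abs ?mass_ge0.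
apply: filterS => w /(_ Logic.I) /= mw.
have sF (K : R -> T -> R) : measurable_fun setT (fun z : measurableTypeR R * T => K z.1 z.2) ->
    measurable_fun (`[0%R, t]%classic : set (measurableTypeR R)) (fun s => (K s w)%:E).
  move=> mK; apply/measurable_EFinP; apply: measurable_funTS.
  exact: (measurableT_comp mK (measurable_pair2 w)).
have : ae_eq mu (`[0%R, t]%classic : set (measurableTypeR R)) (fun s => (H s w)%:E) (cst 0).
  apply/ae_eq_integral_abs => //; first exact: sF.
  by rewrite -mw; apply: eq_integral => s _; rewrite gee0_abs ?lee_fin.
move=> HE; apply: ae_eq_integral => //; [exact: sF|exact: sF|].
apply: filterS HE => s Hs st; have [/eqP] := Hs st.
by rewrite normr_eq0 subr_eq0 => /eqP ->.
Qed.

End time_integral.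

(** * The given processes as total masses, and the two-point function *)

Section limit.
Context d (T : measurableType d) (R : realType) (P : probability T R).
Variables (kappa delta lam gamma : R) (X : R -> T -> R) (Lj : nat -> R -> T -> R).
Hypothesis kappa01 : 0 < kappa < 1.
Hypothesis delta_gt0 : 0 < delta.
Hypothesis lam_gt0 : 0 < lam.
Hypothesis gamma_ge0 : 0 <= gamma.
Hypothesis X_OU : stationary_OU P lam (tempered_stable kappa delta gamma) X.
Hypothesis Lj_copies : independent_copies P
  (geometric_process (c_X kappa delta gamma) X) Lj.
Variables (p : nat) (b : R).

Local Notation g := (gamma `^ kappa^-1).
Local Notation cum := (cumulant kappa delta gamma).
Local Notation c := (cum 1).
Local Notation lm := (log_moment kappa delta gamma).
Local Notation om := (decay_rate kappa delta gamma p).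

Hypothesis p_ge2 : (2 <= p)%N.
Hypothesis p_le : 2 * p%:R <= g.
Hypothesis om_lt : expR om < b.

Local Notation A := (total_mass Lj b).
Local Notation zeta q := (q - lm q / ln b).
Local Notation mu := (@lebesgue_measure R).
Let b1 : 1 < b. Proof. exact: (b_gt1 kappa01 delta_gt0 gamma_ge0 p_ge2 p_le om_lt). Qed.
Let b0 : 0 < b. Proof. exact: lt_trans b1. Qed.

(** Positivity is an event of the one-dimensional distribution, which a copy shares with an
    exponential. *)
Lemma copy_gt0 j (s : R) : 0 <= s -> {ae P, forall w, 0 < Lj j s w}.
Proof.
move=> s0; have [/(_ j)[pL fdd] _ _] := Lj_copies.
have mpos : measurable [set w | 0 < Lj j s w].
  rewrite -[X in measurable X]setTI; have -> : [set w | 0 < Lj j s w] = Lj j s @^-1` `]0, +oo[.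
    by apply/seteqP; split => w /=; rewrite in_itv/= andbT.
  by apply: pL => //; exact: measurable_itv.
have P1 : P [set w | 0 < Lj j s w] = 1%E.
  pose B : set (1.-tuple (measurableTypeR R)) := (fun v => tnth v ord0) @^-1` `]0, +oo[.
  have mB : measurable B.
    have mI : measurable (`]0%R, +oo[%classic : set (measurableTypeR R)) by exact: measurable_itv.
    by rewrite /B -[X in measurable X]setTI; exact: (measurable_tnth ord0 measurableT mI).
  have t0 i : 0 <= tnth [tuple s] i by rewrite (ord1 i).
  have := fdd 1%N [tuple s] B t0 mB.
  have -> : at_times [tuple s] (Lj j) @^-1` B = [set w | 0 < Lj j s w].
    by apply/seteqP; split => w; rewrite /B /at_times /= tnth_mktuple /= in_itv/= andbT.
  move=> ->; rewrite [X in P X](_ : _ = setT) ?probability_setT//.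
  apply/seteqP; split => // w _; rewrite /B /at_times /= tnth_mktuple /= in_itv/= andbT.
  exact: expR_gt0.
exists (~` [set w | 0 < Lj j s w]); split => //; first exact: measurableC.
by rewrite probability_setC// P1 subee.
Qed.

Local Notation F n := (fun (s : R) w => \prod_(j < n.+1) Lj j (Num.max (s * b ^+ j) 0) w).

Lemma measurable_copies n : measurable_fun setT (fun z : measurableTypeR R * T => F n z.1 z.2).
Proof.
apply: measurable_prod => j _.
have mt : measurable_fun setT (fun z : measurableTypeR R * T =>
    (z.1 * b ^+ j : measurableTypeR R, z.2)).
  by apply: measurable_fun_pair => //; apply: measurable_funM.
exact: (measurableT_comp (copy_measurable2 Lj_copies j) mt).
Qed.

Lemma A_procE n t w : A_proc Lj b n t w = fine (\int[mu]_(s in `[0%R, t]) (F n s w)%:E).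
Proof.
congr fine; apply: eq_integral => s /set_mem /=; rewrite in_itv/= => /andP[s0 _].
congr EFin; apply: eq_bigr => j _; rewrite max_l// mulr_ge0//.
by apply: exprn_ge0; exact: ltW.
Qed.

Lemma measurable_A_proc n t : measurable_fun setT (A_proc Lj b n t).
Proof.
have -> : A_proc Lj b n t = fun w => fine (\int[mu]_(s in `[0%R, t]) (F n s w)%:E).
  by apply/funext => w; exact: A_procE.
apply: measurableT_comp => //; exact: (measurable_time_integral t (measurable_copies n)).
Qed.

(** The index shifts by one because the n-th process has n + 1 factors. The two may differ on null
    sets, where a copy is not positive. *)
Lemma A_proc_total_mass n t : {ae P, forall w, A_proc Lj b n t w = A n.+1 t w}.
Proof.
have mY := measurable_cascade Lj_copies b n.+1.
have : {ae P, forall w, \int[mu]_(s in `[0%R, t]) (F n s w)%:E =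
    \int[mu]_(s in `[0%R, t]) (cascade Lj b n.+1 s w)%:E}%E.
  apply: (ae_eq_time_integral t (measurable_copies n) mY) => s s0.
  have s0' j : 0 <= s * b ^+ j by rewrite mulr_ge0// exprn_ge0// ltW.
  have : {ae P, forall w, forall j : nat, 0 < Lj j (s * b ^+ j) w}.
    by apply: ae_foralln => j; exact: copy_gt0.
  apply: filterS => w Hw; rewrite /cascade expR_sum; apply: eq_bigr => j _.
  by rewrite /log_copy max_l// lnK// posrE.
by apply: filterS => w; rewrite A_procE => ->.
Qed.

Lemma A_proc_expectation n t (phi : R -> R) (L : T -> R) :
  measurable_fun setT L -> measurable_fun setT phi -> (forall x, 0 <= phi x) ->
  (\int[P]_w (phi (A_proc Lj b n t w - L w))%:E =
   \int[P]_w (phi (A n.+1 t w - L w))%:E)%E.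
Proof.
move=> mL mphi phi0; apply: ge0_ae_eq_integral => //.
- apply/measurable_EFinP; apply: (measurableT_comp mphi); apply: measurable_funB => //.
  exact: measurable_A_proc.
- apply/measurable_EFinP; apply: (measurableT_comp mphi); apply: measurable_funB => //.
  exact: (measurable_total_mass Lj_copies).
- by move=> w _; rewrite lee_fin.
- by move=> w _; rewrite lee_fin.
- by have := A_proc_total_mass n t; apply: filterS => w -> _.
Qed.

(** Convexity gives lm q <= (q/p) lm p, and lm p = (p - 1) om < p ln b. Positivity is needed at t =
    0, where the power of t has to vanish with the mass. *)
Lemma zeta_gt0 q : 0 < q <= p%:R -> 0 < zeta q.
Proof.
move=> /andP[q0 qp]; have lb : 0 < ln b by exact: ln_gt0.
have p0 : 0 < p%:R :> R by rewrite (lt_le_trans q0).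
have t01 : 0 <= q / p%:R <= 1 by rewrite divr_ge0 ?(ltW q0) ?(ltW p0)//= ler_pdivrMr// mul1r.
have g0 : 2 * 0 <= g by rewrite mulr0 powR_ge0.
have := log_moment_convex kappa01 delta_gt0 t01 p_le g0.
rewrite (log_moment0 _ kappa01)// !mulr0 !addr0 divfK ?gt_eqF// => h.
rewrite subr_gt0 ltr_pdivrMr//; apply: (le_lt_trans h).
have hp : lm p%:R < p%:R * ln b.
  rewrite log_moment_p//; have := @ltr_ln R (expR om) b.
  rewrite !posrE expR_gt0 b0 om_lt expRK => /(_ isT isT) oml.
  have pp : p.-1%:R <= p%:R :> R by rewrite ler_nat leq_pred.
  have pp0 : 0 < p.-1%:R :> R by rewrite ltr0n -subn1 subn_gt0.
  apply: (@lt_le_trans _ _ (ln b * p.-1%:R)); first by rewrite ltr_pM2r.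
  by rewrite mulrC ler_wpM2r// ltW.
have := ltr_pM2l (divr_gt0 q0 p0) (lm p%:R) (p%:R * ln b).
by rewrite hp mulrA divfK ?gt_eqF.
Qed.

(** M(1, 1; h) in closed form, as [two_point_expectation] shows. *)
Definition two_point (h : R) : R := expR (increment kappa delta gamma (expR (- lam * `|h|))).

Let g4 : 4 <= g.
Proof.
apply: le_trans p_le; have : 2 <= p%:R :> R by rewrite ler_nat.
by lra.
Qed.

Lemma log_joint2 (s u : R) : s <= u ->
  expR (log_joint kappa delta gamma lam [:: s; u]) = two_point (u - s).
Proof.
move=> su; rewrite /= /lag big_seq1 big_nil (increment0 _ kappa01)// !addr0.
by rewrite /two_point ger0_norm// subr_ge0.
Qed.

Lemma two_pointN h : two_point (- h) = two_point h.
Proof. by rewrite /two_point normrN. Qed.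

Lemma log_joint2_insertion_sort (s u : R) :
  expR (log_joint kappa delta gamma lam (insertion_sort [:: s; u])) = two_point (u - s).
Proof.
rewrite [insertion_sort _]/=; case: ifP => su; first exact: log_joint2.
by rewrite -two_pointN opprB log_joint2// ltW// ltNge su.
Qed.

(** A convex function vanishing at 0 is superadditive on nonnegative arguments, so that the
    [increment] is nonnegative here. *)
Lemma two_point_ge1 h : 1 <= two_point h.
Proof.
rewrite /two_point -[leLHS]expR0 ler_expR; set x := expR _.
have x0 : 0 < x by exact: expR_gt0.
have x1 : x <= 1.
  by rewrite /x -[leRHS]expR0 ler_expR mulNr oppr_le0 mulr_ge0// ltW.
have y0 : 0 < x + 1 by rewrite addr_gt0.
have gx : 2 * (x + 1) <= g by apply: le_trans g4; lra.
have g0 : 2 * 0 <= g by rewrite mulr0 powR_ge0.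
have conv (t : R) : 0 <= t <= 1 -> cum (t * (x + 1)) <= t * cum (x + 1).
  move=> t01; have := cumulant_convex kappa01 delta_gt0 t01 gx g0.
  by rewrite (cumulant0 _ kappa01)// !mulr0 !addr0.
have h1 : cum x <= x / (x + 1) * cum (x + 1).
  have := conv (x / (x + 1)); rewrite divfK ?gt_eqF//; apply.
  by rewrite divr_ge0 ?(ltW x0) ?(ltW y0)//= ler_pdivrMr// mul1r lerDl.
have h2 : cum 1 <= (x + 1)^-1 * cum (x + 1).
  have := conv (x + 1)^-1; rewrite mulVf ?gt_eqF//; apply.
  by rewrite invr_ge0 (ltW y0)/= invf_le1// lerDr ltW.
have h3 : x / (x + 1) * cum (x + 1) + (x + 1)^-1 * cum (x + 1) = cum (x + 1).
  by field; rewrite gt_eqF.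
by rewrite /increment; lra.
Qed.

Lemma two_point_expectation (t1 t2 : R) : 0 <= t1 -> 0 <= t2 ->
  (two_point (t1 - t2))%:E = ((expR (- 2 * c_X kappa delta gamma))%:E *
     \int[P]_w (expR (X t1 w + X t2 w))%:E)%E.
Proof.
wlog t12 : t1 t2 / t1 <= t2.
  move=> H h1 h2; have [t12|/ltW t21] := leP t1 t2; first exact: H.
  rewrite -two_pointN opprB H//; congr (_ * _)%E.
  by apply: eq_integral => w _; rewrite addrC.
move=> h1 h2; rewrite -two_pointN opprB -log_joint2//.
have us0 : {in [:: t1; t2], forall u : R, 0 <= u}.
  by move=> u; rewrite !inE => /orP[] /eqP ->.
have sg : 2 * (size [:: t1; t2])%:R <= g by apply: le_trans g4; rewrite /=; lra.
have st : sorted <=%R [:: t1; t2] by rewrite /= t12.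
rewrite -(ou_joint kappa01 lam_gt0 X_OU st us0 sg) (ou_center X_OU us0).
rewrite c_XE (_ : - 2 * c = - c * (size [:: t1; t2])%:R); last by rewrite /=; ring.
congr (_ * _)%E.
by apply: eq_integral => w _; rewrite big_cons big_seq1.
Qed.

Let m2p : measurable_fun setT (fun z : measurableTypeR R * measurableTypeR R => two_point (z.1 - z.2)).
Proof.
have mcum : measurable_fun setT (cum : R -> R).
  apply: measurable_funB => //; apply: measurable_funM => //.
  apply: (measurableT_comp (@measurable_powR R kappa)); apply: measurable_funB => //.
have minc : measurable_fun setT (increment kappa delta gamma).
  apply: measurable_funB => //; apply: measurable_funB => //.
  by apply: (measurableT_comp mcum); exact: measurable_funD.
have m2 : measurable_fun setT two_point.
  apply: (measurableT_comp (@measurable_expR R)); apply: (measurableT_comp minc).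
  have mn : measurable_fun setT (fun h : R => `|h|) := @normr_measurable R setT.
  by apply: (measurableT_comp (@measurable_expR R)); exact: measurable_funM.
by apply: (measurableT_comp m2); exact: measurable_funB.
Qed.

Lemma total_mass1_square t : 0 <= t ->
  (\int[P]_w (A 1 t w ^+ 2)%:E =
   \int[mu]_(v in `[0%R, t]) \int[mu]_(u in `[0%R, t]) (two_point (u - v))%:E)%E.
Proof.
move=> t0; have mY := measurable_cascade Lj_copies b 1; have Y0 := cascade_ge0 Lj b 1.
have HM := total_mass_moment kappa01 delta_gt0 lam_gt0 gamma_ge0 X_OU Lj_copies p_ge2 p_le om_lt.
have := HM 1%N t 2%N (cst 1) t0 (measurable_cst _) (fun=> ler01).
under eq_integral do rewrite mul1r.
move=> ->; rewrite (mass_momentS P t mY Y0 1 (measurable_cst _) (fun=> ler01)).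
apply: eq_integral => v /set_mem /=; rewrite in_itv/= => /andP[v0 _].
have mYv : measurable_fun setT (fun w => cst 1 w * cascade Lj b 1 v w).
  by apply: measurable_funM => //; exact: (measurable_section mY).
have Yv0 w : 0 <= cst 1 w * cascade Lj b 1 v w by rewrite mul1r.
rewrite (mass_momentS P t mY Y0 0 mYv Yv0).
apply: eq_integral => u /set_mem /=; rewrite in_itv/= => /andP[u0 _].
rewrite mass_moment0.
have l0 : {in [:: v; u] ++ [::], forall s : R, 0 <= s}.
  by move=> s; rewrite !inE => /orP[] /eqP ->.
have := @cascade_moment _ _ _ _ _ _ _ _ _ _ kappa01 delta_gt0 lam_gt0 gamma_ge0 X_OU Lj_copies
  _ _ p_ge2 p_le om_lt 1%N 0%N 0%N 0 [:: v; u] [::] isT isT l0 p_ge2.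
rewrite add0r ler_nat => /(_ p_ge2).
rewrite big_ord1 /= expr0 !mulr1 log_anchored0 log_joint2_insertion_sort => <-.
apply: eq_integral => w _; congr EFin.
by rewrite anchor0 big_cons big_seq1 big_nil !mul1r mulr1.
Qed.

Lemma two_point_integral t : 0 <= t ->
  (\int[mu]_(v in `[0%R, t]) \int[mu]_(u in `[0%R, t]) (two_point (u - v))%:E =
   \int[mu]_(v in `[0%R, t]) \int[mu]_(u in `[0%R, t]) (two_point (u - v) - 1)%:E + (t ^+ 2)%:E)%E.
Proof.
move=> t0.
have mt : (mu (`[0%R, t]%classic : set (measurableTypeR R)) = t%:E)%E.
  rewrite lebesgue_measure_itv/= lte_fin; case: ltP => [_|t0']; first by rewrite sube0.
  by rewrite (le_anti (introT andP (conj t0' t0))).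
have m1 : measurable_fun setT (fun z : measurableTypeR R * measurableTypeR R =>
    two_point (z.1 - z.2) - 1) by exact: measurable_funB.
have ge0 h : 0 <= two_point h - 1 by rewrite subr_ge0 two_point_ge1.
transitivity (\int[mu]_(v in `[0%R, t])
    (\int[mu]_(u in `[0%R, t]) (two_point (u - v) - 1)%:E + t%:E))%E.
  apply: eq_integral => v _.
  transitivity (\int[mu]_(u in `[0%R, t]) ((two_point (u - v) - 1)%:E + (cst 1 u : \bar R)))%E.
    by apply: eq_integral => u _; rewrite -EFinD subrK.
  rewrite ge0_integralD//.
  - by rewrite integral_cst//= mul1e mt.
  - by move=> u _; rewrite lee_fin.
  - apply/measurable_EFinP; apply: measurable_funTS.
    exact: (measurableT_comp m1 (measurable_pair2 (v : measurableTypeR R))).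
rewrite ge0_integralD//.
- rewrite integral_cst//= mt -EFinM -expr2//.
- by move=> v _; apply: integral_ge0 => u _; rewrite lee_fin.
- apply: measurable_funTS.
  exact: (@measurable_time_integral _ (measurableTypeR R) R (fun u v => two_point (u - v) - 1) t m1).
Qed.

End limit.

(** From 2 f g <= f^2 + g^2 and E f g = E g^2; finiteness of E g^2 allows it to be cancelled. *)
Lemma square_le_of_martingale d (T : measurableType d) (R : realType) (P : probability T R)
    (f g : T -> R) :
  measurable_fun setT f -> measurable_fun setT g -> (forall w, 0 <= f w) -> (forall w, 0 <= g w) ->
  (\int[P]_w (f w * g w ^+ 1)%:E = \int[P]_w (g w ^+ 2)%:E)%E ->
  (\int[P]_w (g w ^+ 2)%:E)%E \is a fin_num ->
  (\int[P]_w (g w ^+ 2)%:E <= \int[P]_w (f w ^+ 2)%:E)%E.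
Proof.
move=> mf mg f0 g0 fg gfin.
have m1 : measurable_fun setT (fun w => (g w ^+ 2)%:E).
  by apply/measurable_EFinP; exact: measurable_funX.
have m2 : measurable_fun setT (fun w => (f w ^+ 2)%:E).
  by apply/measurable_EFinP; exact: measurable_funX.
have m3 : measurable_fun setT (fun w => (f w * g w ^+ 1)%:E).
  by apply/measurable_EFinP; exact: (measurable_funM mf (measurable_funX 1 mg)).
have p1 w : setT w -> (0 <= (g w ^+ 2)%:E)%E by rewrite lee_fin sqr_ge0.
have p2 w : setT w -> (0 <= (f w ^+ 2)%:E)%E by rewrite lee_fin sqr_ge0.
have p3 w : setT w -> (0 <= (f w * g w ^+ 1)%:E)%E by rewrite lee_fin expr1 mulr_ge0.
rewrite -(leeD2rE _ _ gfin) -{1 2}fg.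
rewrite -(ge0_integralD P measurableT p3 m3 p3 m3) -(ge0_integralD P measurableT p2 m2 p1 m1).
apply: ge0_le_integral => //.
- by move=> w _; apply: adde_ge0; exact: p3.
- exact: emeasurable_funD.
- exact: emeasurable_funD.
move=> w _; rewrite -!EFinD lee_fin expr1 -subr_ge0.
have -> : f w ^+ 2 + g w ^+ 2 - (f w * g w + f w * g w) = (f w - g w) ^+ 2 by ring.
exact: sqr_ge0.
Qed.

(** * Convergence, scaling and variance of the limit mass *)

Section limit_mass.
Context d (T : measurableType d) (R : realType) (P : probability T R).
Variables (kappa delta lam gamma : R) (X : R -> T -> R) (Lj : nat -> R -> T -> R).
Hypothesis kappa01 : 0 < kappa < 1.
Hypothesis delta_gt0 : 0 < delta.
Hypothesis lam_gt0 : 0 < lam.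
Hypothesis gamma_ge0 : 0 <= gamma.
Hypothesis X_OU : stationary_OU P lam (tempered_stable kappa delta gamma) X.
Hypothesis Lj_copies : independent_copies P
  (geometric_process (c_X kappa delta gamma) X) Lj.
Variables (p : nat) (b : R).

Local Notation g := (gamma `^ kappa^-1).
Local Notation cum := (cumulant kappa delta gamma).
Local Notation lm := (log_moment kappa delta gamma).
Local Notation om := (decay_rate kappa delta gamma p).

Hypothesis p_ge2 : (2 <= p)%N.
Hypothesis p_le : 2 * p%:R <= g.
Hypothesis om_lt : expR om < b.

Local Notation A := (total_mass Lj b).
Local Notation zeta q := (q - lm q / ln b).
Local Notation mu := (@lebesgue_measure R).

Lemma limit_mass_exists t : 0 <= t <= 1 -> exists L : T -> R,
  [/\ measurable_fun setT L, forall w, 0 <= L w &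
      (\int[P]_w (`|A n t w - L w| ^+ p)%:E @[n --> \oo] --> 0)%E].
Proof.
move=> t01; have t0 : 0 <= t by case/andP: t01.
have [C C0 HC] :=
  total_mass_bounded kappa01 delta_gt0 lam_gt0 gamma_ge0 X_OU Lj_copies p_ge2 p_le om_lt.
have HM := total_mass_martingale kappa01 delta_gt0 lam_gt0 gamma_ge0 X_OU Lj_copies p_ge2 p_le om_lt.
case: p p_ge2 HC HM => [//|[//|m]] _ HC HM.
have := @martingale_Lp_limit _ _ _ P (fun n => A n t) m C.
have mA n : measurable_fun setT (A n t) by exact: (measurable_total_mass Lj_copies).
have A0 n w : 0 <= A n t w by exact: total_mass_ge0.
have Ab n : (\int[P]_w (A n t w ^+ m.+2)%:E <= C%:E)%E by exact: HC.
have AM M N : (M <= N)%N ->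
    (\int[P]_w (A N t w * A M t w ^+ m.+1)%:E = \int[P]_w (A M t w ^+ m.+2)%:E)%E.
  by move=> MN; exact: HM.
by move=> /(_ mA A0 Ab AM).
Qed.

Variables (t : R) (L : T -> R).
Hypothesis t01 : 0 <= t <= 1.
Hypothesis mL : measurable_fun setT L.
Hypothesis L0 : forall w, 0 <= L w.
Hypothesis cvgL : (\int[P]_w (`|A n t w - L w| ^+ p)%:E @[n --> \oo] --> 0)%E.

Let t0 : 0 <= t. Proof. by case/andP: t01. Qed.
Let mA n : measurable_fun setT (A n t).
Proof. exact: (measurable_total_mass Lj_copies). Qed.
Let A0 n w : 0 <= A n t w. Proof. exact: total_mass_ge0. Qed.

Lemma limit_mass_cvg q : 0 < q <= p%:R ->
  (\int[P]_w (`|A n t w - L w| `^ q)%:E @[n --> \oo] --> 0)%E.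
Proof. by move=> q0p; exact: (cvg_Lp_lower mA mL q0p cvgL). Qed.

Lemma A_proc_cvg q : 0 < q <= p%:R ->
  ('E_P[fun w => (`|A_proc Lj b n t w - L w| `^ q)%R] @[n --> \oo] --> 0)%E.
Proof.
move=> q0p; have := limit_mass_cvg q0p; rewrite -cvg_shiftS.
have -> // : (fun n => 'E_P[fun w => (`|A_proc Lj b n t w - L w| `^ q)%R])%E =
  (fun n => \int[P]_w (`|A n.+1 t w - L w| `^ q)%:E)%E.
apply/funext => n; rewrite unlock.
have mphi : measurable_fun setT (fun x : R => `|x| `^ q).
  exact: (measurableT_comp (measurable_powR q) (@normr_measurable R setT)).
exact: (A_proc_expectation kappa01 delta_gt0 gamma_ge0 Lj_copies p_ge2 p_le om_lt n t mL mphi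
  (fun x => powR_ge0 _ _)).
Qed.

Lemma limit_mass_at0 q : 0 < q <= p%:R -> t = 0 -> (\int[P]_w (L w `^ q)%:E = 0)%E.
Proof.
move=> q0p t0'; have /andP[q0 _] := q0p.
have Aq n : (\int[P]_w (A n t w `^ q)%:E <= 0%:E)%E.
  rewrite (_ : integral _ _ _ = 0%E)//; apply: integral0_eq => w _.
  rewrite /total_mass /mass t0' set_itv1 integral_set1 //.
  by rewrite /= powR0// gt_eqF.
have nAq : \forall n \near \oo, (\int[P]_w (A n t w `^ q)%:E <= 0%:E)%E by exact: nearW.
have := lim_moment_le mA mL A0 L0 (ltW q0) (limit_mass_cvg q0p) nAq.
rewrite mulr0 => h; apply/eqP; rewrite eq_le h/=.
by apply: integral_ge0 => w _; rewrite lee_fin powR_ge0.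
Qed.

Lemma limit_mass_mean : (\int[P]_w (L w)%:E = t%:E)%E.
Proof.
have p1 : 0 < (1 : R) <= p%:R by rewrite ltr01 ler1n (leq_trans _ p_ge2).
apply: (lim_mean mA mL A0 L0 (limit_mass_cvg p1)) => n.
rewrite -(mass_mean kappa01 delta_gt0 lam_gt0 gamma_ge0 X_OU Lj_copies p_ge2 p_le om_lt n t0).
rewrite -(total_mass_moment kappa01 delta_gt0 lam_gt0 gamma_ge0 X_OU Lj_copies p_ge2 p_le om_lt
  n 1 t0 (measurable_cst _) (fun=> ler01)).
by apply: eq_integral => w _; rewrite expr1 mul1r.
Qed.

Lemma total_mass1_square_fin : (\int[P]_w (A 1 t w ^+ 2)%:E)%E \is a fin_num.
Proof.
have p1 w : setT w -> (0 <= (A 1 t w ^+ 2)%:E)%E by rewrite lee_fin sqr_ge0.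
have m1 : measurable_fun setT (fun w => (A 1 t w ^+ 2)%:E).
  by apply/measurable_EFinP; exact: measurable_funX.
have [C _ HC] :=
  total_mass_bounded kappa01 delta_gt0 lam_gt0 gamma_ge0 X_OU Lj_copies p_ge2 p_le om_lt.
rewrite ge0_fin_numE ?integral_ge0//; apply: (@le_lt_trans _ _ (1 + C%:E)%E); last exact: ltry.
have p4 w : setT w -> (0 <= (A 1 t w ^+ p)%:E)%E by rewrite lee_fin exprn_ge0.
have m4 : measurable_fun setT (fun w => (A 1 t w ^+ p)%:E).
  by apply/measurable_EFinP; exact: measurable_funX.
(* A^2 <= 1 + A^p, by [powR_le_pM] at s = 1. *)
apply: (@le_trans _ _ (\int[P]_w (cst 1 w + (A 1 t w ^+ p)%:E))%E).
  apply: ge0_le_integral => //; first exact: emeasurable_funD.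
  move=> w _; rewrite -EFinD lee_fin -powR_mulrn//.
  have q2 : 0 <= (2 : R) <= p%:R by rewrite ler0n ler_nat.
  by have := powR_le_pM (A0 1 w) ltr01 q2; rewrite !powR1 mul1r.
by rewrite ge0_integralD// integral_cst//= mul1e probability_setT leeD2l// HC.
Qed.

Lemma total_mass_square_le n : (1 <= n)%N ->
  (\int[P]_w (A 1 t w ^+ 2)%:E <= \int[P]_w (A n t w ^+ 2)%:E)%E.
Proof.
move=> n1.
have HM := total_mass_martingale kappa01 delta_gt0 lam_gt0 gamma_ge0 X_OU Lj_copies p_ge2 p_le om_lt
  n1 p_ge2 t0.
exact: (square_le_of_martingale (mA n) (mA 1) (A0 n) (A0 1) HM total_mass1_square_fin).
Qed.

Lemma limit_mass_scaling q : 0 < q <= p%:R -> 0 < t -> forall Clow Cup N0,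
  (forall N, (N0 <= N)%N ->
    ((Clow * t `^ (zeta q))%:E <= \int[P]_w (A N t w `^ q)%:E <= (Cup * t `^ (zeta q))%:E)%E) ->
  ((2 `^ (- q) * Clow * t `^ (zeta q))%:E <= \int[P]_w (L w `^ q)%:E <=
   (2 `^ q * Cup * t `^ (zeta q))%:E)%E.
Proof.
move=> q0p tp Clow Cup N0 HN; have /andP[q0 _] := q0p.
have lo : \forall n \near \oo, ((Clow * t `^ (zeta q))%:E <= \int[P]_w (A n t w `^ q)%:E)%E.
  by exists N0 => // N /= /HN /andP[].
have up : \forall n \near \oo, (\int[P]_w (A n t w `^ q)%:E <= (Cup * t `^ (zeta q))%:E)%E.
  by exists N0 => // N /= /HN /andP[].
apply/andP; split.
  have := lim_moment_ge mA mL A0 L0 (ltW q0) (limit_mass_cvg q0p) lo.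
  by rewrite -lee_pdivrMl ?powR_gt0// -EFinM powRN mulrA.
have := lim_moment_le mA mL A0 L0 (ltW q0) (limit_mass_cvg q0p) up.
by rewrite mulrA.
Qed.

(** The variance is E L^2 - t^2, and E L^2 is at least the second moment at depth 1, a double
    integral of [two_point]. Copies of t^2 are added to both sides so that only nonnegative
    integrands occur. *)
Lemma limit_mass_variance : (\int[P]_w (L w ^+ 2)%:E \is a fin_num)%E ->
  (\int[mu]_(v in `[0%R, t]) \int[mu]_(u in `[0%R, t])
     (two_point kappa delta lam gamma (u - v) - 1)%:E <= 'V_P[L])%E.
Proof.
move=> Lfin; set I := (\int[mu]_(v in _) _)%E.
have m1 : measurable_fun setT (fun w => ((L w - t) ^+ 2)%:E).
  by apply/measurable_EFinP; apply: measurable_funX; exact: measurable_funB.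
have m2 : measurable_fun setT (fun w => (L w)%:E) by exact/measurable_EFinP.
have m3 : measurable_fun setT (fun w => (L w ^+ 2)%:E).
  by apply/measurable_EFinP; exact: measurable_funX.
have m4 : measurable_fun setT (fun w => (2 * t)%:E * (L w)%:E)%E by exact: emeasurable_funM.
have p1 w : setT w -> (0 <= ((L w - t) ^+ 2)%:E)%E by rewrite lee_fin sqr_ge0.
have p2 w : setT w -> (0 <= (L w)%:E)%E by rewrite lee_fin.
have p3 w : setT w -> (0 <= (L w ^+ 2)%:E)%E by rewrite lee_fin sqr_ge0.
have t20 : 0 <= 2 * t by rewrite mulr_ge0.
have p4 w : setT w -> (0 <= (2 * t)%:E * (L w)%:E)%E by rewrite -EFinM lee_fin mulr_ge0.
have m5 : measurable_fun setT (fun _ : T => (t ^+ 2)%:E) by exact: measurable_cst.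
have p5 (w : T) : setT w -> (0 <= (t ^+ 2)%:E)%E by rewrite lee_fin sqr_ge0.
have VE : 'V_P[L]%E = (\int[P]_w ((L w - t) ^+ 2)%:E)%E.
  have EL : 'E_P[L]%E = t%:E by rewrite unlock limit_mass_mean.
  rewrite /variance covariance.unlock EL expectation.unlock; apply: eq_integral => w _.
  by rewrite expr2.
have h1 : ('V_P[L] + (t ^+ 2 + t ^+ 2)%:E = \int[P]_w (L w ^+ 2)%:E + (t ^+ 2)%:E)%E.
  transitivity (\int[P]_w (((L w - t) ^+ 2)%:E + (2 * t)%:E * (L w)%:E))%E.
    rewrite ge0_integralD// ge0_integralZl_EFin// limit_mass_mean VE -EFinM.
    by congr (_ + _%:E)%E; ring.
  transitivity (\int[P]_w ((L w ^+ 2)%:E + (t ^+ 2)%:E))%E.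
    by apply: eq_integral => w _; rewrite -EFinM -!EFinD; congr EFin; ring.
  rewrite (ge0_integralD P measurableT p3 m3 p5 m5); congr (_ + _)%E.
  by rewrite integral_cst//= probability_setT mule1.
have h2 : (I + (t ^+ 2)%:E <= \int[P]_w (L w ^+ 2)%:E)%E.
  rewrite -(two_point_integral kappa01 delta_gt0 lam_gt0 gamma_ge0 p_ge2 p_le t0).
  rewrite -(total_mass1_square kappa01 delta_gt0 lam_gt0 gamma_ge0 X_OU Lj_copies p_ge2 p_le om_lt t0).
  have p2' : 0 < (2%:R : R) <= p%:R by rewrite ltr0n ler_nat.
  rewrite -(fineK total_mass1_square_fin); apply: (lim_square_ge mA mL _ _ Lfin).
    exact: limit_mass_cvg.
  exists 1%N => // n n1; rewrite /= (fineK total_mass1_square_fin).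
  exact: total_mass_square_le.
rewrite -(@leeD2rE _ (t ^+ 2 + t ^+ 2)%:E)// h1 EFinD addeA leeD2r//.
Qed.

End limit_mass.

(** * The parameters of the theorem in terms of the log-moment function *)

Section parameters.
Context {R : realType}.

Lemma b_boundE (kappa delta gamma : R) (qs : nat) : (2 <= qs)%N ->
  b_bound kappa delta gamma qs = expR (decay_rate kappa delta gamma qs).
Proof.
move=> qs2; have q1 : (1 : R) < qs%:R by rewrite ltr1n.
rewrite /b_bound /decay_rate /log_moment /cumulant mulr1; congr expR.
have -> : qs.-1%:R = qs%:R - 1 :> R by rewrite -subn1 natrB// ltnW.
have e1 : 1 - qs%:R != 0 :> R by rewrite subr_eq0 lt_eqF.
have e2 : qs%:R - 1 != 0 :> R by rewrite subr_eq0 gt_eqF.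
by field; rewrite ?e1 ?e2.
Qed.

Lemma varsigmaE (kappa delta gamma b q : R) : ln b != 0 ->
  varsigma kappa delta gamma b q = q - log_moment kappa delta gamma q / ln b.
Proof. by move=> lb; rewrite /varsigma /log_moment /cumulant mulr1; field. Qed.

Lemma powR_gamma_ge (kappa gamma x : R) : 0 < kappa -> 0 <= x ->
  x `^ kappa <= gamma -> x <= gamma `^ kappa^-1.
Proof.
move=> k0 x0 xg; have -> : x = (x `^ kappa) `^ kappa^-1.
  by rewrite -powRrM divff ?gt_eqF// powRr1.
by rewrite ge0_ler_powR ?nnegrE ?powR_ge0 ?invr_ge0 ?(ltW k0) ?(le_trans (powR_ge0 _ _) xg).
Qed.

End parameters.

Theorem theorem8 (R : realType) (d : measure_display) (T : measurableType d)
    (P : probability T R)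
    (kappa delta lam gamma : R) (qs : nat) (b : R)
    (X : R -> T -> R) (Lj : nat -> R -> T -> R)
    (kappa01 : 0 < kappa < 1) (delta_gt0 : 0 < delta) (lam_gt0 : 0 < lam)
    (qs_ge2 : (2 <= qs)%N)
    (gamma_ge : Num.max ((2 * qs%:R) `^ kappa) (4 `^ kappa) <= gamma)
    (X_OU : stationary_OU P lam (tempered_stable kappa delta gamma) X)
    (L_meas : measurable_process
       (geometric_process (c_X kappa delta gamma) X))
    (L_sep : separable_process P
       (geometric_process (c_X kappa delta gamma) X))
    (Lj_copies : independent_copies P
       (geometric_process (c_X kappa delta gamma) X) Lj)
    (b_gt : b_bound kappa delta gamma qs < b) :
  exists A : R -> T -> R,
    [/\ forall t : R, 0 <= t <= 1 -> measurable_fun setT (A t)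
          /\ forall w, 0 <= A t w,
        forall (q : R) (t : R), Q_range kappa gamma qs q -> 0 <= t <= 1 ->
          ('E_P[fun w => (`|A_proc Lj b n t w - A t w| `^ q)%R]
             @[n --> \oo] --> 0)%E,
        forall q : R, Q_range kappa gamma qs q ->
          ('E_P[fun w => (`|A 1 w| `^ q)%R] < +oo)%E,
        forall q : R, Q_range kappa gamma qs q ->
          exists Clow Cup : R, 0 < Clow <= Cup /\
            forall t : R, 0 <= t <= 1 ->
              ((Clow * t `^ varsigma kappa delta gamma b q)%:E
                 <= 'E_P[fun w => (A t w `^ q)%R]
                 <= (Cup * t `^ varsigma kappa delta gamma b q)%:E)%E &
        exists M : R -> R,
          (forall t1 t2 : R, 0 <= t1 -> 0 <= t2 ->
             ((M (t1 - t2)%R)%:E = (expR (- 2 * c_X kappa delta gamma)%R)%:E *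
                'E_P[fun w => expR (X t1 w + X t2 w)%R])%E) /\
          forall t : R, 0 <= t <= 1 ->
            (\int[lebesgue_measure]_(w in `[0%R, t])
               \int[lebesgue_measure]_(u in `[0%R, t]) ((M (u - w) - 1)%R)%:E
             <= 'V_P[A t])%E].
Proof.
have /andP[k0 _] := kappa01.
have := gamma_ge; rewrite ge_max => /andP[gq _].
have gamma_ge0 : 0 <= gamma by apply: le_trans gq; exact: powR_ge0.
have p_le : 2 * qs%:R <= gamma `^ kappa^-1 by apply: powR_gamma_ge; rewrite // mulr_ge0.
have om_lt : expR (decay_rate kappa delta gamma qs) < b by rewrite -b_boundE.
have b1 := b_gt1 kappa01 delta_gt0 gamma_ge0 qs_ge2 p_le om_lt.
have lb : ln b != 0 by rewrite gt_eqF// ln_gt0.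
have qQ q : Q_range kappa gamma qs q -> 0 < q <= qs%:R by move=> [/andP[-> _] ->].
have H t : exists L : T -> R, 0 <= t <= 1 -> [/\ measurable_fun setT L, forall w, 0 <= L w &
      (\int[P]_w (`|total_mass Lj b n t w - L w| ^+ qs)%:E @[n --> \oo] --> 0)%E].
  (* The limit is chosen for each t separately; [cst 0] is a default value outside [0, 1]. *)
  have [t01|t01] := boolP (0 <= t <= 1); last by exists (cst 0).
  have [L HL] := limit_mass_exists kappa01 delta_gt0 lam_gt0 gamma_ge0 X_OU Lj_copies
    qs_ge2 p_le om_lt t01.
  by exists L.
have [A HA] := choice H.
have scaling q : 0 < q <= qs%:R -> exists Clow Cup : R, 0 < Clow <= Cup /\
    forall t : R, 0 <= t <= 1 ->
      ((Clow * t `^ varsigma kappa delta gamma b q)%:E <= \int[P]_w (A t w `^ q)%:E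
        <= (Cup * t `^ varsigma kappa delta gamma b q)%:E)%E.
  move=> q0p; rewrite varsigmaE//.
  have [Clow [Cup [Cl0 Cu0 HC]]] := total_mass_scaling kappa01 delta_gt0 lam_gt0 gamma_ge0 X_OU
    Lj_copies qs_ge2 p_le om_lt q0p.
  have Cl1 : 0 < 2 `^ (- q) * Clow by rewrite mulr_gt0// powR_gt0.
  have Cu1 : 0 < 2 `^ q * Cup by rewrite mulr_gt0// powR_gt0.
  (* The second summand of the upper constant only serves to make it at least the lower one. *)
  exists (2 `^ (- q) * Clow), (2 `^ q * Cup + 2 `^ (- q) * Clow); split.
    by rewrite Cl1 lerDr ltW.
  move=> t t01; have [mL L0 cvgL] := HA t t01; have /andP[t0 t1] := t01.
  (* At t = 0 all three terms vanish, the exponent being positive. *)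
  have [t0'|t0'] := eqVneq t 0.
    rewrite (limit_mass_at0 Lj_copies mL L0 cvgL q0p t0').
    have zq := zeta_gt0 kappa01 delta_gt0 gamma_ge0 qs_ge2 p_le om_lt q0p.
    by rewrite t0' powR0 ?gt_eqF// !mulr0 lexx.
  have tp : 0 < t by rewrite lt_def t0' t0.
  have [|N0 HN] := HC t; first by rewrite tp.
  have /andP[-> /le_trans->]// := limit_mass_scaling Lj_copies mL L0 cvgL q0p tp HN.
  by rewrite lee_fin ler_wpM2r ?powR_ge0// lerDl ltW.
exists A; split.
- by move=> t /HA[mL L0 _].
- move=> q t /qQ q0p t01; have [mL L0 cvgL] := HA t t01.
  exact: (A_proc_cvg kappa01 delta_gt0 gamma_ge0 Lj_copies qs_ge2 p_le om_lt mL cvgL q0p).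
- move=> q /qQ q0p; have t1 : 0 <= (1 : R) <= 1 by rewrite ler01 lexx.
  have [_ L0 _] := HA 1 t1; have [Clow [Cup [_ /(_ 1 t1)/andP[_ up]]]] := scaling q q0p.
  rewrite unlock; under eq_integral do rewrite ger0_norm//.
  by apply: le_lt_trans up _; exact: ltry.
- move=> q /qQ /scaling[Clow [Cup [C0 HC]]]; exists Clow, Cup; split=> // t t01.
  by rewrite unlock; exact: HC.
exists (two_point kappa delta lam gamma); split.
  move=> t1 t2 h1 h2; rewrite unlock.
  exact: (two_point_expectation kappa01 lam_gt0 gamma_ge0 X_OU qs_ge2 p_le h1 h2).
move=> t t01; have [mL L0 cvgL] := HA t t01.
apply: (limit_mass_variance kappa01 delta_gt0 lam_gt0 gamma_ge0 X_OU Lj_copies qs_ge2 p_le om_lt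
  t01 mL L0 cvgL).
have q2 : 0 < (2%:R : R) <= qs%:R by rewrite ltr0n ler_nat.
have [Clow [Cup [_ /(_ t t01)/andP[_ up]]]] := scaling 2%:R q2.
rewrite ge0_fin_numE; last by apply: integral_ge0 => w _; rewrite lee_fin sqr_ge0.
apply: le_lt_trans (ltry _); apply: le_trans up.
rewrite le_eqVlt; apply/orP; left; apply/eqP; apply: eq_integral => w _.
by rewrite powR_mulrn.
Qed.
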